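(* Let $\mathcal M=(\mathbf M^{(\lambda)})_{\lambda>0}$ be a weight matrix on $\mathbb N_0^d$. (Roumieu case) Assume $\mathcal M$ satisfies: - (R1) for every $\lambda>0$ there exist $\kappa\ge\lambda$ and $B,C,H>0$ such that $\alpha^{\alpha/2}M^{(\lambda)}_\beta\le B\,C^{|\alpha|}H^{|\alpha+\beta|}M^{(\kappa)}_{\alpha+\beta}$ for all $\alpha,\beta\in\mathbb N_0^d$; - (R2) for every $\lambda>0$ there exist $\kappa\ge\lambda$ and $A\ge1$ such that $M^{(\lambda)}_{\alpha+e_j}\le A^{|\alpha|+1}M^{(\kappa)}_\alpha$ for all $\alpha\in\mathbb N_0^d$ and $1\le j\le d$. Then the Hermite functions $(H_\gamma)_{\gamma\in\mathbb N_0^d}$ form an absolute Schauder basis of $\mathcal S_{\{\mathcal M\}}$. Moreover, the map $$T:\mathcal S_{\{\mathcal M\}}\to\Lambda_{\{\mathcal M\}},\qquad f\mapsto(\xi_\gamma(f))_{\gamma\in\mathbb N_0^d},\qquad \xi_\gamma(f):=\int_{\mathbb R^d}f(x)H_\gamma(x)\,dx,$$ is a (topological) isomorphism. (Beurling case) Assume $\mathcal M$ satisfies: - (B1) for every $\lambda>0$ there exist $0<\kappa\le\lambda$ and $H>0$ such that for every $C>0$ there is $B>0$ with $\alpha^{\alpha/2}M^{(\kappa)}_\beta\le B\,C^{|\alpha|}H^{|\alpha+\beta|}M^{(\lambda)}_{\alpha+\beta}$ for all $\alpha,\beta\in\mathbb N_0^d$; - (B2) for every $\lambda>0$ there exist $0<\kappa\le\lambda$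 and $A\ge1$ such that $M^{(\kappa)}_{\alpha+e_j}\le A^{|\alpha|+1}M^{(\lambda)}_\alpha$ for all $\alpha\in\mathbb N_0^d$ and $1\le j\le d$. Then the Hermite functions form an absolute Schauder basis of $\mathcal S_{(\mathcal M)}$, and the same map $T:\mathcal S_{(\mathcal M)}\to\Lambda_{(\mathcal M)}$ is a (topological) isomorphism.
   Context: A weight matrix is a family $\mathcal M=(\mathbf M^{(\lambda)})_{\lambda>0}$ with $\mathbf M^{(\lambda)}=(M^{(\lambda)}_\alpha)_{\alpha\in\mathbb N_0^d}$ sequences of positive reals, $M^{(\lambda)}_0=1$, and $M^{(\lambda)}_\alpha\le M^{(\kappa)}_\alpha$ for all $\alpha$ whenever $0<\lambda\le\kappa$. Notation: $|\alpha|=\alpha_1+\dots+\alpha_d$; $e_j$ is the $j$-th unit vector; $\alpha^{\alpha/2}:=\prod_{j}\alpha_j^{\alpha_j/2}$ with $0^0:=1$; $\alpha^{1/2}:=(\alpha_1^{1/2},\dots,\alpha_d^{1/2})$. For a sequence $\mathbf M=(M_\alpha)$ and $h>0$, $\|f\|_{\infty,\mathbf M,h}:=\sup_{\alpha,\beta\in\mathbb N_0^d}\frac{\|x^\alpha\partial^\beta f\|_\infty}{h^{|\alpha+\beta|}M_{\alpha+\beta}}$. $\mathcal S_{\{\mathcal M\}}$ is the set of $f\in C^\infty(\mathbb R^d)$ with $\|f\|_{\infty,\mathbf M^{(\lambda)},h}<\infty$ for some $\lambda,h>0$, with the inductive limit topology; $\mathcal S_{(\mathcal M)}$ is the set of $f\in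 C^\infty(\mathbb R^d)$ with $\|f\|_{\infty,\mathbf M^{(\lambda)},h}<\infty$ for all $\lambda,h>0$, with the projective limit topology. The associated weight function of $\mathbf M$ is $\omega_{\mathbf M}(t)=\sup_{\alpha\in\mathbb N^d_{0,t}}\log\frac{|t^\alpha|}{M_\alpha}$ for $t\in\mathbb R^d$, where $\mathbb N^d_{0,t}=\{\alpha:\alpha_j=0\text{ whenever }t_j=0\}$ and $0^0=1$. For $h>0$ put $\|\mathbf c\|_{\mathbf M,h}:=\sup_{\alpha}|c_\alpha|e^{\omega_{\mathbf M}(\alpha^{1/2}/h)}$. $\Lambda_{\{\mathcal M\}}$ is the space of $\mathbf c\in\mathbb C^{\mathbb N_0^d}$ with $\|\mathbf c\|_{\mathbf M^{(\lambda)},h}<\infty$ for some $\lambda,h>0$ (inductive limit topology over $j\in\mathbb N$ of the norms $\|\cdot\|_{\mathbf M^{(j)},j}$); $\Lambda_{(\mathcal M)}$ is the space of $\mathbf c$ with $\|\mathbf c\|_{\mathbf M^{(\lambda)},h}<\infty$ for all $\lambda,h>0$ (projective limit topology given by the norms $\|\cdot\|_{\mathbf M^{(1/j)},1/j}$, $j\in\mathbb N$). Hermite functions: $H_\gamma(x)=(2^{|\gamma|}\gamma!\pi^{d/2})^{-1/2}h_\gamma(x)e^{-|x|^2/2}$, with $h_\gamma(x)=(-1)^{|\gamma|}e^{|x|^2}\partial^\gamma e^{-|x|^2}$. *)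

(* Defs.v *)
From HB Require Import structures.
From mathcomp Require Import all_boot all_order all_algebra.
From mathcomp Require Import complex.
From mathcomp Require Import all_classical all_reals all_analysis.
Set Implicit Arguments. Unset Strict Implicit. Unset Printing Implicit Defensive.
Import Order.TTheory GRing.Theory Num.Theory.
Local Open Scope classical_set_scope.
Local Open Scope ring_scope.

Section HermiteDefs.
Variable R : realType.
Local Notation C := (complex R).

Definition mindex (d : nat) := {ffun 'I_d -> nat}.
Definition mlen d (a : mindex d) : nat := (\sum_(j < d) a j)%N.
Definition madd d (a b : mindex d) : mindex d := [ffun j => (a j + b j)%N].
Definition munit d (j : 'I_d) : mindex d := [ffun k => nat_of_bool (k == j)].
Definition mzero d : mindex d := [ffun _ => 0%N].
Definition mfact d (a : mindex d) : nat := (\prod_(j < d) (a j)`!)%N.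
(* alpha^{alpha/2} = prod_j alpha_j^{alpha_j/2}, with 0^0 = 1 *)
Definition mpow_half d (a : mindex d) : R :=
  \prod_(j < d) (Num.sqrt (a j)%:R) ^+ (a j).

Definition monom d (x : 'rV[R]_d) (a : mindex d) : R :=
  \prod_(j < d) (x ord0 j) ^+ (a j).
Definition sqnorm d (x : 'rV[R]_d) : R := \sum_(j < d) (x ord0 j) ^+ 2.

Definition weight_matrix d (M : R -> mindex d -> R) : Prop :=
  (forall l, 0 < l -> forall a, 0 < M l a) /\
  (forall l, 0 < l -> M l (mzero d) = 1) /\
  (forall l k, 0 < l -> l <= k -> forall a, M l a <= M k a).

Definition unitv d (j : 'I_d) : 'rV[R]_d := delta_mx ord0 j.
Definition pder d (j : 'I_d) (g : 'rV[R]_d -> R) : 'rV[R]_d -> R :=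
  fun x => derive g x (unitv j).
Definition pders d (b : mindex d) (g : 'rV[R]_d -> R) : 'rV[R]_d -> R :=
  foldr (fun j h => iter (b j) (pder j) h) g (enum 'I_d).
Definition smooth d (g : 'rV[R]_d -> R) : Prop :=
  forall (js : seq 'I_d) x, differentiable (foldr (@pder d) g js) x.

Definition cmod (z : C) : R := Num.sqrt (complex.Re z ^+ 2 + complex.Im z ^+ 2).
Definition reF d (f : 'rV[R]_d -> C) : 'rV[R]_d -> R := fun x => complex.Re (f x).
Definition imF d (f : 'rV[R]_d -> C) : 'rV[R]_d -> R := fun x => complex.Im (f x).
Definition smoothC d (f : 'rV[R]_d -> C) : Prop := smooth (reF f) /\ smooth (imF f).
Definition pdersC d (b : mindex d) (f : 'rV[R]_d -> C) : 'rV[R]_d -> C :=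
  fun x => Complex (pders b (reF f) x) (pders b (imF f) x).

(* ||f||_{infty,M,h} <= K, i.e. sup_{alpha,beta} ||x^alpha d^beta f||_infty
   / (h^{|alpha+beta|} M_{alpha+beta}) <= K  (sup unfolded) *)
Definition snorm_le d (Ml : mindex d -> R) (h K : R) (f : 'rV[R]_d -> C) : Prop :=
  forall (a b : mindex d) (x : 'rV[R]_d),
    `|monom x a| * cmod (pdersC b f x) <= K * h ^+ mlen (madd a b) * Ml (madd a b).

Definition SR d (M : R -> mindex d -> R) : set ('rV[R]_d -> C) :=
  [set f | smoothC f /\ exists l h K, 0 < l /\ 0 < h /\ snorm_le (M l) h K f].
Definition SB d (M : R -> mindex d -> R) : set ('rV[R]_d -> C) :=
  [set f | smoothC f /\ forall l h, 0 < l -> 0 < h -> exists K, snorm_le (M l) h K f].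

Definition omegaM d (Ml : mindex d -> R) (t : 'rV[R]_d) : \bar R :=
  ereal_sup [set (ln (`|monom t b| / Ml b))%:E |
             b in [set b : mindex d | forall j, t ord0 j = 0 -> b j = 0%N]].
Definition sqrt_idx d (a : mindex d) (h : R) : 'rV[R]_d :=
  \row_(j < d) (Num.sqrt (a j)%:R / h).
Definition lnorm_le d (Ml : mindex d -> R) (h K : R) (c : mindex d -> C) : Prop :=
  forall a, ((cmod (c a))%:E * expeR (omegaM Ml (sqrt_idx a h)) <= K%:E)%E.

Definition LR d (M : R -> mindex d -> R) : set (mindex d -> C) :=
  [set c | exists l h K, 0 < l /\ 0 < h /\ lnorm_le (M l) h K c].
Definition LB d (M : R -> mindex d -> R) : set (mindex d -> C) :=
  [set c | forall l h, 0 < l -> 0 < h -> exists K, lnorm_le (M l) h K c].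

(* ---------- locally convex topologies, described by their continuous
   seminorms ---------- *)
Definition seminorm_on (V : lmodType C) (E : set V) (p : V -> R) : Prop :=
  (forall x, E x -> 0 <= p x) /\
  (forall x y, E x -> E y -> p (x + y) <= p x + p y) /\
  (forall (k : C) x, E x -> p (k *: x) = cmod k * p x).

(* continuous seminorms of S_{M}: inductive limit over lambda, h > 0 *)
Definition csSR d (M : R -> mindex d -> R) (p : ('rV[R]_d -> C) -> R) : Prop :=
  seminorm_on (SR M) p /\
  forall l h, 0 < l -> 0 < h -> exists Cst : R,
    forall f K, SR M f -> snorm_le (M l) h K f -> p f <= Cst * K.
(* continuous seminorms of S_(M): projective limit over lambda, h > 0 *)
Definition csSB d (M : R -> mindex d -> R) (p : ('rV[R]_d -> C) -> R) : Prop :=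
  seminorm_on (SB M) p /\
  exists l h (Cst : R), 0 < l /\ 0 < h /\
    forall f K, SB M f -> snorm_le (M l) h K f -> p f <= Cst * K.
(* continuous seminorms of Lambda_{M}: inductive limit of ||.||_{M^(j),j} *)
Definition csLR d (M : R -> mindex d -> R) (p : (mindex d -> C) -> R) : Prop :=
  seminorm_on (LR M) p /\
  forall j : nat, (0 < j)%N -> exists Cst : R,
    forall c K, LR M c -> lnorm_le (M j%:R) j%:R K c -> p c <= Cst * K.
(* continuous seminorms of Lambda_(M): projective limit of ||.||_{M^(1/j),1/j} *)
Definition csLB d (M : R -> mindex d -> R) (p : (mindex d -> C) -> R) : Prop :=
  seminorm_on (LB M) p /\
  exists (j : nat) (Cst : R), (0 < j)%N /\
    forall c K, LB M c -> lnorm_le (M (j%:R^-1)) (j%:R^-1) K c -> p c <= Cst * K.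

Definition linear_on (V W : lmodType C) (E : set V) (T : V -> W) : Prop :=
  forall (k : C) x y, E x -> E y -> T (k *: x + y) = k *: T x + T y.

Definition lc_continuous (V W : lmodType C) (csE : (V -> R) -> Prop)
  (csF : (W -> R) -> Prop) (T : V -> W) : Prop :=
  forall q, csF q -> csE (q \o T).

Definition top_iso (V W : lmodType C) (E : set V) (csE : (V -> R) -> Prop)
  (F : set W) (csF : (W -> R) -> Prop) (T : V -> W) : Prop :=
  (forall x, E x -> F (T x)) /\ linear_on E T /\
  exists Tinv : W -> V,
    (forall y, F y -> E (Tinv y)) /\
    (forall x, E x -> Tinv (T x) = x) /\
    (forall y, F y -> T (Tinv y) = y) /\
    lc_continuous csE csF T /\ lc_continuous csF csE Tinv.

(* unconditional convergence of sum_i u i to x in (E, cs):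
   the net of finite partial sums converges to x *)
Definition sum_converges (I : eqType) (V : lmodType C) (cs : (V -> R) -> Prop)
  (u : I -> V) (x : V) : Prop :=
  forall p, cs p -> forall eps : R, 0 < eps ->
  exists F0 : seq I, forall F : seq I, uniq F -> {subset F0 <= F} ->
    p (x - \sum_(i <- F) u i) < eps.

Definition abs_schauder_basis (I : eqType) (V : lmodType C) (E : set V)
  (cs : (V -> R) -> Prop) (e : I -> V) : Prop :=
  (forall i, E (e i)) /\
  (forall x, E x -> exists c : I -> C,
      sum_converges cs (fun i => c i *: e i) x /\
      forall c' : I -> C, sum_converges cs (fun i => c' i *: e i) x -> c' = c) /\
  (* the coefficient functionals are continuous *)
  (forall i, exists p, cs p /\ forall x (c : I -> C), E x ->
      sum_converges cs (fun i => c i *: e i) x -> cmod (c i) <= p x) /\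
  (* absoluteness: sum_i |c_i(x)| p(e_i) < infinity for every continuous seminorm p *)
  (forall x (c : I -> C) p, E x -> sum_converges cs (fun i => c i *: e i) x ->
      cs p -> exists B : R, forall F : seq I, uniq F ->
        \sum_(i <- F) cmod (c i) * p (e i) <= B).

Definition hermite_poly d (g : mindex d) (x : 'rV[R]_d) : R :=
  (-1) ^+ mlen g * expR (sqnorm x) * pders g (fun y => expR (- sqnorm y)) x.
Definition hermite d (g : mindex d) (x : 'rV[R]_d) : R :=
  (Num.sqrt (2 ^+ mlen g * (mfact g)%:R * pi `^ (d%:R / 2)))^-1
  * hermite_poly g x * expR (- sqnorm x / 2).
Definition hermiteC d (g : mindex d) : 'rV[R]_d -> C :=
  fun x => (hermite g x)%:C%C.

(* ---------- Lebesgue integral over R^d (iterated one-dimensional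
   Lebesgue integrals) ---------- *)
Fixpoint iint (n : nat) : ('rV[R]_n -> R) -> R :=
  match n return ('rV[R]_n -> R) -> R with
  | 0 => fun f => f 0
  | n'.+1 => fun f =>
      Rintegral (@lebesgue_measure R) setT
        (fun t : R => iint (fun y : 'rV[R]_n' => f (row_mx (t%:M) y)))
  end.

Definition hcoef d (g : mindex d) (f : 'rV[R]_d -> C) : C :=
  Complex (iint (fun x => reF f x * hermite g x))
          (iint (fun x => imF f x * hermite g x)).
Definition hermiteT d (f : 'rV[R]_d -> C) : mindex d -> C :=
  fun g => hcoef g f.

Definition condR1 d (M : R -> mindex d -> R) : Prop :=
  forall l, 0 < l -> exists k B Cst H, l <= k /\ 0 < B /\ 0 < Cst /\ 0 < H /\
    forall a b : mindex d,
      mpow_half a * M l b <= B * Cst ^+ mlen a * H ^+ mlen (madd a b) * M k (madd a b).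
Definition condR2 d (M : R -> mindex d -> R) : Prop :=
  forall l, 0 < l -> exists k A, l <= k /\ 1 <= A /\
    forall (a : mindex d) (j : 'I_d),
      M l (madd a (munit j)) <= A ^+ (mlen a).+1 * M k a.
Definition condB1 d (M : R -> mindex d -> R) : Prop :=
  forall l, 0 < l -> exists k H, 0 < k /\ k <= l /\ 0 < H /\
    forall Cst, 0 < Cst -> exists B, 0 < B /\
      forall a b : mindex d,
        mpow_half a * M k b <= B * Cst ^+ mlen a * H ^+ mlen (madd a b) * M l (madd a b).
Definition condB2 d (M : R -> mindex d -> R) : Prop :=
  forall l, 0 < l -> exists k A, 0 < k /\ k <= l /\ 1 <= A /\
    forall (a : mindex d) (j : 'I_d),
      M k (madd a (munit j)) <= A ^+ (mlen a).+1 * M l a.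

End HermiteDefs.

(* Main.v *)
Require Import Defs.
From HB Require Import structures.
From mathcomp Require Import all_boot all_order all_algebra.
From mathcomp Require Import complex.
From mathcomp Require Import all_classical all_reals all_analysis.
From mathcomp Require Import measurable_realfun.
From mathcomp Require Import ring lra zify.
Set Implicit Arguments. Unset Strict Implicit. Unset Printing Implicit Defensive.
Import Order.TTheory GRing.Theory Num.Theory.
Import numFieldNormedType.Exports.
Local Open Scope classical_set_scope.
Local Open Scope ring_scope.

(** With the raising operators [A_j = x_j - d_j], partial integration gives
    [xi_(g+b) (A^b f) = sqrt (2^|b| (g+b)! / g!) xi_g f], so [g^(b/2) |xi_g f|] is at
    most a weighted sup norm of [A^b f].  Expanding [A^b] produces terms [x^p d^q f] with
    [p + q = b - 2k] and coefficients of size [b^k]; the first condition on the weights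
    trades [b^k M_(b-2k)] for [M_b], and the second one pays for the integration weight.
    This bounds [T].

    Conversely, the ladder relations bound [x^a d^b H_g] by [(g + a + b)^((a+b)/2)] up to
    geometric and polynomial factors.  Where [g_j] dominates, this is compensated by the
    decay of the coefficients, where [a_j + b_j] dominates, by the first condition; the
    second condition yields the extra decay that makes [sum_g c_g H_g] converge absolutely
    in the space.  Hence [T] is invertible as soon as a function in the space with
    vanishing Hermite coefficients is 0.  Such a function annihilates every polynomial times
    [e^(-t^2/2)], hence by power series expansion all narrow Gaussians, hence is 0.

    All integrals are iterated one-dimensional ones, handled on a class of functions that
    are Lipschitz in each variable and dominated by [prod_j 1/(1+x_j^2)]. *)

(** * Partial derivatives *)

(** Both cases rest on the same two norm estimates, stated for three weights [N], [N'], [N''] with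
    explicit constants: passing from [N] to [N'] spends the first condition, from [N'] to [N''] the
    second. The Roumieu case picks the target from the source; the Beurling case picks the source
    from the target, and there the free constant in the first condition lets h be adjusted to hit a
    prescribed target exactly. Losses that are geometric in the order are absorbed by h, so sharp
    bounds are never sought: the sup norm of the Hermite functions is bounded polynomially, and
    polynomial losses cost at most six extra orders per coordinate. These are paid by iterating the
    second condition a fixed number of times; only a fixed number keeps its cost geometric. A basis
    requires unconditional convergence and absoluteness besides continuity of the inverse of T. All
    three come from a single bound on the Hermite series of c that is linear in the mass of the
    support of c under the summable weight [w2]: the whole index set, a tail, or a single index. *)

Section Calculus.
Variables (R : realType) (d : nat).
Implicit Types (g f : 'rV[R]_d -> R) (x v : 'rV[R]_d).

Lemma rV_sum_unitv v : v = \sum_(j < d) v ord0 j *: unitv R j.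
Proof. exact: row_sum_delta. Qed.

Lemma le_coord_norm v j : `|v ord0 j| <= `|v|.
Proof. by rewrite [leRHS]/Num.norm /= mx_normrE; apply/bigmax_geP; right; exists (ord0, j). Qed.

Lemma is_derive_line g x v t : derivable g (x + t *: v) v ->
  is_derive t (1 : R) (fun s => g (x + s *: v)) ('D_v g (x + t *: v)).
Proof.
move=> dg.
have E : (fun h : R => h^-1 *: (((fun s => g (x + s *: v)) \o shift t) (h *: 1)
            - g (x + t *: v))) =
  (fun h : R => h^-1 *: ((g \o shift (x + t *: v)) (h *: v) - g (x + t *: v))).
  apply/funext => h /=; congr (_ *: (g _ - _)).
  by rewrite [h *: 1]mulr1 scalerDl addrCA.
by split; [rewrite /derivable E|rewrite /derive E].
Qed.

Lemma MVT_line g x v : (forall t, derivable g (x + t *: v) v) ->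
  exists2 t : R, 0 <= t <= 1 & g (x + v) - g x = 'D_v g (x + t *: v).
Proof.
move=> dg.
have Hd t := is_derive_line (dg t).
have cg : {within `[0, 1], continuous (fun s => g (x + s *: v))}.
  apply: continuous_subspaceT => t.
  by apply: differentiable_continuous; apply/derivable1_diffP; case: (Hd t).
have [t tin] := MVT_segment ler01 (fun t _ => Hd t) cg.
rewrite scale1r scale0r addr0 subr0 mulr1 => E.
by exists t => //; move: tin; rewrite in_itv.
Qed.

Lemma derive_pder g x v : differentiable g x ->
  'D_v g x = \sum_(j < d) v ord0 j * pder j g x.
Proof.
move=> dg; rewrite deriveE // {1}[v]rV_sum_unitv linear_sum.
by apply: eq_bigr => j _; rewrite linearZ /= /pder deriveE.
Qed.

Lemma MVT_pder g x v : (forall y, differentiable g y) ->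
  exists2 t : R, 0 <= t <= 1 &
    g (x + v) - g x = \sum_(j < d) v ord0 j * pder j g (x + t *: v).
Proof.
move=> dg; have [|t t01 E] := @MVT_line g x v.
  by move=> t; apply: diff_derivable; exact: dg.
by exists t => //; rewrite E derive_pder.
Qed.

Lemma derive_scale g x v (c : R) : differentiable g x ->
  'D_(c *: v) g x = c * 'D_v g x.
Proof. by move=> dg; rewrite !deriveE // linearZ. Qed.

Lemma MVT_coord g x j (s : R) : (forall y, differentiable g y) ->
  exists2 t : R, 0 <= t <= 1 &
    g (x + s *: unitv R j) - g x = s * pder j g (x + (t * s) *: unitv R j).
Proof.
move=> dg; have [|t t01 E] := @MVT_line g x (s *: unitv R j).
  by move=> t; apply: diff_derivable; exact: dg.
by exists t => //; rewrite E derive_scale // scalerA.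
Qed.

(** The mean value theorem is used twice, without care for the constant. What matters is a remainder
    controlled by a bound on the second derivatives only, since such remainders can be summed over a
    series. *)
Lemma taylor2 g x v (c : R) : (forall y, differentiable g y) ->
  (forall j y, differentiable (pder j g) y) ->
  (forall i j y, `|pder i (pder j g) y| <= c) ->
  `|g (x + v) - g x - \sum_(j < d) v ord0 j * pder j g x| <= d%:R ^+ 2 * c * `|v| ^+ 2.
Proof.
move=> dg dpg Hc; have [t /andP[t0 t1] ->] := MVT_pder x v dg.
rewrite -sumrB; apply: le_trans (ler_norm_sum _ _ _) _.
have Hj j : `|v ord0 j * pder j g (x + t *: v) - v ord0 j * pder j g x|
            <= `|v| * (d%:R * (`|v| * c)).
  rewrite -mulrBr normrM; apply: ler_pM => //; first exact: le_coord_norm.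
  have [s /andP[s0 s1] ->] := MVT_pder x (t *: v) (dpg j).
  apply: le_trans (ler_norm_sum _ _ _) _.
  apply: (@le_trans _ _ (\sum_(i < d) `|v| * c)).
    apply: ler_sum => i _; rewrite normrM; apply: ler_pM => //.
    rewrite mxE normrM (ger0_norm t0).
    by apply: le_trans (le_coord_norm v i); apply: ler_piMl.
  by rewrite sumr_const card_ord mulr_natl.
apply: le_trans (ler_sum _ (fun j _ => Hj j)) _.
by rewrite sumr_const card_ord -[leLHS]mulr_natl le_eqVlt; apply/orP; left; apply/eqP; ring.
Qed.

(** A converse to [taylor2]. A quadratic remainder survives summation of a series, so this yields
    differentiability of the sum together with its partial derivatives. *)
Lemma quadratic_remainder_differentiable f (l : 'I_d -> R) x (c : R) :
  (forall v, `|f (x + v) - f x - \sum_(j < d) v ord0 j * l j| <= c * `|v| ^+ 2) ->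
  differentiable f x /\ (forall j, pder j f x = l j).
Proof.
move=> Hf.
pose L (v : 'rV[R]_d) : R := (v *m (\col_j l j)) ord0 ord0.
have LE v : L v = \sum_(j < d) v ord0 j * l j.
  by rewrite /L mxE; apply: eq_bigr => j _; rewrite mxE.
have linL : linear L by move=> a u v; rewrite /L mulmxDl -scalemxAl !mxE.
pose Lm := GRing.isLinear.Build _ _ _ _ L linL.
pose LL : {linear 'rV[R]_d -> R} := HB.pack L Lm.
have cL : continuous LL.
  apply: bounded_linear_continuous; apply/linear_boundedP.
  near=> M => v /=; rewrite LE; apply: le_trans (ler_norm_sum _ _ _) _.
  apply: (@le_trans _ _ ((\sum_(j < d) `|l j|) * `|v|)).
    rewrite mulr_suml; apply: ler_sum => j _; rewrite normrM mulrC.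
    by apply: ler_wpM2l => //; exact: le_coord_norm.
  by apply: ler_wpM2r.
have Ho : f \o shift x = cst (f x) + (LL : _ -> _) +o_ (0 : 'rV[R]_d) id.
  apply/eqaddoP => _/posnumP[e] /=.
  have [c0|c0] := lerP c 0; near=> v;
  rewrite /= opprD -![(_ + _ : _ -> _) _]/(_ + _) -![(- _ : _ -> _) _]/(- _) /=
    addrA [v + x]addrC LE; apply: le_trans (Hf v) _;
  rewrite expr2 mulrA; apply: ler_wpM2r => //.
    by apply: (@le_trans _ _ 0) => //; apply: mulr_le0_ge0.
  rewrite mulrC -ler_pdivlMr //.
  near: v; apply/nbhs_ballP; exists (e%:num / c) => /=; first by rewrite divr_gt0.
  by move=> v; rewrite -ball_normE /= sub0r normrN => /ltW.
have dE := diff_unique cL Ho.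
have df : differentiable f x.
  apply/diff_locallyP; split; first by rewrite dE.
  by rewrite dE.
split=> // j; rewrite /pder deriveE // dE /= LE (bigD1 j) //= mxE !eqxx mul1r.
rewrite big1 ?addr0 // => i ij; rewrite mxE (negPf ij).
by rewrite mul0r.
Unshelve. all: by end_near. Qed.

Lemma derive_translate g x v c : 'D_v (fun y => g (y + c)) x = 'D_v g (x + c).
Proof.
rewrite /derive.
have -> // : (fun h : R => h^-1 *: (((fun y => g (y + c)) \o shift x) (h *: v) - g (x + c)))
  = (fun h : R => h^-1 *: ((g \o shift (x + c)) (h *: v) - g (x + c))).
by apply/funext => h /=; rewrite addrA.
Qed.

(* Both mixed derivatives are the limit of the same second difference quotient. *)
Lemma pder_comm g i j x : (forall y, differentiable g y) ->
  (forall k y, differentiable (pder k g) y) ->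
  pder i (pder j g) x = pder j (pder i g) x.
Proof.
move=> dg dpg.
suff H k l : forall e : R, 0 < e -> \forall s \near 0^'+,
   `|(g (x + s *: unitv R k + s *: unitv R l) - g (x + s *: unitv R k)
      - g (x + s *: unitv R l) + g x) / s ^+ 2 - pder l (pder k g) x| <= e.
  have K e : 0 < e -> `|pder i (pder j g) x - pder j (pder i g) x| <= e.
    move=> e0; have e2 : 0 < e / 2 by rewrite divr_gt0.
    have F : Filter (nbhs (0 : R)^'+) by exact: at_right_proper_filter.
    have [s [/= H1 H2]] := @filter_ex _ _ (at_right_proper_filter (0 : R)) _
      (@filterI _ _ F _ _ (H i j _ e2) (H j i _ e2)).
    have E : g (x + s *: unitv R i + s *: unitv R j) - g (x + s *: unitv R i)
        - g (x + s *: unitv R j) + g x =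
      g (x + s *: unitv R j + s *: unitv R i) - g (x + s *: unitv R j)
        - g (x + s *: unitv R i) + g x by rewrite (addrAC x); ring.
    move: H1 H2; rewrite E; set q := _ / s ^+ 2.
    move: (pder i (pder j g) x) (pder j (pder i g) x) => p1 p2; clear -q e; clearbody q.
    by rewrite !ler_norml => /andP[? ?] /andP[? ?]; lra.
  apply/eqP; rewrite -subr_eq0 -normr_le0; apply/ler_addgt0Pr => e e0.
  by rewrite add0r; exact: K.
move=> e e0.
have /diff_locally /eqaddoP := dpg k x.
have e40 : 0 < e / 4 by rewrite divr_gt0.
move=> /(_ _ e40) /= /nbhs_ballP[r /= r0 Hr].
near=> s.
have s0 : 0 < s by [].
have sr : 2 * s < r.
  rewrite mulrC -ltr_pdivlMr //; near: s; apply: nbhs_right_lt; rewrite divr_gt0 //.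
(* [G] is the increment of [g] in direction l. The mean value theorem in direction k leaves an
   increment of [pder k g] between two points within 2s of x; differentiability of [pder k g] at x
   is applied at both, with error e/4 times 2s each. *)
pose G y := g (y + s *: unitv R l) - g y.
have dG y : differentiable G y.
  apply: differentiableB => //.
  by apply: (@differentiable_comp _ _ _ _ (fun z => z + s *: unitv R l) g) => //.
have [t /andP[t0 t1]] := MVT_coord x k s dG.
have -> : pder k G (x + (t * s) *: unitv R k) =
   pder k g (x + (t * s) *: unitv R k + s *: unitv R l) - pder k g (x + (t * s) *: unitv R k).
  rewrite /pder /G deriveB; last 2 first.
  - apply: diff_derivable.
    by apply: (@differentiable_comp _ _ _ _ (fun z => z + s *: unitv R l) g) => //.
  - exact: diff_derivable.
  by congr (_ - _); exact: derive_translate.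
rewrite /G => E.
have -> : g (x + s *: unitv R k + s *: unitv R l) - g (x + s *: unitv R k) -
     g (x + s *: unitv R l) + g x = s *
    (pder k g (x + (t * s) *: unitv R k + s *: unitv R l) - pder k g (x + (t * s) *: unitv R k)).
  by rewrite -E; ring.
have nu q : `|unitv R q| <= 1.
  rewrite [leLHS]/Num.norm /= mx_normrE; apply/bigmax_leP; split=> //= -[a b] _ /=.
  by rewrite mxE; case: andP; rewrite ?normr1 ?normr0.
have Hball v : `|v| <= 2 * s -> `|pder k g (x + v) - pder k g x - 'd (pder k g) x v| <= e / 4 * (2 * s).
  move=> vs; have : ball (0 : 'rV[R]_d) r v by rewrite -ball_normE /= sub0r normrN (le_lt_trans vs).
  move=> /Hr /=; rewrite opprD -![(_ + _ : _ -> _) _]/(_ + _) -![(- _ : _ -> _) _]/(- _) /=.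
  rewrite addrA [v + x]addrC => /le_trans; apply.
  by apply: ler_wpM2l => //; exact: ltW.
have n1 : `|(t * s) *: unitv R k| <= s.
  rewrite normrZ normrM (ger0_norm t0) (gtr0_norm s0).
  apply: (@le_trans _ _ (t * s * 1)); first by apply: ler_wpM2l; [rewrite mulr_ge0 // ltW|exact: nu].
  by rewrite mulr1 ler_piMl // ltW.
have n2 : `|s *: unitv R l| <= s.
  by rewrite normrZ (gtr0_norm s0) ler_piMr ?nu // ltW.
have B1 := Hball ((t * s) *: unitv R k).
have B2 := Hball ((t * s) *: unitv R k + s *: unitv R l).
have {}B1 : `|pder k g (x + (t * s) *: unitv R k) - pder k g x - 'd (pder k g) x ((t * s) *: unitv R k)| <= e / 4 * (2 * s).
  by apply: B1; apply: (le_trans n1); lra.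
have {}B2 : `|pder k g (x + ((t * s) *: unitv R k + s *: unitv R l)) - pder k g x - 'd (pder k g) x ((t * s) *: unitv R k + s *: unitv R l)| <= e / 4 * (2 * s).
  by apply: B2; apply: (le_trans (ler_normD _ _)); lra.
have -> : pder l (pder k g) x = 'd (pder k g) x (s *: unitv R l) / s.
  by rewrite linearZ /= mulrAC mulfV ?mul1r ?gt_eqF // {1}/pder deriveE.
have sn0 : s != 0 by rewrite gt_eqF.
rewrite expr2 invfM mulrA [s * _]mulrC mulfK // -mulrBl normrM normfV (gtr0_norm s0).
rewrite ler_pdivrMr // -[x + _ + _]addrA; move: B1 B2; rewrite linearD /=.
set p1 := pder k g _; set p2 := pder k g _; set p3 := pder k g _.
set p4 : R := 'd _ _ _; set p5 : R := 'd _ _ _; set q := e / 4 * (2 * s).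
have qE : 2 * q = e * s by rewrite /q; field.
rewrite -qE; move: p4 p5 (q) => p4 p5 {qE}q.
clearbody p1 p2 p3; clear.
by rewrite !ler_norml => /andP[? ?] /andP[? ?]; apply/andP; split; lra.
Unshelve. all: by end_near. Qed.

End Calculus.

(** * Smooth functions and Schwartz functions *)

Section Smooth.
Variables (R : realType) (d : nat).
Implicit Types (f g u : 'rV[R]_d -> R) (x v : 'rV[R]_d) (js ks : seq 'I_d) (a b : mindex d).

Definition dl js g := foldr (@pder R d) g js.

Arguments dl : simpl never.

Lemma dl_cons j js g : dl (j :: js) g = pder j (dl js g).
Proof. by []. Qed.

Lemma dl_rcons js j g : dl (rcons js j) g = dl js (pder j g).
Proof. by rewrite /dl -cats1 foldr_cat. Qed.

Lemma dl_cat js ks g : dl (js ++ ks) g = dl js (dl ks g).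
Proof. by rewrite /dl foldr_cat. Qed.

Lemma smooth_diff g x : smooth g -> differentiable g x.
Proof. by move=> /(_ [::]). Qed.

Lemma smooth_pder j g : smooth g -> smooth (pder j g).
Proof. by move=> sg js x; rewrite -/(dl js _) -dl_rcons; exact: sg. Qed.

Lemma smooth_dl js g : smooth g -> smooth (dl js g).
Proof. by move=> sg; elim: js => //= j js; exact: smooth_pder. Qed.

(** Smoothness is the largest class of differentiable functions stable under partial derivatives, so
    it is enough to exhibit one such class containing [g]. *)
Lemma smooth_coind (S : ('rV[R]_d -> R) -> Prop) :
  (forall g x, S g -> differentiable g x) -> (forall g j, S g -> S (pder j g)) ->
  forall g, S g -> smooth g.
Proof.
move=> Sd Sp g Sg js x; apply: Sd.
by elim: js => //= j js; exact: Sp.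
Qed.

Lemma pder_swap i j g : smooth g -> pder i (pder j g) = pder j (pder i g).
Proof.
move=> sg; apply/funext => x; apply: pder_comm => [y|k y]; first exact: smooth_diff.
by apply: smooth_diff; exact: smooth_pder.
Qed.

Lemma dl_rem j js g : smooth g -> j \in js -> dl js g = pder j (dl (rem j js) g).
Proof.
move=> sg; elim: js => //= k js IH; rewrite inE eq_sym; case: eqVneq => [->|kj] /= jin.
  by rewrite dl_cons.
by rewrite !dl_cons (IH jin) (pder_swap k j (smooth_dl (rem j js) sg)).
Qed.

Lemma dl_perm js ks g : smooth g -> perm_eq js ks -> dl js g = dl ks g.
Proof.
move=> sg; elim: js ks => [|j js IH] ks p.
  by move/perm_size: p => /esym/size0nil ->.
have jin : j \in ks by rewrite -(perm_mem p) mem_head.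
rewrite (dl_rem sg jin) dl_cons (IH (rem j ks)) // -(perm_cons j).
by apply: perm_trans p _; exact: perm_to_rem.
Qed.

(** The directions in the order in which [pders] uses them. Lists can be permuted and extended by
    one direction at a time, which multi-indices do not allow directly. *)
Definition mlist b : seq 'I_d := flatten [seq nseq (b j) j | j <- enum 'I_d].
Definition mcnt js : mindex d := [ffun j => count_mem j js].

Lemma count_mlist b j : count_mem j (mlist b) = b j.
Proof.
rewrite /mlist count_flatten -map_comp sumnE big_map big_enum /= (bigD1 j) //=.
rewrite count_nseq /= eqxx mul1n big1 ?addn0 // => i ij.
by rewrite count_nseq /= (negPf ij).
Qed.

Lemma mcnt_mlist b : mcnt (mlist b) = b.
Proof. by apply/ffunP => j; rewrite ffunE count_mlist. Qed.

Lemma pdersE b g : pders b g = dl (mlist b) g.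
Proof.
rewrite /pders /mlist; elim: (enum 'I_d) => //= j s ->; rewrite dl_cat.
by elim: (b j) => //= n ->.
Qed.

Lemma pders_mzero g : pders (Defs.mzero d) g = g.
Proof.
rewrite pdersE /mlist (_ : flatten _ = [::]) //.
by elim: (enum 'I_d) => //= j s ->; rewrite ffunE.
Qed.

Lemma dl_pders js g : smooth g -> dl js g = pders (mcnt js) g.
Proof.
move=> sg; rewrite pdersE; apply: dl_perm => //; apply/allP => j _ /=.
by rewrite count_mlist ffunE eqxx.
Qed.

Lemma pders_munit b j g : smooth g -> pders b (pder j g) = pders (madd b (munit j)) g.
Proof.
move=> sg; rewrite pdersE -dl_rcons dl_pders //; congr pders; apply/ffunP => k.
by rewrite !ffunE -cats1 count_cat count_mlist /= addn0 eq_sym.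
Qed.

Lemma pderD j f g : smooth f -> smooth g ->
  pder j (fun x => f x + g x) = (fun x => pder j f x + pder j g x).
Proof.
move=> sf sg; apply/funext => x; apply: deriveD; apply: diff_derivable; exact: smooth_diff.
Qed.

Lemma pderZ j (c : R) f : smooth f -> pder j (fun x => c * f x) = (fun x => c * pder j f x).
Proof.
move=> sf; apply/funext => x; apply: deriveZ; apply: diff_derivable; exact: smooth_diff.
Qed.

Lemma pderM j f g : smooth f -> smooth g ->
  pder j (fun x => f x * g x) = (fun x => f x * pder j g x + pder j f x * g x).
Proof.
move=> sf sg; apply/funext => x; rewrite /pder.
rewrite (@deriveM _ _ f g); try by apply: diff_derivable; exact: smooth_diff.
by rewrite /GRing.scale /= [g x * _]mulrC.
Qed.

Lemma smooth_add f g : smooth f -> smooth g -> smooth (fun x => f x + g x).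
Proof.
move=> sf sg.
apply: (@smooth_coind (fun u => exists f g, [/\ smooth f, smooth g & u = (fun x => f x + g x)])).
- by move=> u x [f' [g' [sf' sg' ->]]]; apply: differentiableD; exact: smooth_diff.
- move=> u j [f' [g' [sf' sg' ->]]]; exists (pder j f'), (pder j g').
  by split; [exact: smooth_pder|exact: smooth_pder|exact: pderD].
- by exists f, g.
Qed.

Lemma smooth_scale (c : R) f : smooth f -> smooth (fun x => c * f x).
Proof.
move=> sf; apply: (@smooth_coind (fun u => exists2 f, smooth f & u = (fun x => c * f x))).
- by move=> u x [f' sf' ->]; apply: differentiableZ; exact: smooth_diff.
- move=> u j [f' sf' ->]; exists (pder j f'); [exact: smooth_pder|exact: pderZ].
- by exists f.
Qed.

(** The Leibniz rule turns one product into a sum of two, so products alone do not form a class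
    stable under [pder]; sums of products do. This is the invariant fed to the coinduction
    principles. *)
Inductive prodspan (S : ('rV[R]_d -> R) -> Prop) : ('rV[R]_d -> R) -> Prop :=
| prodspan_mul f g : S f -> S g -> prodspan S (fun x => f x * g x)
| prodspan_add f g : prodspan S f -> prodspan S g -> prodspan S (fun x => f x + g x).

Lemma smooth_prodspan f : prodspan (@smooth R d) f -> smooth f.
Proof.
have D u x : prodspan (@smooth R d) u -> differentiable u x.
  elim=> [f1 f2 s1 s2|f1 f2 _ s1 _ s2]; last exact: differentiableD.
  by apply: differentiableM; exact: smooth_diff.
suff P u : prodspan (@smooth R d) u -> (smooth u /\ forall j, prodspan (@smooth R d) (pder j u)).
  by move=> /P[].
have Q w : prodspan (@smooth R d) w -> forall j, prodspan (@smooth R d) (pder j w).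
  elim=> [f1 f2 s1 s2 j|f1 f2 p1 IH1 p2 IH2 j].
    rewrite pderM //; apply: prodspan_add; apply: prodspan_mul => //; exact: smooth_pder.
  have -> : pder j (fun x => f1 x + f2 x) = (fun x => pder j f1 x + pder j f2 x).
    by apply/funext => x; apply: deriveD; apply: diff_derivable; exact: D.
  exact: prodspan_add.
by move=> pu; split; [exact: (smooth_coind D (fun g j pg => Q g pg j))|exact: Q].
Qed.

Lemma smooth_mul f g : smooth f -> smooth g -> smooth (fun x => f x * g x).
Proof. by move=> sf sg; apply: smooth_prodspan; exact: prodspan_mul. Qed.

Lemma pder_cst j (c : R) : pder j (fun _ : 'rV[R]_d => c) = (fun _ => 0).
Proof. by apply/funext => x; exact: derive_cst. Qed.

Lemma smooth_cst (c : R) : smooth (fun _ : 'rV[R]_d => c).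
Proof.
apply: (@smooth_coind (fun u => exists c, u = (fun=> c))); last by exists c.
  by move=> u x [? ->]; exact: differentiable_cst.
by move=> u j [? ->]; rewrite pder_cst; exists 0.
Qed.

Lemma pder_coord i j : pder i (fun x : 'rV[R]_d => x ord0 j) = (fun _ => (i == j)%:R).
Proof.
apply/funext => x; rewrite /pder deriveE; last exact: differentiable_coord.
have cc : continuous (fun x : 'rV[R]_d => x ord0 j).
  by move=> y; apply: differentiable_continuous; exact: differentiable_coord.
have lin : linear (fun x : 'rV[R]_d => x ord0 j : R) by move=> c u w; rewrite !mxE.
pose Lm := GRing.isLinear.Build _ _ _ _ _ lin.
pose LL : {linear 'rV[R]_d -> R} := HB.pack (fun x : 'rV[R]_d => x ord0 j : R) Lm.
have -> := @diff_lin _ _ _ LL x cc.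
by rewrite /= mxE eqxx /= eq_sym.
Qed.

Lemma smooth_coord j : smooth (fun x : 'rV[R]_d => x ord0 j).
Proof.
apply: (@smooth_coind (fun u => u = (fun x => x ord0 j) \/ smooth u)); last by left.
  by move=> u x [->|]; [exact: differentiable_coord|exact: smooth_diff].
move=> u i [->|su]; right; last exact: smooth_pder.
by rewrite pder_coord; exact: smooth_cst.
Qed.

Lemma dlD js f g : smooth f -> smooth g ->
  dl js (fun x => f x + g x) = (fun x => dl js f x + dl js g x).
Proof. by move=> sf sg; elim: js => // j js IH; rewrite !dl_cons IH pderD //; exact: smooth_dl. Qed.

Lemma dlZ js (c : R) f : smooth f -> dl js (fun x => c * f x) = (fun x => c * dl js f x).
Proof. by move=> sf; elim: js => // j js IH; rewrite !dl_cons IH pderZ //; exact: smooth_dl. Qed.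

(** The commutator of multiplication by x_j with derivatives. If j does not occur in [js], then
    [rem j js] is [js] itself, but its coefficient is 0. *)
Lemma dl_coord js j u : smooth u -> dl js (fun x => x ord0 j * u x) =
  (fun x => x ord0 j * dl js u x + (count_mem j js)%:R * dl (rem j js) u x).
Proof.
move=> su; elim: js => [|k js IH] /=; first by apply/funext => x; rewrite mul0r addr0.
have s1 := smooth_coord j; have s2 := smooth_dl js su.
rewrite !dl_cons IH pderD; last 2 first.
- exact: smooth_mul.
- by apply: smooth_scale; exact: smooth_dl.
rewrite pderM // pderZ; last exact: smooth_dl.
rewrite pder_coord; apply/funext => x; rewrite natrD; case: eqVneq => [->|kj] /=.
  have [jin|jn] := boolP (j \in js).
    by rewrite -(dl_rem su jin); ring.
  by rewrite (count_memPn jn); ring.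
by rewrite dl_cons; ring.
Qed.

Lemma smooth_pders_coord b j u : smooth u -> pders b (fun x => x ord0 j * u x) =
  (fun x => x ord0 j * pders b u x
     + (b j)%:R * pders [ffun k => (b k - (k == j))%N] u x).
Proof.
move=> su; rewrite !pdersE dl_coord // count_mlist; apply/funext => x; congr (_ + _ * _).
rewrite dl_pders // pdersE; congr (dl (mlist _) u x); apply/ffunP => k.
rewrite !ffunE; have [jin|jn] := boolP (j \in mlist b).
  have /permP /(_ (pred1 k)) := perm_to_rem jin; rewrite /= count_mlist => ->.
  by rewrite eq_sym addKn.
rewrite rem_id // count_mlist; case: eqVneq => [->|]; last by rewrite subn0.
by move/count_memPn: jn; rewrite count_mlist => ->.
Qed.

Lemma monom_madd x a b : monom x (madd a b) = monom x a * monom x b.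
Proof. by rewrite /monom -big_split; apply: eq_bigr => j _; rewrite ffunE exprD. Qed.

Lemma monom_munit x j : monom x (munit j) = x ord0 j.
Proof.
rewrite /monom (bigD1 j) //= ffunE eqxx expr1 big1 ?mulr1 // => i ij.
by rewrite ffunE (negPf ij) expr0.
Qed.

Lemma monom_mzero x : monom x (Defs.mzero d) = 1.
Proof. by rewrite /monom big1 // => j _; rewrite ffunE expr0. Qed.

Definition rdec f := forall a, exists K, forall x, `|monom x a| * `|f x| <= K.

Lemma rdec_add f g : rdec f -> rdec g -> rdec (fun x => f x + g x).
Proof.
move=> rf rg a; have [K HK] := rf a; have [L HL] := rg a; exists (K + L) => x.
apply: le_trans (lerD (HK x) (HL x)); rewrite -mulrDr.
by apply: ler_wpM2l => //; exact: ler_normD.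
Qed.

Lemma rdec_scale (c : R) f : rdec f -> rdec (fun x => c * f x).
Proof.
move=> rf a; have [K HK] := rf a; exists (`|c| * K) => x.
by rewrite normrM mulrCA; apply: ler_wpM2l.
Qed.

Lemma rdec_mul f g : rdec f -> rdec g -> rdec (fun x => f x * g x).
Proof.
move=> rf rg a; have [K HK] := rf a; have [L HL] := rg (Defs.mzero d); exists (K * L) => x.
rewrite normrM mulrA; apply: ler_pM => //.
by have := HL x; rewrite monom_mzero normr1 mul1r.
Qed.

Lemma rdec_coord j f : rdec f -> rdec (fun x => x ord0 j * f x).
Proof.
move=> rf a; have [K HK] := rf (madd a (munit j)); exists K => x.
by have := HK x; rewrite monom_madd monom_munit !normrM mulrA.
Qed.

(** The real Schwartz space. Indexing derivatives by lists makes stability under [pder] immediate;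
    [schP] translates to multi-indices. *)
Definition sch g := smooth g /\ forall js, rdec (dl js g).

Lemma sch_smooth g : sch g -> smooth g. Proof. by case. Qed.
Lemma sch_rdec g : sch g -> rdec g. Proof. by case=> _ /(_ [::]). Qed.

Lemma sch_coind (S : ('rV[R]_d -> R) -> Prop) :
  (forall g x, S g -> differentiable g x) -> (forall g, S g -> rdec g) ->
  (forall g j, S g -> S (pder j g)) -> forall g, S g -> sch g.
Proof.
move=> Sd Sr Sp g Sg; split; first exact: (smooth_coind Sd Sp).
by move=> js; apply: Sr; elim: js => //= j js; exact: Sp.
Qed.

Lemma sch_pder j g : sch g -> sch (pder j g).
Proof.
move=> [sg rg]; split; first exact: smooth_pder.
by move=> js; rewrite -dl_rcons.
Qed.

Lemma sch_dl js g : sch g -> sch (dl js g).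
Proof. by move=> sg; elim: js => //= j js; exact: sch_pder. Qed.

Lemma sch_pders b g : sch g -> sch (pders b g).
Proof. by move=> sg; rewrite pdersE; exact: sch_dl. Qed.

Lemma sch_add f g : sch f -> sch g -> sch (fun x => f x + g x).
Proof.
move=> [sf rf] [sg rg]; split; first exact: smooth_add.
by move=> js; rewrite dlD //; exact: rdec_add.
Qed.

Lemma sch_scale (c : R) f : sch f -> sch (fun x => c * f x).
Proof.
move=> [sf rf]; split; first exact: smooth_scale.
by move=> js; rewrite dlZ //; exact: rdec_scale.
Qed.

Lemma sch_mul f g : sch f -> sch g -> sch (fun x => f x * g x).
Proof.
move=> sf sg; have ps : prodspan sch (fun x => f x * g x) by exact: prodspan_mul.
have P u : prodspan sch u -> prodspan (@smooth R d) u.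
  elim=> [f1 f2 s1 s2|f1 f2 _ s1 _ s2]; last exact: prodspan_add.
  by apply: prodspan_mul; exact: sch_smooth.
apply: (sch_coind _ _ _ ps).
- by move=> u x /P /smooth_prodspan su; exact: smooth_diff.
- move=> u; elim=> [f1 f2 s1 s2|f1 f2 _ s1 _ s2]; last exact: rdec_add.
  by apply: rdec_mul; exact: sch_rdec.
- move=> u j; elim=> [f1 f2 s1 s2|f1 f2 p1 s1 p2 s2].
    rewrite pderM; try exact: sch_smooth.
    by apply: prodspan_add; apply: prodspan_mul => //; exact: sch_pder.
  by rewrite pderD; [exact: prodspan_add|apply: smooth_prodspan; exact: P..].
Qed.

Lemma sch_coord j f : sch f -> sch (fun x => x ord0 j * f x).
Proof.
move=> [sf rf]; split; first by apply: smooth_mul => //; exact: smooth_coord.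
move=> js; rewrite dl_coord //; apply: rdec_add; first exact: rdec_coord.
exact: rdec_scale.
Qed.

Lemma schP g : sch g <-> smooth g /\ forall a b, exists K, forall x,
  `|monom x a| * `|pders b g x| <= K.
Proof.
split=> [sg|[sg H]].
  by split=> [|a b]; [exact: sch_smooth|apply: sch_rdec; exact: sch_pders].
by split=> // js a; rewrite dl_pders.
Qed.

Lemma sch_sum (I : Type) (s : seq I) (F : I -> 'rV[R]_d -> R) :
  sch (fun=> 0) -> (forall i, sch (F i)) -> sch (fun x => \sum_(i <- s) F i x).
Proof.
move=> s0 sF; elim: s => [|i s IH].
  by rewrite (_ : (fun x => _) = (fun=> 0)) //; apply/funext => x; rewrite big_nil.
rewrite (_ : (fun x => _) = (fun x => F i x + \sum_(i <- s) F i x)); first exact: sch_add.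
by apply/funext => x; rewrite big_cons.
Qed.

End Smooth.

(** * Iterated integrals *)

Section Integral1.
Variable R : realType.
Implicit Types (f g : R -> R) (s t K : R).
Local Notation mu := (@lebesgue_measure R).

(** An integrable weight comparable with each of its translates, so that the functions dominated by
    it form a translation invariant class. *)
Definition qw t : R := (1 + t ^+ 2)^-1.
Definition I1 f : R := Rintegral mu setT f.

Lemma qw_den_gt0 t : 0 < 1 + t ^+ 2.
Proof. by rewrite ltr_pwDl // sqr_ge0. Qed.

Lemma qw_gt0 t : 0 < qw t. Proof. by rewrite invr_gt0 qw_den_gt0. Qed.
Lemma qw_ge0 t : 0 <= qw t. Proof. exact: ltW (qw_gt0 t). Qed.
Lemma qw_le1 t : qw t <= 1.
Proof. by rewrite invf_le1 ?qw_den_gt0 // lerDl sqr_ge0. Qed.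

Lemma qw_translate s t : qw (t + s) <= 2 * (1 + s ^+ 2) * qw t.
Proof.
rewrite /qw ler_pdivlMr ?qw_den_gt0 // mulrC ler_pdivrMr ?qw_den_gt0 //.
(* Once the denominators are cleared, the two sides differ by 1 + (t + 2s)^2 + 2 (s (t + s))^2. *)
have : 0 <= (t + 2 * s) ^+ 2 by exact: sqr_ge0.
have : 0 <= (s * (t + s)) ^+ 2 by exact: sqr_ge0.
by rewrite !expr2; lra.
Qed.

Lemma continuous_qw : continuous qw.
Proof. exact: continuous_oneDsqrV. Qed.

Lemma integrable_qw : mu.-integrable setT (EFin \o qw).
Proof.
have mq : measurable_fun [set: R] (@qw) by exact: continuous_measurable_fun continuous_qw.
apply/integrableP; split; first exact/measurable_EFinP.
apply/abse_integralP => //=; first exact/measurable_EFinP.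
rewrite (@ge0_symfun_integralT R qw); first last.
- by move=> t; rewrite /= /qw sqrrN.
- exact: continuous_qw.
- exact: qw_ge0.
rewrite (_ : [set x | _] = `[0%R, +oo[%classic); last first.
  by apply/seteqP; split => x/=; rewrite in_itv/= andbT.
by rewrite (@integral0y_oneDsqr R) -EFinM /= ltry.
Qed.

Definition good1 f := continuous f /\ exists K, forall t, `|f t| <= K * qw t.

Lemma good1_integrable f : good1 f -> mu.-integrable setT (EFin \o f).
Proof.
move=> [cf [K HK]].
apply: (le_integrable measurableT _ _ (integrableZl measurableT K integrable_qw)).
- by apply/measurable_EFinP; exact: continuous_measurable_fun.
- move=> t _ /=; rewrite lee_fin; apply: le_trans (HK t) _.
  exact: ler_norm.

Qed.

Lemma good1_qw : good1 qw.
Proof. by split; [exact: continuous_qw|exists 1 => t; rewrite mul1r ger0_norm // qw_ge0]. Qed.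

Lemma good1D f g : good1 f -> good1 g -> good1 (fun t => f t + g t).
Proof.
move=> [cf [K HK]] [cg [L HL]]; split; first by move=> t; apply: cvgD; [exact: cf|exact: cg].
exists (K + L) => t; apply: le_trans (ler_normD _ _) _; rewrite mulrDl; exact: lerD.
Qed.

Lemma good1Z (c : R) f : good1 f -> good1 (fun t => c * f t).
Proof.
move=> [cf [K HK]]; split; first by move=> t; apply: cvgM; [exact: cvg_cst|exact: cf].
by exists (`|c| * K) => t; rewrite normrM -mulrA; apply: ler_wpM2l.
Qed.

Lemma I1D f g : good1 f -> good1 g -> I1 (fun t => f t + g t) = I1 f + I1 g.
Proof. by move=> gf gg; apply: RintegralD => //; exact: good1_integrable. Qed.

Lemma I1Z (c : R) f : good1 f -> I1 (fun t => c * f t) = c * I1 f.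
Proof. by move=> gf; apply: RintegralZl => //; exact: good1_integrable. Qed.

Lemma I1_le f g : good1 f -> good1 g -> (forall t, f t <= g t) -> I1 f <= I1 g.
Proof. by move=> gf gg fg; apply: le_Rintegral => //; exact: good1_integrable. Qed.

Lemma I1_norm f K : good1 f -> (forall t, `|f t| <= K * qw t) -> `|I1 f| <= K * I1 qw.
Proof.
move=> gf HK; have gK := good1Z K good1_qw; have gN := good1Z (- K) good1_qw.
have H t : - (K * qw t) <= f t <= K * qw t by rewrite -ler_norml.
rewrite ler_norml -mulNr -!I1Z //; try exact: good1_qw.
by apply/andP; split; apply: I1_le => // t; have /andP[] := H t; rewrite ?mulNr.
Qed.

Lemma good1_translate s f : good1 f -> good1 (fun t => f (t + s)).
Proof.
move=> [cf [K HK]]; split.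
  move=> t; apply: (@continuous_comp _ _ _ (fun t => t + s) f); last exact: cf.
  by apply: cvgD; [exact: cvg_id|exact: cvg_cst].
have K0 : 0 <= K.
  have := HK 0; have := normr_ge0 (f 0); rewrite /qw expr0n /= addr0 invr1 mulr1.
  by move=> /le_trans; apply.
exists (K * (2 * (1 + s ^+ 2))) => t; apply: le_trans (HK _) _.
by rewrite -[X in _ <= X]mulrA; apply: ler_wpM2l => //; exact: qw_translate.
Qed.

Lemma I1_translate_ge0 s f : good1 f -> (forall t, 0 <= f t) ->
  I1 (fun t => f (t + s)) = I1 f.
Proof.
move=> [cf _] f0.
have dF (t : R) : is_derive t 1 (fun t : R => t + s) 1.
  rewrite -[X in is_derive _ _ _ X]addr0.
  exact: (@is_deriveD _ _ _ id (cst s)).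
have FE : derive1 (fun t : R => t + s) = cst 1.
  by apply/funext => t; rewrite derive1E; case: (dF t).
rewrite /I1 /Rintegral; congr fine.
rewrite [RHS](@increasing_ge0_integration_by_substitutionT R (fun t => t + s)) //.
- by apply: eq_integral => t _; rewrite FE /= mulr1.
- by move=> x y; rewrite ltrD2r.
- by rewrite FE => x; exact: cvg_cst.
- by rewrite FE; exact: is_cvg_cst.
- by rewrite FE; exact: is_cvg_cst.
- apply/cvgrNyPle => A; near=> x; rewrite -lerBrDr; near: x.
  by apply: nbhs_ninfty_le; exact: num_real.
- apply/cvgryPge => A; near=> x; rewrite -lerBlDr; near: x.
  by apply: nbhs_pinfty_ge; exact: num_real.
Unshelve. all: by end_near. Qed.

(** Substitution is available for nonnegative integrands; adding the dominating multiple of [qw]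
    makes f nonnegative, and the added term is itself nonnegative. *)
Lemma I1_translate s f : good1 f -> I1 (fun t => f (t + s)) = I1 f.
Proof.
move=> gf; have [cf [K HK]] := gf.
have gK := good1Z K good1_qw; have gS := good1D gf gK.
have Kq t : 0 <= K * qw t by apply: le_trans (HK t).
have S0 t : 0 <= f t + K * qw t by have := HK t; rewrite ler_norml => /andP[]; lra.
have := I1_translate_ge0 s gS S0; have := I1_translate_ge0 s gK Kq => EK.
have := good1_translate s gf => gfs; have gKs := good1_translate s gK.
by rewrite (I1D gfs gKs) (I1D gf gK) EK => /addIr.
Qed.

End Integral1.

(** * Linearity, translation invariance and partial integration for iterated integrals *)

Section IteratedIntegral.
Variable R : realType.

Definition wt n (x : 'rV[R]_n) : R := \prod_(j < n) qw (x ord0 j).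
(** The weight without direction i is constant along that direction, hence the same at both ends of
    an increment, and still integrable in the other variables. This is what continuity of a partial
    integral in its remaining variable requires. *)
Definition wtd n (i : 'I_n) (x : 'rV[R]_n) : R := \prod_(j < n | j != i) qw (x ord0 j).

Lemma wtE n (i : 'I_n) x : wt x = qw (x ord0 i) * wtd i x.
Proof. by rewrite /wt (bigD1 i). Qed.

Lemma wt_ge0 n (x : 'rV[R]_n) : 0 <= wt x.
Proof. by apply: prodr_ge0 => j _; exact: qw_ge0. Qed.

Lemma wt_gt0 n (x : 'rV[R]_n) : 0 < wt x.
Proof. by apply: prodr_gt0 => j _; exact: qw_gt0. Qed.

Lemma wtd_ge0 n i (x : 'rV[R]_n) : 0 <= wtd i x.
Proof. by apply: prodr_ge0 => j _; exact: qw_ge0. Qed.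

Lemma wt_le1 n (x : 'rV[R]_n) : wt x <= 1.
Proof. by apply: prodr_ile1 => j _; rewrite qw_ge0 qw_le1. Qed.

Lemma wt_le_wtd n i (x : 'rV[R]_n) : wt x <= wtd i x.
Proof. by rewrite (wtE i) ler_piMl ?wtd_ge0 ?qw_le1. Qed.

Lemma addunitvE n (x : 'rV[R]_n) (s : R) i j :
  (x + s *: unitv R i) ord0 j = x ord0 j + s * (j == i)%:R.
Proof. by rewrite !mxE eqxx. Qed.

Lemma wtd_same n i (x : 'rV[R]_n) s : wtd i (x + s *: unitv R i) = wtd i x.
Proof. by apply: eq_bigr => j /negPf ji; rewrite addunitvE ji mulr0 addr0. Qed.

Lemma prod_qw_translate n (P : pred 'I_n) i (x : 'rV[R]_n) s :
  \prod_(j < n | P j) qw ((x + s *: unitv R i) ord0 j) <=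
  2 * (1 + s ^+ 2) * \prod_(j < n | P j) qw (x ord0 j).
Proof.
have [Pi|Pi] := boolP (P i).
  rewrite !(bigD1 i Pi) /= mulrA; apply: ler_pM; rewrite ?qw_ge0 //.
  - by apply: prodr_ge0 => j _; exact: qw_ge0.
  - by rewrite addunitvE eqxx mulr1; exact: qw_translate.
  by apply: ler_prod => j /andP[_ /negPf ji]; rewrite addunitvE ji mulr0 addr0 qw_ge0 lexx.
rewrite (eq_bigr (fun j => qw (x ord0 j))).
  rewrite ler_peMl //; first by apply: prodr_ge0 => j _; exact: qw_ge0.
  by have := sqr_ge0 s; lra.
move=> j Pj; rewrite addunitvE; case: eqVneq => [E|]; last by rewrite mulr0 addr0.
by move: Pi; rewrite -E Pj.
Qed.

(* The class on which the iterated integral is linear, monotone and translation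
   invariant: the Lipschitz condition makes every partial integral continuous. *)
Definition lipgoodK n K (f : 'rV[R]_n -> R) :=
  (forall x, `|f x| <= K * wt x) /\
  (forall j s x, `|f (x + s *: unitv R j) - f x| <= K * `|s| * wtd j x).
Definition lipgood n (f : 'rV[R]_n -> R) := exists K, lipgoodK K f.

Lemma lipgoodK_ge0 n K (f : 'rV[R]_n -> R) : lipgoodK K f -> 0 <= K.
Proof.
move=> [H _]; have := le_trans (normr_ge0 _) (H 0).
by rewrite pmulr_lge0 // wt_gt0.
Qed.

Lemma lipgoodD n (f g : 'rV[R]_n -> R) : lipgood f -> lipgood g ->
  lipgood (fun x => f x + g x).
Proof.
move=> [K [H1 H2]] [L [H3 H4]]; exists (K + L); split=> [x|j s x].
  by apply: le_trans (ler_normD _ _) _; rewrite mulrDl; exact: lerD.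
rewrite opprD addrACA; apply: le_trans (ler_normD _ _) _.
by rewrite !mulrDl; exact: lerD.
Qed.

Lemma lipgoodZ n (c : R) (f : 'rV[R]_n -> R) : lipgood f -> lipgood (fun x => c * f x).
Proof.
move=> [K [H1 H2]]; exists (`|c| * K); split=> [x|j s x].
  by rewrite normrM -mulrA; apply: ler_wpM2l.
by rewrite -mulrBr normrM -!mulrA; apply: ler_wpM2l => //; rewrite mulrA; exact: H2.
Qed.

Lemma lipgoodB n (f g : 'rV[R]_n -> R) : lipgood f -> lipgood g ->
  lipgood (fun x => f x - g x).
Proof.
move=> gf /(lipgoodZ (-1)) gg; have := lipgoodD gf gg.
by congr lipgood; apply/funext => x; rewrite mulN1r.
Qed.

Lemma lipgood_translate n (f : 'rV[R]_n -> R) i r : lipgood f ->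
  lipgood (fun x => f (x + r *: unitv R i)).
Proof.
move=> [K HK]; have K0 := lipgoodK_ge0 HK; move: HK => [H1 H2].
exists (K * (2 * (1 + r ^+ 2))); split=> [x|j s x].
  apply: le_trans (H1 _) _; rewrite -[leRHS]mulrA; apply: ler_wpM2l => //.
  exact: (@prod_qw_translate n xpredT).
rewrite addrAC; apply: le_trans (H2 j s _) _.
rewrite -mulrA -[leRHS]mulrA -[leRHS]mulrA; apply: ler_wpM2l => //.
rewrite mulrCA; apply: ler_wpM2l => //; exact: prod_qw_translate.
Qed.

Definition sl n (t : R) (y : 'rV[R]_n) : 'rV[R]_n.+1 := row_mx t%:M y.

Lemma sl0 n t (y : 'rV[R]_n) : sl t y ord0 ord0 = t.
Proof.
have E : ord0 = lshift n (ord0 : 'I_1) by exact: val_inj.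
by rewrite (etrans (congr1 (row_mx t%:M y ord0) E) (row_mxEl _ _ _ _)) mxE eqxx.
Qed.

Lemma slS n t (y : 'rV[R]_n) j : sl t y ord0 (lift ord0 j) = y ord0 j.
Proof.
have E : lift ord0 j = rshift 1 j by exact: val_inj.
exact: (etrans (congr1 (row_mx t%:M y ord0) E) (row_mxEr _ _ _ _)).
Qed.

Lemma sl_surj n (x : 'rV[R]_n.+1) : x = sl (x ord0 ord0) (\row_j x ord0 (lift ord0 j)).
Proof.
by apply/rowP => k; case: (unliftP ord0 k) => [j ->|->]; rewrite ?slS ?sl0 ?mxE.
Qed.

Lemma sl_unitv0 n t s (y : 'rV[R]_n) : sl t y + s *: unitv R ord0 = sl (t + s) y.
Proof.
apply/rowP => k; rewrite addunitvE; case: (unliftP ord0 k) => [j ->|->].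
  by rewrite !slS /= mulr0 addr0.
by rewrite !sl0 eqxx mulr1.
Qed.

Lemma sl_unitvS n t s (y : 'rV[R]_n) j :
  sl t y + s *: unitv R (lift ord0 j) = sl t (y + s *: unitv R j).
Proof.
apply/rowP => k; rewrite addunitvE; case: (unliftP ord0 k) => [i ->|->].
  by rewrite !slS addunitvE (inj_eq (@lift_inj _ _)).
by rewrite !sl0 /= mulr0 addr0.
Qed.

Lemma wt_sl n t (y : 'rV[R]_n) : wt (sl t y) = qw t * wt y.
Proof. by rewrite /wt big_ord_recl sl0; under eq_bigr do rewrite slS. Qed.

Lemma wtd_sl0 n t (y : 'rV[R]_n) : wtd ord0 (sl t y) = wt y.
Proof.
have := wtE ord0 (sl t y); rewrite wt_sl sl0 => /(mulfI _) -> //.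
by rewrite gt_eqF // qw_gt0.
Qed.

Lemma wtd_slS n t (y : 'rV[R]_n) j : wtd (lift ord0 j) (sl t y) = qw t * wtd j y.
Proof.
have q0 : qw (y ord0 j) != 0 by rewrite gt_eqF // qw_gt0.
apply: (mulfI q0); have := wtE (lift ord0 j) (sl t y).
by rewrite wt_sl slS (wtE j y) => <-; rewrite mulrCA.
Qed.

Lemma lipgoodK_slice n K (f : 'rV[R]_n.+1 -> R) t : lipgoodK K f ->
  lipgoodK (K * qw t) (fun y => f (sl t y)).
Proof.
move=> [H1 H2]; split=> [y|j s y]; first by rewrite -mulrA -wt_sl.
apply: le_trans (_ : K * `|s| * (qw t * wtd j y) <= _); last by rewrite le_eqVlt; apply/orP; left; apply/eqP; ring.
by have := H2 (lift ord0 j) s (sl t y); rewrite sl_unitvS wtd_slS.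
Qed.

Lemma lipgood_slice n (f : 'rV[R]_n.+1 -> R) t : lipgood f -> lipgood (fun y => f (sl t y)).
Proof. by move=> [K HK]; exists (K * qw t); exact: lipgoodK_slice. Qed.

Lemma lip_continuous (F : R -> R) K : (forall s t, `|F t - F s| <= K * `|t - s|) -> continuous F.
Proof.
move=> HK x; apply/cvgrPdist_le => e e0; have [K0|K0] := lerP K 0; near=> y.
  by apply: le_trans (HK y x) _; apply: (@le_trans _ _ 0); [exact: mulr_le0_ge0|exact: ltW].
apply: le_trans (HK y x) _; rewrite mulrC -ler_pdivlMr //.
near: y; apply/nbhs_ballP; exists (e / K) => /=; first by rewrite divr_gt0.
by move=> y /ltW.
Unshelve. all: by end_near. Qed.

Local Notation c1 := (I1 (@qw R)).

Lemma iintS n (f : 'rV[R]_n.+1 -> R) : iint f = I1 (fun t => iint (fun y => f (sl t y))).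
Proof. by []. Qed.

(** The four claims need a joint induction: linearity and the norm bound in one dimension make the
    partial integrals of the next dimension continuous and dominated, and this in turn gives
    linearity and the norm bound there. *)
Lemma iint_basic n :
  [/\ forall f g : 'rV[R]_n -> R, lipgood f -> lipgood g ->
        iint (fun x => f x + g x) = iint f + iint g,
      forall (c : R) (f : 'rV[R]_n -> R), lipgood f -> iint (fun x => c * f x) = c * iint f,
      forall (f : 'rV[R]_n -> R) K, lipgood f -> (forall x, `|f x| <= K * wt x) ->
        `|iint f| <= K * c1 ^+ n &
      forall (f : 'rV[R]_n.+1 -> R), lipgood f -> good1 (fun t => iint (fun y => f (sl t y)))].
Proof.
elim: n => [|n [IHD IHZ IHn IHg]].
  have D0 : forall f : 'rV[R]_0 -> R, iint f = f 0 by [].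
  have N0 : forall (f : 'rV[R]_0 -> R) K, lipgood f -> (forall x, `|f x| <= K * wt x) ->
        `|iint f| <= K * c1 ^+ 0.
    by move=> f K _ /(_ 0); rewrite /wt big_ord0 expr0.
  split=> //; move=> f gf; have [K HK] := gf; split.
    apply: (@lip_continuous _ K) => s t; have [_ /(_ ord0 (t - s) (sl s 0))] := HK.
    by rewrite sl_unitv0 wtd_sl0 [s + _]addrC subrK /wt big_ord0 mulr1.
  exists K => t; have [/(_ (sl t 0))] := HK.
  by rewrite wt_sl /wt big_ord0 mulr1.
have Dn : forall f g : 'rV[R]_n.+1 -> R, lipgood f -> lipgood g ->
        iint (fun x => f x + g x) = iint f + iint g.
  move=> f g gf gg; rewrite !iintS -I1D; try exact: IHg.
  by congr I1; apply/funext => t; rewrite IHD //; exact: lipgood_slice.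
have Zn : forall (c : R) (f : 'rV[R]_n.+1 -> R), lipgood f ->
    iint (fun x => c * f x) = c * iint f.
  move=> c f gf; rewrite !iintS -I1Z; last exact: IHg.
  by congr I1; apply/funext => t; rewrite IHZ //; exact: lipgood_slice.
have Nn : forall (f : 'rV[R]_n.+1 -> R) K, lipgood f -> (forall x, `|f x| <= K * wt x) ->
        `|iint f| <= K * c1 ^+ n.+1.
  move=> f K gf HK; rewrite iintS exprS mulrCA mulrC.
  apply: I1_norm; first exact: IHg.
  move=> t; rewrite mulrAC; apply: IHn; first exact: lipgood_slice.
  by move=> y; rewrite -mulrA -wt_sl.
split=> // f gf; have [K HK] := gf; split.
  apply: (@lip_continuous _ (K * c1 ^+ n.+1)) => s t.
  have gt := lipgood_slice t gf; have gs := lipgood_slice s gf.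
  have -> : iint (fun y => f (sl t y)) - iint (fun y => f (sl s y)) =
            iint (fun y => f (sl t y) + -1 * f (sl s y)).
    by rewrite Dn ?Zn ?mulN1r //; exact: lipgoodZ.
  rewrite mulrAC; apply: Nn; first by apply: lipgoodD => //; exact: lipgoodZ.
  move=> y; have [_ /(_ ord0 (t - s) (sl s y))] := HK.
  by rewrite sl_unitv0 wtd_sl0 [s + _]addrC subrK mulN1r.
exists (K * c1 ^+ n.+1) => t; rewrite mulrAC; apply: Nn; first exact: lipgood_slice.
by move=> y; rewrite -mulrA -wt_sl; have [] := HK.
Qed.

Lemma iintD n (f g : 'rV[R]_n -> R) : lipgood f -> lipgood g ->
  iint (fun x => f x + g x) = iint f + iint g.
Proof. by have [H _ _ _] := iint_basic n; exact: H. Qed.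

Lemma iintZ n (c : R) (f : 'rV[R]_n -> R) : lipgood f -> iint (fun x => c * f x) = c * iint f.
Proof. by have [_ H _ _] := iint_basic n; exact: H. Qed.

Lemma iint_norm n (f : 'rV[R]_n -> R) K : lipgood f -> (forall x, `|f x| <= K * wt x) ->
  `|iint f| <= K * c1 ^+ n.
Proof. by have [_ _ H _] := iint_basic n; exact: H. Qed.

Lemma iint_good1 n (f : 'rV[R]_n.+1 -> R) : lipgood f -> good1 (fun t => iint (fun y => f (sl t y))).
Proof. by have [_ _ _ H] := iint_basic n; exact: H. Qed.

Lemma iintB n (f g : 'rV[R]_n -> R) : lipgood f -> lipgood g ->
  iint (fun x => f x - g x) = iint f - iint g.
Proof.
move=> gf gg; rewrite -[- iint g]mulN1r -iintZ // -iintD //; last exact: lipgoodZ.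
by congr iint; apply/funext => x; rewrite mulN1r.
Qed.

Lemma iint_ge0 n (f : 'rV[R]_n -> R) : (forall x, 0 <= f x) -> 0 <= iint f.
Proof.
elim: n f => [|n IH] f f0; first exact: f0.
by apply: Rintegral_ge0 => t _; exact: IH.
Qed.

Lemma iint_le n (f g : 'rV[R]_n -> R) : lipgood f -> lipgood g -> (forall x, f x <= g x) ->
  iint f <= iint g.
Proof.
move=> gf gg fg; rewrite -subr_ge0 -iintB //; apply: iint_ge0 => x.
by rewrite subr_ge0.
Qed.

Lemma iint_translate n (f : 'rV[R]_n -> R) i s : lipgood f ->
  iint (fun x => f (x + s *: unitv R i)) = iint f.
Proof.
elim: n f i => [|n IH] f i gf; first by case: i.
rewrite !iintS; case: (unliftP ord0 i) => [j ->|->].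
  congr I1; apply/funext => t; rewrite -[RHS](IH _ j (lipgood_slice t gf)).
  by congr iint; apply/funext => y; rewrite sl_unitvS.
rewrite -[RHS](I1_translate s); last exact: iint_good1.
by congr I1; apply/funext => t; congr iint; apply/funext => y; rewrite sl_unitv0.
Qed.

(* By translation invariance the difference quotient of [g] integrates to 0. *)
Lemma iint_derivative0 n (g g' : 'rV[R]_n -> R) j K : lipgood g -> lipgood g' ->
  (forall s x, `|s| <= 1 -> `|g (x + s *: unitv R j) - g x - s * g' x| <= K * s ^+ 2 * wt x) ->
  iint g' = 0.
Proof.
move=> gg gg' H.
have B s : 0 < s <= 1 -> `|iint g'| <= K * s * c1 ^+ n.
  move=> /andP[s0 s1].
  have gt := lipgood_translate j s gg.
  have : `|iint (fun x => g (x + s *: unitv R j) - g x - s * g' x)| <= K * s ^+ 2 * c1 ^+ n.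
    apply: iint_norm => [|x]; last by apply: H; rewrite gtr0_norm.
    by apply: lipgoodB; [exact: lipgoodB|exact: lipgoodZ].
  rewrite iintB; [|exact: lipgoodB|exact: lipgoodZ].
  rewrite iintB // iint_translate // subrr sub0r normrN iintZ // normrM (gtr0_norm s0).
  by rewrite expr2 mulrA [K * s * s]mulrC -[s * _ * _]mulrA ler_pM2l.
apply/eqP; rewrite -normr_le0; apply/ler_addgt0Pr => e e0; rewrite add0r.
pose D := `|K * c1 ^+ n| + 1; have D0 : 0 < D by rewrite ltr_wpDl.
pose s := Num.min 1 (e / D).
have s0 : 0 < s by rewrite lt_min ltr01 divr_gt0.
apply: (le_trans (B s _)); first by rewrite s0 ge_min lexx.
rewrite mulrAC; apply: (@le_trans _ _ (D * s)).
  by apply: ler_wpM2r; [exact: ltW|rewrite (le_trans (ler_norm _)) // lerDl].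
by rewrite mulrC -ler_pdivlMr // ge_min lexx orbT.
Qed.

(** The exponents of the monomials obtained by expanding prod_j (1 + x_j^2), the reciprocal of [wt].
    Decay like [wt] is thus equivalent to finitely many monomial bounds. *)
Definition aJ d (J : {set 'I_d}) : mindex d := [ffun j => ((j \in J) * 2)%N].

Lemma wt_of_monom d (f : 'rV[R]_d -> R) T : (forall J x, `|monom x (aJ J)| * `|f x| <= T) ->
  forall x, `|f x| <= #|{set 'I_d}|%:R * T * wt x.
Proof.
move=> H x; have w0 := wt_gt0 x; rewrite -ler_pdivrMr //.
have -> : (wt x)^-1 = \sum_(J : {set 'I_d}) `|monom x (aJ J)|.
  rewrite /wt -prodfV.
  under eq_bigr do rewrite /qw invrK addrC.
  rewrite bigA_distr; apply: eq_bigr => J _.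
  rewrite /monom normr_prod big_mkcond /=; apply: eq_bigr => j _.
  by rewrite ffunE; case: (j \in J); rewrite ?mul1n ?mul0n ?expr0 ?normr1 // ger0_norm // sqr_ge0.
rewrite mulr_sumr; apply: (@le_trans _ _ (\sum_(J : {set 'I_d}) T)).
  by apply: ler_sum => J _; rewrite mulrC; exact: H.
by rewrite sumr_const mulr_natl.
Qed.

Lemma rdec_wt n (f : 'rV[R]_n -> R) : rdec f -> exists2 K, 0 <= K & forall x, `|f x| <= K * wt x.
Proof.
move=> rf.
have HJ J : {K | forall x, `|monom x (aJ J)| * `|f x| <= K} by apply: cid; exact: rf.
pose T := \sum_(J : {set 'I_n}) `|sval (HJ J)|.
exists (#|{set 'I_n}|%:R * T); first by rewrite mulr_ge0 // sumr_ge0.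
apply: wt_of_monom => J x; apply: le_trans (svalP (HJ J) x) _; apply: le_trans (ler_norm _) _.
by rewrite /T (bigD1 J) //= lerDl sumr_ge0.
Qed.

Lemma sch_lipgood n (g : 'rV[R]_n -> R) : sch g -> lipgood g.
Proof.
move=> sg; have [K0 K00 H0] := rdec_wt (sch_rdec sg).
have Hj j : {K | 0 <= K /\ forall x, `|pder j g x| <= K * wt x}.
  by apply: cid; have [K] := rdec_wt (sch_rdec (sch_pder j sg)); exists K.
pose S := \sum_j sval (Hj j).
have S0 : 0 <= S by apply: sumr_ge0 => j _; case: (svalP (Hj j)).
exists (K0 + S); split=> [x|j s x].
  by apply: le_trans (H0 x) _; apply: ler_wpM2r; [exact: wt_ge0|rewrite lerDl].
have [t _ ->] := MVT_coord x j s (fun y => smooth_diff y (sch_smooth sg)).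
rewrite normrM [leLHS]mulrC [leRHS]mulrAC; apply: ler_wpM2r => //.
have [Kj0 Kj] := svalP (Hj j).
apply: le_trans (Kj _) _; apply: ler_pM => //; first exact: wt_ge0.
  by rewrite ler_wpDl // /S (bigD1 j) //= lerDl; apply: sumr_ge0 => i _; case: (svalP (Hj i)).
by rewrite -(wtd_same j x (t * s)); exact: wt_le_wtd.
Qed.

Lemma iint_pder n (g : 'rV[R]_n -> R) j : sch g -> iint (pder j g) = 0.
Proof.
move=> sg; have sg1 := sch_pder j sg; have sg2 := sch_pder j sg1.
have [K K0 HK] := rdec_wt (sch_rdec sg2).
(* The factor 4 bounds 2 (1 + u^2), the price of moving [wt] by a step u with |u| <= 1. *)
apply: (@iint_derivative0 n g (pder j g) j (4 * K)); [exact: sch_lipgood|exact: sch_lipgood|].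
move=> s x s1.
have [t /andP[t0 t1] ->] := MVT_coord x j s (fun y => smooth_diff y (sch_smooth sg)).
have [r /andP[r0 r1]] := MVT_coord x j (t * s) (fun y => smooth_diff y (sch_smooth sg1)).
rewrite -mulrBr => ->; rewrite !normrM (ger0_norm t0).
set u := r * (t * s).
have u1 : u ^+ 2 <= 1.
  rewrite -real_normK ?num_real // expr_le1 // /u !normrM (ger0_norm t0) (ger0_norm r0).
  by rewrite mulr_ile1 ?mulr_ge0 // mulr_ile1.
have H : `|pder j (pder j g) (x + u *: unitv R j)| <= 4 * K * wt x.
  apply: le_trans (HK _) _; rewrite [4 * K]mulrC -[leRHS]mulrA; apply: ler_wpM2l => //.
  apply: le_trans (@prod_qw_translate n xpredT j x u) _.
  by apply: ler_wpM2r; [exact: wt_ge0|lra].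
rewrite -[s ^+ 2]real_normK ?num_real // expr2.
apply: (@le_trans _ _ (`|s| * (1 * `|s| * (4 * K * wt x)))).
  apply: ler_wpM2l => //; apply: ler_pM => //; first by rewrite mulr_ge0.
  by apply: ler_wpM2r.
by rewrite le_eqVlt; apply/orP; left; apply/eqP; ring.
Qed.

End IteratedIntegral.

(** * Hermite functions in one variable *)

Section Hermite1.
Variable R : realType.
Implicit Types (n m a b k : nat) (s t K : R).
Local Notation mu := (@lebesgue_measure R).

Lemma pow_fact_le_expR x n : 0 <= x -> x ^+ n <= n`!%:R * expR x :> R.
Proof.
move=> x0; have f0 : 0 < n`!%:R :> R by rewrite ltr0n fact_gt0.
rewrite mulrC -ler_pdivrMr //; case: n f0 => [|n] f0.
  by rewrite expr0 fact0 divr1; apply: le_trans (expR_ge1Dx x); rewrite lerDl.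
by apply: le_trans (expR_ge1Dxn n x0); rewrite lerDr.
Qed.

Lemma pow_gauss_bounded (c : R) n : 0 < c ->
  exists2 K, 0 <= K & forall t, `|t| ^+ n * expR (- c * t ^+ 2) <= K.
Proof.
move=> c0; exists (1 + n`!%:R * c ^- n).
  by rewrite addr_ge0 // mulr_ge0 // invr_ge0 exprn_ge0 // ltW.
move=> t; have x0 : 0 <= c * t ^+ 2 by rewrite mulr_ge0 ?sqr_ge0 // ltW.
have g1 : expR (- c * t ^+ 2) <= 1 by rewrite -expR0 ler_expR mulNr oppr_le0.
have g0 : 0 <= expR (- c * t ^+ 2) by exact: expR_ge0.
have cn : 0 <= n`!%:R * c ^- n by rewrite mulr_ge0 // invr_ge0 exprn_ge0 // ltW.
have [t1|t1] := lerP `|t| 1.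
  apply: (@le_trans _ _ 1); last by rewrite lerDl.
  by rewrite mulr_ile1 ?exprn_ge0 // exprn_ile1.
apply: (@le_trans _ _ (n`!%:R * c ^- n)); last by rewrite lerDr.
have H := pow_fact_le_expR n x0.
have E : expR (- c * t ^+ 2) * expR (c * t ^+ 2) = 1 by rewrite -expRD mulNr addNr expR0.
apply: (@le_trans _ _ ((t ^+ 2) ^+ n * expR (- c * t ^+ 2))).
  apply: ler_wpM2r => //; rewrite -real_normK ?num_real // -exprM mulnC exprM.
  by apply: ler_eXnr; rewrite ?exprn_ege1 // ltW.
have -> : (t ^+ 2) ^+ n = (c * t ^+ 2) ^+ n * c ^- n.
  by rewrite -exprVn -exprMn mulrAC mulfV ?mul1r // gt_eqF.
rewrite mulrAC; apply: ler_wpM2r; first by rewrite invr_ge0 exprn_ge0 // ltW.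
apply: le_trans (ler_wpM2r g0 H) _.
by rewrite -mulrA [expR _ * _]mulrC E mulr1.
Qed.

(** The physicists' Hermite polynomials: up to the sign (-1)^n, the recursion is the rule for
    differentiating a polynomial times e^(-t^2). *)
Fixpoint hp n : {poly R} :=
  if n is n'.+1 then 2%:P * 'X * hp n' - (hp n')^`() else 1.
Definition hc n : R := (Num.sqrt (2 ^+ n * n`!%:R * Num.sqrt pi))^-1.
Definition gau t : R := expR (- t ^+ 2 / 2).
Definition phi n t : R := hc n * (hp n).[t] * gau t.
(** The ladder coefficient: t phi_n = ld n phi_(n-1) + ld (n+1) phi_(n+1), and phi_n' is the same
    expression with a minus sign in the middle. *)
Definition ld n : R := Num.sqrt (n%:R / 2).

Lemma hp_deriv n : (hp n.+1)^`() = (2 * n.+1%:R)%:P * hp n.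
Proof.
elim: n => [|n IH].
  by rewrite /= !mulr1 derivB derivM !derivC derivX mul0r add0r mulr1 subr0.
rewrite [hp n.+2]/= -/(hp n.+1) derivB derivM derivM derivC derivX mul0r add0r mulr1 IH.
rewrite derivM derivC mul0r add0r.
have -> : 2%:P * hp n.+1 + 2%:P * 'X * ((2 * n.+1%:R)%:P * hp n) - (2 * n.+1%:R)%:P * (hp n)^`()
  = 2%:P * hp n.+1 + (2 * n.+1%:R)%:P * (2%:P * 'X * hp n - (hp n)^`()) by ring.
rewrite -[2%:P * 'X * hp n - (hp n)^`()]/(hp n.+1) -mulrDl -polyCD; congr (_%:P * _).
by rewrite -[n.+2%:R]natr1; ring.
Qed.

Lemma hp_derivE n t : (hp n)^`().[t] = 2 * n%:R * (hp n.-1).[t].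
Proof.
case: n => [|n]; first by rewrite /= derivC horner0 mulr0 mul0r.
by rewrite hp_deriv hornerM hornerC.
Qed.

Lemma hp_rec n t : (hp n.+1).[t] = 2 * t * (hp n).[t] - 2 * n%:R * (hp n.-1).[t].
Proof. by rewrite [hp n.+1]/= !hornerE hp_derivE. Qed.

Lemma ld_ge0 n : 0 <= ld n. Proof. exact: sqrtr_ge0. Qed.
Lemma ld_gt0 n : 0 < ld n.+1. Proof. by rewrite sqrtr_gt0 divr_gt0. Qed.
Lemma ld0 : ld 0 = 0. Proof. by rewrite /ld mul0r sqrtr0. Qed.
Lemma ld_sqr n : ld n ^+ 2 = n%:R / 2.
Proof. by rewrite sqr_sqrtr // divr_ge0. Qed.

Lemma hc_gt0 n : 0 < hc n.
Proof.
by rewrite invr_gt0 sqrtr_gt0 !mulr_gt0 ?exprn_gt0 ?sqrtr_gt0 ?pi_gt0 // ltr0n fact_gt0.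
Qed.

Lemma hcS n : hc n = 2 * ld n.+1 * hc n.+1.
Proof.
have E : Num.sqrt (2 ^+ n.+1 * n.+1`!%:R * Num.sqrt pi) =
  2 * ld n.+1 * Num.sqrt (2 ^+ n * n`!%:R * Num.sqrt pi) :> R.
  have -> : 2 * ld n.+1 = Num.sqrt (2 * n.+1%:R).
    apply/eqP; rewrite -(@eqrXn2 _ 2) ?mulr_ge0 ?ld_ge0 // ?sqrtr_ge0 //.
    by rewrite exprMn ld_sqr sqr_sqrtr ?mulr_ge0 //; apply/eqP; field.
  rewrite -sqrtrM ?mulr_ge0 //; congr Num.sqrt.
  by rewrite factS natrM exprS; ring.
have := hc_gt0 n; rewrite /hc E invr_gt0 => h0.
have l0 := ld_gt0 n.
rewrite invfM mulrA mulfV ?mul1r // mulf_neq0 // gt_eqF //.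
Qed.

Lemma phi_mulX n t : t * phi n t = ld n * phi n.-1 t + ld n.+1 * phi n.+1 t.
Proof.
rewrite /phi.
have -> : ld n * (hc n.-1 * (hp n.-1).[t] * gau t) = hc n * n%:R * (hp n.-1).[t] * gau t.
  case: n => [|n]; first by rewrite ld0 mulr0 !mul0r.
  rewrite /= hcS; have := ld_sqr n.+1; rewrite expr2 => E.
  transitivity (2 * (ld n.+1 * ld n.+1) * hc n.+1 * (hp n).[t] * gau t); first by ring.
  by rewrite E; field.
rewrite hp_rec [in LHS]hcS [X in X * n%:R]hcS; ring.
Qed.

Definition is_derive_gau t : is_derive t (1 : R) gau (- t * gau t).
Proof.
have -> : gau = (fun t => expR ((- 2^-1) * t ^+ 2)).
  by apply/funext => u; rewrite /gau mulrC mulrN mulNr.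
apply: is_derive_eq; rewrite /= /GRing.scale /=.
by set e := expR _; field.
Qed.

Lemma is_derive_phi n t : is_derive t (1 : R) (phi n) (ld n * phi n.-1 t - ld n.+1 * phi n.+1 t).
Proof.
have dp : is_derive t (1 : R) (fun t => hc n * (hp n).[t]) (hc n * (hp n)^`().[t]).
  by apply: is_deriveZ.
have dg := is_derive_gau t.
have := @is_deriveM _ _ _ _ _ _ _ _ dp dg.
rewrite -[_ * gau]/(phi n) => H; apply: is_derive_eq.
rewrite /GRing.scale /= hp_derivE.
have E1 := phi_mulX n t.
have E2 : hc n * n%:R * (hp n.-1).[t] * gau t = ld n * phi n.-1 t.
  case: (n) => [|k]; first by rewrite ld0 mulr0 !mul0r.
  rewrite /phi /= [hc k]hcS; have := ld_sqr k.+1; rewrite expr2 => E.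
  transitivity (2 * (ld k.+1 * ld k.+1) * hc k.+1 * (hp k).[t] * gau t); last by ring.
  by rewrite E; field.
have E3 : ld n.+1 * phi n.+1 t = t * phi n t - ld n * phi n.-1 t by rewrite E1; ring.
rewrite E3 -E2 /phi; ring.
Qed.

(* [psi b n] is the [b]-th derivative of [phi n]; at [n = 0] the junk index [n.-1]
   is harmless since [ld 0 = 0]. *)
Fixpoint psi b n : R -> R :=
  if b is b'.+1 then fun t => ld n * psi b' n.-1 t - ld n.+1 * psi b' n.+1 t else phi n.

Lemma is_derive_psi b n t : is_derive t (1 : R) (psi b n) (psi b.+1 n t).
Proof.
elim: b n => [|b IH] n; first exact: is_derive_phi.
have D1 : is_derive t (1 : R) (fun t => ld n * psi b n.-1 t) (ld n * psi b.+1 n.-1 t).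
  by apply: is_deriveZ.
have D2 : is_derive t (1 : R) (fun t => ld n.+1 * psi b n.+1 t) (ld n.+1 * psi b.+1 n.+1 t).
  by apply: is_deriveZ.
exact: is_deriveB.
Qed.

Lemma continuous_psi b n : continuous (psi b n).
Proof.
move=> t; apply: differentiable_continuous; apply/derivable1_diffP.
by case: (is_derive_psi b n t).
Qed.

Lemma poly_gau_bounded (p : {poly R}) k :
  exists2 K, 0 <= K & forall t, `|t| ^+ k * `|p.[t]| * gau t <= K.
Proof.
have P0 : forall k, exists2 K, 0 <= K & forall t, `|t| ^+ k * gau t <= K.
  move=> m; have [|K K0 HK] := @pow_gauss_bounded 2^-1 m; first by rewrite invr_gt0.
  exists K => // t; have -> : gau t = expR (- 2^-1 * t ^+ 2) by congr expR; field.
  exact: HK.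
elim/poly_ind: p k => [|p c IH] k.
  by exists 0 => // t; rewrite horner0 normr0 mulr0 mul0r.
have [K K0 HK] := IH k.+1; have [L L0 HL] := P0 k.
exists (K + `|c| * L); first by rewrite addr_ge0 // mulr_ge0.
move=> t; rewrite hornerMXaddC.
have g0 : 0 <= gau t by exact: expR_ge0.
apply: (@le_trans _ _ (`|t| ^+ k.+1 * `|p.[t]| * gau t + `|c| * (`|t| ^+ k * gau t))).
  rewrite [leRHS](_ : _ = `|t| ^+ k * (`|p.[t] * t| + `|c|) * gau t); last first.
    by rewrite normrM exprS; ring.
  apply: ler_wpM2r => //; apply: ler_wpM2l; first exact: exprn_ge0.
  exact: ler_normD.
by apply: lerD => //; apply: ler_wpM2l.
Qed.

Lemma phi_decay n k : exists2 K, 0 <= K & forall t, `|t| ^+ k * `|phi n t| <= K.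
Proof.
have [K K0 HK] := poly_gau_bounded (hp n) k.
exists (hc n * K); first by rewrite mulr_ge0 // ltW // hc_gt0.
move=> t; rewrite /phi !normrM (gtr0_norm (hc_gt0 n)) (gtr0_norm (expR_gt0 _)).
rewrite -mulrA mulrCA; apply: ler_wpM2l; first by rewrite ltW // hc_gt0.
by rewrite mulrA; exact: HK.
Qed.

Lemma psi_decay b n k : exists2 K, 0 <= K & forall t, `|t| ^+ k * `|psi b n t| <= K.
Proof.
elim: b n => [|b IH] n; first exact: phi_decay.
have [K K0 HK] := IH n.-1; have [L L0 HL] := IH n.+1.
exists (ld n * K + ld n.+1 * L); first by rewrite addr_ge0 // mulr_ge0 // ld_ge0.
move=> t /=.
apply: (@le_trans _ _ (ld n * (`|t| ^+ k * `|psi b n.-1 t|) + ld n.+1 * (`|t| ^+ k * `|psi b n.+1 t|))).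
  rewrite [leRHS](_ : _ = `|t| ^+ k * (`|ld n * psi b n.-1 t| + `|ld n.+1 * psi b n.+1 t|)); last first.
    by rewrite !normrM (ger0_norm (ld_ge0 n)) (ger0_norm (ld_ge0 n.+1)); ring.
  by apply: ler_wpM2l; [exact: exprn_ge0|exact: ler_normB].
by apply: lerD; apply: ler_wpM2l; rewrite ?ld_ge0.
Qed.

Lemma good1_psi b n : good1 (psi b n).
Proof.
split; first exact: continuous_psi.
have [K K0 HK] := psi_decay b n 0; have [L L0 HL] := psi_decay b n 2.
exists (K + L) => t; rewrite ler_pdivlMr ?qw_den_gt0 //.
have := HK t; have := HL t; rewrite expr0 mul1r real_normK ?num_real //.
set u := `|psi b n t|; move=> h1 h2; rewrite mulrDr mulr1 [u * _]mulrC.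
exact: lerD.
Qed.

Lemma good1_phi n : good1 (phi n). Proof. exact: (good1_psi 0). Qed.

Lemma good1M f g : good1 f -> good1 g -> good1 (fun t : R => f t * g t).
Proof.
move=> [cf [K HK]] [cg [L HL]]; split; first by move=> t; apply: cvgM; [exact: cf|exact: cg].
exists (K * L) => t; rewrite normrM -mulrA; apply: (@le_trans _ _ (`|f t| * (L * 1))).
  apply: ler_wpM2l => //; apply: le_trans (HL t) _.
  have L0 : 0 <= L by have := le_trans (normr_ge0 _) (HL t); rewrite pmulr_lge0 // qw_gt0.
  by apply: ler_wpM2l => //; exact: qw_le1.
rewrite mulr1 [leRHS]mulrA [leRHS]mulrAC; apply: ler_wpM2r; last exact: HK.
by have := le_trans (normr_ge0 _) (HL t); rewrite pmulr_lge0 // qw_gt0.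
Qed.

Lemma MVT1 (F F' : R -> R) (t s : R) : (forall t, is_derive t 1 F (F' t)) ->
  exists2 r, 0 <= r <= 1 & F (t + s) - F t = s * F' (t + r * s).
Proof.
move=> dF.
have dG (u : R) : is_derive u 1 (fun u => F (t + u * s)) (s * F' (t + u * s)).
  have d1 : is_derive u 1 (fun u : R => t + u * s) s.
    apply: is_derive_eq; rewrite add0r /GRing.scale /= mulr1; ring.
  have := @is_derive1_comp _ F (fun u => t + u * s) u _ _ (dF _) d1.
  by rewrite [_ * s]mulrC.
have cG : {within `[0, 1], continuous (fun u => F (t + u * s))}.
  apply: continuous_subspaceT => u; apply: differentiable_continuous.
  by apply/derivable1_diffP; case: (dG u).
have [r + ] := MVT_segment ler01 (fun u _ => dG u) cG.
rewrite in_itv /= mul1r mul0r addr0 subr0 mulr1 => rin E.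
by exists r.
Qed.

(** The second derivative supplies the quadratic Taylor remainder. Translation invariance cancels
    the integral of F (t + s) - F t, which leaves |[I1 F1]| of order s. *)
Lemma I1_derivative0 (F F1 F2 : R -> R) :
  (forall t, is_derive t 1 F (F1 t)) -> (forall t, is_derive t 1 F1 (F2 t)) ->
  good1 F -> good1 F1 -> good1 F2 -> I1 F1 = 0.
Proof.
move=> dF dF1 gF gF1 [_ [K HK]].
have K0 : 0 <= K by have := le_trans (normr_ge0 _) (HK 0); rewrite pmulr_lge0 // qw_gt0.
have rem s t : `|s| <= 1 -> `|F (t + s) - F t - s * F1 t| <= 4 * K * s ^+ 2 * qw t.
  move=> s1; have [r /andP[r0 r1] ->] := MVT1 t s dF.
  have [r' /andP[r0' r1']] := MVT1 t (r * s) dF1.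
  rewrite -mulrBr => ->; set u := r' * (r * s).
  have u1 : u ^+ 2 <= 1.
    rewrite -real_normK ?num_real // expr_le1 // /u !normrM (ger0_norm r0) (ger0_norm r0').
    by rewrite mulr_ile1 ?mulr_ge0 // mulr_ile1.
  have H : `|F2 (t + u)| <= 4 * K * qw t.
    apply: le_trans (HK _) _; rewrite [4 * K]mulrC -[leRHS]mulrA; apply: ler_wpM2l => //.
    apply: le_trans (qw_translate u t) _.
    by apply: ler_wpM2r; [exact: qw_ge0|lra].
  rewrite !normrM (ger0_norm r0) -[s ^+ 2]real_normK ?num_real // expr2.
  apply: (@le_trans _ _ (`|s| * (1 * `|s| * (4 * K * qw t)))).
    apply: ler_wpM2l => //; apply: ler_pM => //; first by rewrite mulr_ge0.
    by apply: ler_wpM2r.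
  by rewrite le_eqVlt; apply/orP; left; apply/eqP; ring.
have B s : 0 < s <= 1 -> `|I1 F1| <= 4 * K * s * I1 (@qw R).
  move=> /andP[s0 s1]; have gt := good1_translate s gF.
  have gN : good1 (fun t => F (t + s) + -1 * F t) by apply: good1D => //; exact: good1Z.
  have gA : good1 (fun t => F (t + s) + -1 * F t + - s * F1 t).
    by apply: good1D => //; exact: good1Z.
  have : `|I1 (fun t => F (t + s) + -1 * F t + - s * F1 t)| <= 4 * K * s ^+ 2 * I1 (@qw R).
    apply: I1_norm => // t; rewrite mulN1r mulNr; apply: rem.
    by rewrite gtr0_norm.
  rewrite (I1D gN (good1Z _ gF1)) (I1D gt (good1Z _ gF)) !I1Z // I1_translate //.
  rewrite mulN1r subrr add0r mulNr normrN normrM (gtr0_norm s0).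
  by rewrite expr2 mulrA [4 * K * s * s]mulrC -[s * _ * _]mulrA ler_pM2l.
apply/eqP; rewrite -normr_le0; apply/ler_addgt0Pr => e e0; rewrite add0r.
pose D := `|4 * K * I1 (@qw R)| + 1; have D0 : 0 < D by rewrite ltr_wpDl.
pose s := Num.min 1 (e / D).
have s0 : 0 < s by rewrite lt_min ltr01 divr_gt0.
apply: (le_trans (B s _)); first by rewrite s0 ge_min lexx.
rewrite mulrAC; apply: (@le_trans _ _ (D * s)).
  by apply: ler_wpM2r; [exact: ltW|rewrite (le_trans (ler_norm _)) // lerDl].
by rewrite mulrC -ler_pdivlMr // ge_min lexx orbT.
Qed.

Lemma I1_psi_parts m n :
  I1 (fun t => phi m t * psi 1 n t + psi 1 m t * phi n t) = 0.
Proof.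
have dM b c t : is_derive t (1 : R) (fun t => psi b m t * psi c n t)
    (psi b m t * psi c.+1 n t + psi b.+1 m t * psi c n t).
  have := @is_deriveM _ _ _ _ _ _ _ _ (is_derive_psi b m t) (is_derive_psi c n t).
  by rewrite /GRing.scale /= [psi c n t * _]mulrC.
have dM2 t : is_derive t (1 : R) (fun t => phi m t * psi 1 n t + psi 1 m t * phi n t)
    (psi 0 m t * psi 2 n t + psi 1 m t * psi 1 n t + (psi 1 m t * psi 1 n t + psi 2 m t * psi 0 n t)).
  by apply: is_deriveD; [exact: (dM 0 1)|exact: (dM 1 0)].
apply: (I1_derivative0 (dM 0 0) dM2).
- by apply: good1M; exact: good1_psi.
- by apply: good1D; apply: good1M; exact: good1_psi.
- by apply: good1D; apply: good1D; apply: good1M; exact: good1_psi.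
Qed.

Definition ip m n := I1 (fun t => phi m t * phi n t).

Lemma ipC m n : ip m n = ip n m.
Proof. by congr I1; apply/funext => t; rewrite mulrC. Qed.

(** Differentiation is antisymmetric and multiplication by t symmetric for the inner product.
    Subtracting the two resulting four-term relations leaves two terms: the lowering and raising
    operators are adjoint. *)
Lemma ip_rec m n : ld m * ip m.-1 n = ld n.+1 * ip m n.+1.
Proof.
have gM k l : good1 (fun t => phi k t * phi l t) by apply: good1M; exact: good1_phi.
have L (a1 a2 a3 a4 : R) : I1 (fun t => a1 * (phi m t * phi n.-1 t) + a2 * (phi m t * phi n.+1 t) +
   (a3 * (phi m.-1 t * phi n t) + a4 * (phi m.+1 t * phi n t))) =
   a1 * ip m n.-1 + a2 * ip m n.+1 + (a3 * ip m.-1 n + a4 * ip m.+1 n).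
  by rewrite !I1D ?I1Z //; do ?[apply: good1D]; exact: good1Z.
have E1 := I1_psi_parts m n.
have E2 : I1 (fun t => phi m t * (t * phi n t) - (t * phi m t) * phi n t) = 0.
  rewrite (_ : (fun t => _) = (fun t => 0 * (phi m t * phi n t))).
    by rewrite I1Z // mul0r.
  by apply/funext => t; rewrite mul0r; ring.
rewrite (_ : (fun t => _) = (fun t => ld n * (phi m t * phi n.-1 t) + (- ld n.+1) * (phi m t * phi n.+1 t) +
   (ld m * (phi m.-1 t * phi n t) + (- ld m.+1) * (phi m.+1 t * phi n t)))) in E1; last first.
  by apply/funext => t /=; ring.
rewrite (_ : (fun t => _) = (fun t => ld n * (phi m t * phi n.-1 t) + (ld n.+1) * (phi m t * phi n.+1 t) +
   ((- ld m) * (phi m.-1 t * phi n t) + (- ld m.+1) * (phi m.+1 t * phi n t)))) in E2; last first.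
  by apply/funext => t; rewrite !phi_mulX; ring.
rewrite L in E1; rewrite L in E2.
move: E1 E2; set p := ip _ _; set q := ip _ _; set r := ip _ _; set w := ip _ _.
move: (ld n) (ld n.+1) (ld m) (ld m.+1) => l1 l2 l3 l4 E1 E2.
have : l1 * p + - l2 * q + (l3 * r + - l4 * w) - (l1 * p + l2 * q + (- l3 * r + - l4 * w)) = 0.
  by rewrite E1 E2 subrr.
move=> E3; apply/eqP; rewrite -subr_eq0; apply/eqP.
have : 2 * (l3 * r - l2 * q) = 0 by rewrite -E3; ring.
by move=> /eqP; rewrite mulf_eq0 (negPf (_ : (2 : R) != 0)) //= => /eqP.
Qed.

Lemma ip00 : ip 0 0 = 1.
Proof.
have E : (fun t => phi 0 t * phi 0 t) = (fun t => hc 0 ^+ 2 * gauss_fun t).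
  apply/funext => t; rewrite /phi /= hornerC mulr1 /gauss_fun expr2 mulrACA; congr (_ * _).
  by rewrite /gau -expRD; congr expR; field.
have s0 : 0 < Num.sqrt pi :> R by rewrite sqrtr_gt0 pi_gt0.
rewrite /ip E /I1 RintegralZl //; last exact: integrableT_gauss.
rewrite /Rintegral integralT_gauss /= /hc expr0 fact0 !mul1r exprVn sqr_sqrtr ?ltW //.
by rewrite mulVf // gt_eqF.
Qed.

(** The Gaussian integral in [ip00] is the only one computed; the recursion reduces the diagonal to
    it and everything off the diagonal to [ld 0 = 0]. *)
Lemma ip_orthonormal m n : ip m n = (m == n)%:R.
Proof.
elim: m n => [|m IH] n.
  case: n => [|n]; first exact: ip00.
  have := ip_rec 0 n; rewrite ld0 mul0r => /esym/eqP.
  by rewrite mulf_eq0 (gt_eqF (ld_gt0 n)) /= => /eqP.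
case: n => [|n].
  have := ip_rec 0 m; rewrite ld0 mul0r => /esym/eqP.
  by rewrite mulf_eq0 (gt_eqF (ld_gt0 m)) /= ipC => /eqP.
have := ip_rec m.+1 n; rewrite /= IH eqSS; case: eqVneq => [->|mn].
  by rewrite mulr1 -[X in X = _ -> _]mulr1 => /(mulfI _) -> //; rewrite gt_eqF // ld_gt0.
by rewrite mulr0 => /esym/eqP; rewrite mulf_eq0 (gt_eqF (ld_gt0 n)) /= => /eqP.
Qed.

Lemma I1_psi1_sqr_le n : I1 (fun t => psi 1 n t ^+ 2) <= n%:R + n.+1%:R.
Proof.
have gS k : good1 (fun t => phi k t * phi k t) by apply: good1M; exact: good1_phi.
have -> : n%:R + n.+1%:R = I1 (fun t => n%:R * (phi n.-1 t * phi n.-1 t)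
                       + n.+1%:R * (phi n.+1 t * phi n.+1 t)).
  by rewrite I1D ?I1Z -?/(ip _ _) ?ip_orthonormal ?eqxx ?mulr1 //; exact: good1Z.
apply: I1_le.
- have := good1M (good1_psi 1 n) (good1_psi 1 n); congr good1.
- by apply: good1D; exact: good1Z.
move=> t /=; have E1 := ld_sqr n; have E2 := ld_sqr n.+1.
have -> : n%:R = 2 * ld n ^+ 2 by rewrite E1; field.
have -> : n.+1%:R = 2 * ld n.+1 ^+ 2 by rewrite E2; field.
rewrite -subr_ge0; have := sqr_ge0 (ld n * phi n.-1 t + ld n.+1 * phi n.+1 t).
by congr (0 <= _); rewrite !expr2; ring.
Qed.

(* Integrate [- (phi n ^+ 2)' <= phi n ^+ 2 + phi n' ^+ 2] over a half line. *)
Lemma phi_sqr_le n t : phi n t ^+ 2 <= 2 * n.+1%:R.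
Proof.
pose w (t : R) := phi n t ^+ 2 + psi 1 n t ^+ 2.
have gq b : good1 (fun t => psi b n t ^+ 2).
  by have := good1M (good1_psi b n) (good1_psi b n).
have gw : good1 w by apply: good1D; [exact: (gq 0)|exact: (gq 1)].
have w0 u : 0 <= w u by rewrite addr_ge0 // sqr_ge0.
have Iw : I1 w <= 2 * n.+1%:R.
  rewrite /w I1D; [|exact: (gq 0)|exact: (gq 1)].
  have -> : I1 (fun t => phi n t ^+ 2) = 1.
    by have := ip_orthonormal n n; rewrite eqxx.
  apply: le_trans (lerD (lexx _) (I1_psi1_sqr_le n)) _.
  by rewrite -natr1 le_eqVlt; apply/orP; left; apply/eqP; ring.
have du (u : R) : is_derive u 1 (fun u => phi n u ^+ 2) (2 * (phi n u * psi 1 n u)).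
  have := @is_deriveM _ _ _ _ _ _ _ _ (is_derive_psi 0 n u) (is_derive_psi 0 n u).
  rewrite /GRing.scale /= -/(psi 1 n u) => H.
  have -> : 2 * (phi n u * psi 1 n u) = phi n u * psi 1 n u + phi n u * psi 1 n u by ring.
  exact: H.
have [K0 H0] : exists K, forall t, `|phi n t ^+ 2| <= K * qw t by case: (gq 0%N).
(* The half line is approached by [t, t + r]: the integral of the nonnegative [w] is enlarged to the
   whole line, and the boundary value at t + r is bounded by its decay. *)
have step r : 0 < r -> phi n t ^+ 2 <= I1 w + K0 * qw (t + r).
  move=> r0; have tr : t < t + r by rewrite ltrDl.
  pose f' u := 2 * (phi n u * psi 1 n u).
  have cf' : continuous f'.
    by have [] := good1Z 2 (good1M (good1_psi 0 n) (good1_psi 1 n)).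
  have cu : continuous (fun u => phi n u ^+ 2).
    by move=> u; apply: differentiable_continuous; apply/derivable1_diffP; case: (du u).
  have F := @continuous_FTC2 R f' (fun u => phi n u ^+ 2) t (t + r) tr.
  have {}F : (\int[mu]_(x in `[t, (t + r)%R]) (f' x)%:E = (phi n (t + r) ^+ 2)%:E - (phi n t ^+ 2)%:E)%E.
    apply: F.
    - exact: continuous_subspaceT.
    - split.
      + by move=> u _; case: (du u).
      + by apply: cvg_at_right_filter; exact: cu.
      + by apply: cvg_at_left_filter; exact: cu.
    - by move=> u _; rewrite derive1E; case: (du u).
  have intw := good1_integrable gw.
  have mI : measurable `[t, (t + r)%R] by [].
  have If' : mu.-integrable `[t, (t + r)%R] (EFin \o f').
    apply: continuous_compact_integrable; first exact: segment_compact.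
    exact: continuous_subspaceT.
  have Iwi : mu.-integrable `[t, (t + r)%R] (EFin \o w).
    exact: integrableS intw.
  have G : (- (\int[mu]_(x in `[t, (t + r)%R]) (f' x)%:E) <= \int[mu]_x (w x)%:E)%E.
    rewrite -integralN; last exact: integrable_add_def If'.
    apply: (@le_trans _ _ (\int[mu]_(x in `[t, (t + r)%R]) (w x)%:E)%E).
      apply: le_integral => //; first exact: integrableN.
      move=> u _; rewrite -EFinN lee_fin /f' /w -subr_ge0.
      have := sqr_ge0 (phi n u + psi 1 n u); congr (0 <= _).
      by rewrite !expr2; ring.
    apply: ge0_subset_integral => //.
    - by have /integrableP[] := intw.
    - by move=> x _; rewrite lee_fin.
  move: G; rewrite F -EFinB -EFinN.
  have -> : (\int[mu]_x (w x)%:E = (I1 w)%:E)%E.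
    by rewrite /I1 /Rintegral fineK //; exact: integrable_fin_num.
  rewrite lee_fin => G.
  have := H0 (t + r); rewrite ger0_norm ?sqr_ge0 // => H1.
  by move: G H1; rewrite opprB lerBlDr => G H1; apply: le_trans G _; apply: lerD.
apply/ler_addgt0Pr => e e0.
have K00 : 0 <= K0 by have := le_trans (normr_ge0 _) (H0 0); rewrite pmulr_lge0 // qw_gt0.
(* This makes t + r at least K0 / e + 1, hence (t + r)^2 >= t + r and K0 [qw (t + r)] <= K0 / (t +
   r) <= e. *)
pose r := `|t| + 1 + K0 / e.
have Ke : 0 <= K0 / e by rewrite divr_ge0 // ltW.
have r0 : 0 < r by rewrite /r ltr_wpDr // ltr_wpDl.
apply: (le_trans (step r r0)); apply: lerD => //.
have tr : K0 / e + 1 <= t + r.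
  by rewrite /r; have := ler_norm (- t); rewrite normrN; lra.
rewrite /qw ler_pdivrMr ?qw_den_gt0 //.
have h : K0 <= e * (t + r).
  rewrite mulrC -ler_pdivrMr //; apply: le_trans tr; lra.
apply: (le_trans h); apply: ler_wpM2l; first exact: ltW.
apply: (@le_trans _ _ ((t + r) ^+ 2)); last by rewrite lerDr.
apply: ler_eXnr => //; apply: le_trans tr; lra.
Qed.

(** Here m counts the factors t and the derivatives together. Each of them produces two ladder
    terms, hence a factor 2 and one more square root; the base value 2 (n + 1) at m = 0 is a crude
    bound for |phi_n|. *)
Definition bnd m n : R := 2 ^+ m.+1 * Num.sqrt (n + m).+1%:R ^+ m.+2.

Lemma bnd_ge0 m n : 0 <= bnd m n.
Proof. by rewrite mulr_ge0 ?exprn_ge0 ?sqrtr_ge0. Qed.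

Lemma bnd_rec m n : ld n * bnd m n.-1 + ld n.+1 * bnd m n.+1 <= bnd m.+1 n.
Proof.
have mono (k l : nat) : (k <= l)%N -> Num.sqrt k%:R <= Num.sqrt l%:R :> R.
  by move=> kl; apply: ler_wsqrtr; rewrite ler_nat.
have B k : (k <= n.+1)%N -> ld k <= Num.sqrt (n + m.+1).+1%:R.
  move=> kn; apply: (@le_trans _ _ (Num.sqrt k%:R)); last by apply: mono; lia.
  by apply: ler_wsqrtr; rewrite ler_pdivrMr // ler_peMr // ler1n.
have C k : (k <= n.+1)%N -> bnd m k <= 2 ^+ m.+1 * Num.sqrt (n + m.+1).+1%:R ^+ m.+2.
  move=> kn; apply: ler_wpM2l; first exact: exprn_ge0.
  by apply: lerXn2r; rewrite ?nnegrE ?sqrtr_ge0 //; apply: mono; lia.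
have S k l : (k <= n.+1)%N -> (l <= n.+1)%N ->
   ld k * bnd m l <= Num.sqrt (n + m.+1).+1%:R * (2 ^+ m.+1 * Num.sqrt (n + m.+1).+1%:R ^+ m.+2).
  by move=> kn ln; apply: ler_pM; rewrite ?ld_ge0 ?bnd_ge0 ?B ?C.
apply: le_trans (lerD (S _ _ _ _) (S _ _ _ _)) _ => //; try lia.
rewrite /bnd; set q := Num.sqrt _; rewrite [2 ^+ m.+2]exprS [q ^+ m.+3]exprS.
by rewrite le_eqVlt; apply/orP; left; apply/eqP; ring.
Qed.

Lemma psi_bound a b n t : `|t| ^+ a * `|psi b n t| <= bnd (a + b) n.
Proof.
have rec1 k (u v : R) m : `|u| <= bnd m k.-1 -> `|v| <= bnd m k.+1 ->
    ld k * `|u| + ld k.+1 * `|v| <= bnd m.+1 k.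
  move=> hu hv; apply: le_trans (bnd_rec m k).
  by apply: lerD; apply: ler_wpM2l; rewrite ?ld_ge0.
have n1 c b' k : `|(`|t| ^+ c * `|psi b' k t|)| = `|t| ^+ c * `|psi b' k t|.
  by rewrite ger0_norm // mulr_ge0 ?exprn_ge0.
elim: b n => [|b IHb] n.
  elim: a n => [|a IHa] n.
    rewrite expr0 mul1r /= /bnd addn0 expr1 sqr_sqrtr //.
    have := phi_sqr_le n t; rewrite -real_normK ?num_real // => H.
    rewrite -(@ler_pXn2r _ 2) ?nnegrE ?mulr_ge0 //.
    apply: le_trans H _; rewrite exprMn.
    have h : (1 : R) <= n.+1%:R by rewrite ler1n.
    by rewrite addn0; move: h; move: (n.+1%:R : R) => e h; nra.
  rewrite exprSr -mulrA -normrM [psi 0 n t]/= phi_mulX addn0.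
  have h1 := IHa n.-1; have h2 := IHa n.+1.
  rewrite addn0 in h1 h2.
  have := rec1 n (`|t| ^+ a * `|phi n.-1 t|) (`|t| ^+ a * `|phi n.+1 t|) a.
  rewrite !(n1 a 0%N) => /(_ h1 h2); apply: le_trans.
  rewrite !(mulrCA _ (`|t| ^+ a)) -mulrDr; apply: ler_wpM2l; first exact: exprn_ge0.
  apply: le_trans (ler_normD _ _) _.
  by rewrite !normrM (ger0_norm (ld_ge0 n)) (ger0_norm (ld_ge0 n.+1)).
have h1 := IHb n.-1; have h2 := IHb n.+1.
have := rec1 n (`|t| ^+ a * `|psi b n.-1 t|) (`|t| ^+ a * `|psi b n.+1 t|) (a + b)%N.
rewrite !n1 addnS => /(_ h1 h2); apply: le_trans.
rewrite !(mulrCA _ (`|t| ^+ a)) -mulrDr; apply: ler_wpM2l; first exact: exprn_ge0.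
apply: le_trans (ler_normB _ _) _.
by rewrite !normrM (ger0_norm (ld_ge0 n)) (ger0_norm (ld_ge0 n.+1)).
Qed.

End Hermite1.

(** * Completeness in one variable *)

Section Completeness1.
Variable R : realType.
Implicit Types (n m k : nat) (s t K L a c : R).
Local Notation mu := (@lebesgue_measure R).

Lemma good1_mul_bounded (u v : R -> R) L : good1 u -> continuous v ->
  (forall t, `|v t| <= L) -> good1 (fun t => u t * v t).
Proof.
move=> [cu [K HK]] cv HL; split; first by move=> t; apply: cvgM; [exact: cu|exact: cv].
exists (K * L) => t; rewrite normrM mulrAC; apply: ler_pM => //.
Qed.

Lemma I1_gauss a y : 0 < a -> I1 (fun t => expR (- a * (t - y) ^+ 2)) = Num.sqrt (pi / a).
Proof.
move=> a0; pose s := Num.sqrt ((2 * a)^-1).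
have s2 : s ^+ 2 = (2 * a)^-1 by rewrite sqr_sqrtr // invr_ge0 mulr_ge0 // ltW.
have s0 : s != 0 by rewrite gt_eqF // sqrtr_gt0 invr_gt0 mulr_gt0.
have p0 := normal_peak_gt0 s0.
have an0 : a != 0 by rewrite gt_eqF.
have E : (fun t => expR (- a * (t - y) ^+ 2)) = (fun t => (normal_peak s)^-1 * normal_pdf y s t).
  apply/funext => t; rewrite normal_pdfE // mulrA mulVf ?gt_eqF // mul1r.
  rewrite /normal_fun s2; congr expR; field.
  by rewrite an0.
have En : normal_peak s = (Num.sqrt (pi / a))^-1.
  rewrite /normal_peak s2; congr (Num.sqrt _)^-1; field.
  by rewrite an0.
rewrite E /I1 RintegralZl //; last exact: integrable_normal_pdf.
by rewrite /Rintegral integral_normal_pdf /= mulr1 En invrK.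
Qed.

Section W.
Variables (u : R -> R) (gu : good1 u).

Definition annih (f : R -> R) := forall n, I1 (fun t => u t * (t ^+ n * f t)) = 0.

(* Expand the exponential into its power series and integrate termwise. *)
Lemma annih_exp (f : R -> R) c k : continuous f -> (forall t, 0 <= f t) ->
  (forall n, exists L, forall t, `|t| ^+ n * (expR `|c * t ^+ k| * f t) <= L) ->
  annih f -> annih (fun t => expR (c * t ^+ k) * f t).
Proof.
move=> cf f0 Hb Wf n.
pose S m (x : R) := series (exp_coeff x) m.
have SS m x : S m.+1 x = S m x + x ^+ m / m`!%:R.
  by rewrite /S /series /= big_nat_recr //= /exp_coeff.
have S_le m (x : R) : `|S m x| <= expR `|x|.
  apply: (@le_trans _ _ (S m `|x|)).
    elim: m => [|m IH]; first by rewrite /S /series /= !big_geq // normr0.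
    rewrite !SS; apply: le_trans (ler_normD _ _) _; apply: lerD => //.
    by rewrite normrM normrX normfV normr_nat.
  apply: nondecreasing_cvgn_le; last exact: is_cvg_series_exp_coeff.
  apply/nondecreasing_seqP => i; rewrite -/(S i `|x|) -/(S i.+1 `|x|) SS lerDl.
  by rewrite divr_ge0 // exprn_ge0.
have cpow i : continuous (fun t : R => t ^+ i) by move=> t; exact: exprn_continuous.
have gN N : good1 (fun t => u t * (t ^+ N * f t)).
  have [L HL] := Hb N; apply: (@good1_mul_bounded _ _ L) => //.
    by move=> t; apply: cvgM; [exact: cpow|exact: cf].
  move=> t; rewrite normrM normrX (ger0_norm (f0 t)); apply: le_trans (HL t).
  apply: ler_wpM2l; first exact: exprn_ge0.
  by rewrite ler_peMl // -expR0 ler_expR.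
pose F m t := u t * (t ^+ n * (S m (c * t ^+ k) * f t)).
have FF m : good1 (F m) /\ I1 (F m) = 0.
  elim: m => [|m [IH1 IH2]].
    have -> : F 0%N = (fun t => 0 * (u t * (t ^+ n * f t))).
      by apply/funext => t; rewrite /F /S /series /= big_geq // !(mul0r, mulr0).
    by split; [exact: good1Z|rewrite I1Z // mul0r].
  have -> : F m.+1 = (fun t => F m t + c ^+ m / m`!%:R * (u t * (t ^+ (n + k * m) * f t))).
    by apply/funext => t; rewrite /F SS exprMn exprD exprM; ring.
  have g2 := good1Z (c ^+ m / m`!%:R) (gN (n + k * m)%N).
  by split; [exact: good1D|rewrite I1D // IH2 I1Z // Wf mulr0 addr0].
have [L HL] := Hb n; have [cu [K HK]] := gu.
have K0 : 0 <= K by have := le_trans (normr_ge0 _) (HK 0); rewrite pmulr_lge0 // qw_gt0.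
(* Every partial sum is at most exp |c t^k|, which explains the absolute value in the hypothesis on
   [f]. *)
have dom m t : `|F m t| <= K * L * qw t.
  rewrite /F normrM mulrAC; apply: ler_pM => //.
  rewrite !normrM normrX (ger0_norm (f0 t)); apply: le_trans (HL t).
  apply: ler_wpM2l; first exact: exprn_ge0.
  by apply: ler_wpM2r.
have := @dominated_cvg _ _ R mu setT measurableT (fun m t => (F m t)%:E)
  (fun t => (u t * (t ^+ n * (expR (c * t ^+ k) * f t)))%:E)
  (fun t => (K * L)%:E * (qw t)%:E)%E.
have zero m : (\int[mu]_t (F m t)%:E = 0)%E.
  have [g1 i1] := FF m; have := i1; rewrite /I1 /Rintegral => i2.
  by rewrite -[LHS]fineK ?i2 //; apply: integrable_fin_num => //; exact: good1_integrable.
move=> H; have {}H : ((\int[mu]_t (F m t)%:E)%E @[m --> \oo] -->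
   (\int[mu]_t (u t * (t ^+ n * (expR (c * t ^+ k) * f t)))%:E)%E).
  apply: H.
  - move=> m; apply/measurable_EFinP; apply: continuous_measurable_fun.
    by case: (FF m) => -[].
  - move=> t _; apply: cvg_EFin; first by near=> x.
    apply: cvgM; first exact: cvg_cst.
    apply: cvgM; first exact: cvg_cst.
    apply: cvgM; last exact: cvg_cst.
    exact: is_cvg_series_exp_coeff.
  - by move=> t _.
  - by apply: integrableZl => //; exact: integrable_qw.
  - by move=> m t _; rewrite -EFinM lee_fin; exact: dom.
have {}zero : (fun m => (\int[mu]_t (F m t)%:E)%E) = (fun=> 0%E).
  by apply/funext => m; exact: zero.
rewrite zero in H; have := cvg_lim (@ereal_hausdorff R) H.
rewrite lim_cst; last exact: ereal_hausdorff.
by rewrite /I1 /Rintegral => <-.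
Unshelve. all: by end_near. Qed.

Lemma continuous_gauss a : continuous (fun t : R => expR (- a * t ^+ 2)).
Proof.
move=> t; apply: (@continuous_comp _ _ _ (fun t : R => - a * t ^+ 2) expR).
  by apply: cvgM; [exact: cvg_cst|exact: exprn_continuous].
exact: continuous_expR.
Qed.

(** Domination requires exp |c t^2| exp (-a t^2) to decay, that is |c| < a, so the Gaussian cannot
    be narrowed arbitrarily in one step. With c = -a/2 the rate grows by the factor 3/2, and the
    step can be iterated. *)
Lemma annih_gauss_step a : 0 < a -> annih (fun t => expR (- a * t ^+ 2)) ->
  annih (fun t => expR (- (3 / 2 * a) * t ^+ 2)).
Proof.
move=> a0 Wa.
have := @annih_exp (fun t => expR (- a * t ^+ 2)) (- (a / 2)) 2.
have -> : (fun t : R => expR (- (a / 2) * t ^+ 2) * expR (- a * t ^+ 2)) =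
          (fun t => expR (- (3 / 2 * a) * t ^+ 2)).
  by apply/funext => t; rewrite -expRD; congr expR; field.
apply => //; first exact: continuous_gauss.
move=> n; have [|K K0 HK] := @pow_gauss_bounded R (a / 2) n; first by rewrite divr_gt0.
exists K => t; apply: le_trans (HK t); apply: ler_wpM2l; first exact: exprn_ge0.
rewrite -expRD ler_expR.
have -> : `|- (a / 2) * t ^+ 2| = a / 2 * t ^+ 2.
  by rewrite mulNr normrN ger0_norm // mulr_ge0 ?sqr_ge0 // divr_ge0 // ltW.
by set q := t ^+ 2; lra.
Qed.

Lemma annih_gauss_all : annih (fun t => expR (- (1 / 2) * t ^+ 2)) ->
  forall m, annih (fun t => expR (- ((3 / 2) ^+ m / 2) * t ^+ 2)).
Proof.
move=> W0; elim=> [|m IH]; first by rewrite expr0.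
have -> : (3 / 2) ^+ m.+1 / 2 = 3 / 2 * ((3 / 2) ^+ m / 2) :> R by rewrite exprS; ring.
apply: (annih_gauss_step _ IH).
by rewrite divr_gt0 // exprn_gt0 // divr_gt0.
Qed.

(** Up to a constant, the shifted Gaussian is exp (2 a y t) exp (-a t^2). A linear exponent is
    dominated by half of the Gaussian for every y, so one expansion is enough. *)
Lemma annih_shift a y : 0 < a -> annih (fun t => expR (- a * t ^+ 2)) ->
  I1 (fun t => u t * expR (- a * (t - y) ^+ 2)) = 0.
Proof.
move=> a0 Wa.
have gk : good1 (fun t => u t * (t ^+ 0 * (expR (2 * a * y * t ^+ 1) * expR (- a * t ^+ 2)))).
  apply: (@good1_mul_bounded _ _ (expR (a * y ^+ 2))) => //.
    move=> t; apply: cvgM; first exact: exprn_continuous.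
    apply: cvgM; last exact: continuous_gauss.
    apply: (@continuous_comp _ _ _ (fun t : R => 2 * a * y * t ^+ 1) expR).
      by apply: cvgM; [exact: cvg_cst|exact: exprn_continuous].
    exact: continuous_expR.
  move=> t; rewrite expr0 mul1r -expRD ger0_norm ?expR_ge0 // ler_expR -subr_ge0.
  rewrite [leRHS](_ : _ = a * (t - y) ^+ 2); last by rewrite !expr2 expr1; ring.
  by rewrite mulr_ge0 ?sqr_ge0 // ltW.
have H := @annih_exp (fun t => expR (- a * t ^+ 2)) (2 * a * y) 1.
have := H (@continuous_gauss a) (fun t => expR_ge0 _).
have Hb n : exists L, forall t, `|t| ^+ n * (expR `|2 * a * y * t ^+ 1| * expR (- a * t ^+ 2)) <= L.
  have [|K K0 HK] := @pow_gauss_bounded R (a / 2) n; first by rewrite divr_gt0.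
  (* From completing the square: 2 a |y| |t| <= (a/2) t^2 + 2 a y^2. *)
  exists (expR (2 * a * y ^+ 2) * K) => t.
  apply: le_trans (ler_wpM2l (expR_ge0 _) (HK t)).
  rewrite [leRHS]mulrCA; apply: ler_wpM2l; first exact: exprn_ge0.
  rewrite -!expRD ler_expR !normrM expr1 (gtr0_norm a0) ger0_norm //.
  rewrite -subr_ge0 [leRHS](_ : _ = a / 2 * (`|t| - 2 * `|y|) ^+ 2).
    by rewrite mulr_ge0 ?sqr_ge0 // divr_ge0 // ltW.
  by rewrite -[t ^+ 2]real_normK ?num_real // -[y ^+ 2]real_normK ?num_real // !expr2; field.
move=> /(_ Hb Wa 0%N) => E.
have -> : (fun t => u t * expR (- a * (t - y) ^+ 2)) = (fun t => expR (- a * y ^+ 2) *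
   (u t * (t ^+ 0 * (expR (2 * a * y * t ^+ 1) * expR (- a * t ^+ 2))))).
  apply/funext => t; rewrite expr0 mul1r [RHS]mulrCA -!expRD; congr (_ * expR _).
  by rewrite !expr2 expr1; ring.
by rewrite I1Z // E mulr0.
Qed.

(* Test [u] against Gaussians of variance tending to 0 centred at [y]. *)
Lemma annih_le0 : annih (fun t => expR (- (1 / 2) * t ^+ 2)) -> forall y, u y <= 0.
Proof.
move=> W0 y; rewrite leNgt; apply/negP => uy.
have [cu [K HK]] := gu.
have K0 : 0 <= K by have := le_trans (normr_ge0 _) (HK 0); rewrite pmulr_lge0 // qw_gt0.
have uK t : - K <= u t.
  have := HK t; rewrite ler_norml => /andP[+ _]; apply: le_trans.
  by rewrite lerN2 ler_piMr // qw_le1.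
pose dl := u y / 2; have dl0 : 0 < dl by rewrite divr_gt0.
have [r r0 Hr] : exists2 r, 0 < r & forall t, `|t - y| <= r -> dl <= u t.
  have /cvgrPdist_lt/(_ _ dl0)/nbhs_ballP[r /= r0 Hr] := cu y.
  exists (r / 2); first by rewrite divr_gt0.
  move=> t ty; have : ball y r t.
    by rewrite -ball_normE /= distrC (le_lt_trans ty) // ltr_pdivrMr // ltr_pMr // ltr1n.
  by move=> /Hr; rewrite ltr_norml /dl => /andP[? ?]; lra.
(* Near y one has u >= [dl], elsewhere only u >= -K. As u annihilates the Gaussian, [dl] times its
   total mass is at most (K + [dl]) times its mass at distance more than r, which is exponentially
   small in a. *)
have key m a : a = (3 / 2) ^+ m / 2 -> 1 <= a ->
    dl * Num.sqrt (pi / a) <= (K + dl) * expR (- (a - 1) * r ^+ 2) * Num.sqrt (pi / 1).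
  move=> aE a1; have a0 : 0 < a by apply: lt_le_trans a1.
  have Wa := annih_gauss_all W0 m; rewrite -aE in Wa.
  have E0 := annih_shift y a0 Wa.
  rewrite -(I1_gauss y a0) -(@I1_gauss 1 y) //.
  have gg b : 0 < b -> good1 (fun t => expR (- b * (t - y) ^+ 2)).
    move=> b0.
    have gb : good1 (fun t => expR (- b * t ^+ 2)).
      split; first exact: continuous_gauss.
      have [L L0 HL] := pow_gauss_bounded 0 b0; have [L' L0' HL'] := pow_gauss_bounded 2 b0.
      exists (L + L') => t; rewrite ler_pdivlMr ?qw_den_gt0 // ger0_norm ?expR_ge0 //.
      have := HL t; have := HL' t; rewrite expr0 mul1r real_normK ?num_real // => h1 h2.
      by rewrite mulrDr mulr1 [X in _ + X]mulrC; exact: lerD.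
    exact: (good1_translate (- y) gb).
  rewrite -!I1Z; [|exact: gg..].
  rewrite -[leRHS]add0r -E0 -I1D; last 2 first.
  - apply: (@good1_mul_bounded _ _ 1) => //; first by case: (gg a a0).
    by move=> t; rewrite ger0_norm ?expR_ge0 // -expR0 ler_expR mulNr oppr_le0 mulr_ge0 ?sqr_ge0 // ltW.
  - by apply: good1Z; exact: gg.
  apply: I1_le.
  - by apply: good1Z; exact: gg.
  - apply: good1D; last by apply: good1Z; exact: gg.
    apply: (@good1_mul_bounded _ _ 1) => //; first by case: (gg a a0).
    by move=> t; rewrite ger0_norm ?expR_ge0 // -expR0 ler_expR mulNr oppr_le0 mulr_ge0 ?sqr_ge0 // ltW.
  move=> t; have [tr|tr] := lerP `|t - y| r.
    apply: (@le_trans _ _ (u t * expR (- a * (t - y) ^+ 2))).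
      by apply: ler_wpM2r; [exact: expR_ge0|exact: Hr].
    by rewrite lerDl !mulr_ge0 ?expR_ge0 // addr_ge0 // ltW.
  have h1 : expR (- a * (t - y) ^+ 2) <= expR (- (a - 1) * r ^+ 2) * expR (- 1 * (t - y) ^+ 2).
    rewrite -expRD ler_expR.
    have h : r ^+ 2 <= (t - y) ^+ 2.
      by rewrite -[leRHS]real_normK ?num_real // lerXn2r ?nnegrE // ltW.
    have : 0 <= (a - 1) * ((t - y) ^+ 2 - r ^+ 2) by rewrite mulr_ge0 // subr_ge0.
    by move: (r ^+ 2) ((t - y) ^+ 2) => q1 q2; lra.
  rewrite -lerBlDl -mulrBl.
  apply: (@le_trans _ _ ((K + dl) * expR (- a * (t - y) ^+ 2))).
    apply: ler_wpM2r; first exact: expR_ge0.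
    by have := uK t; lra.
  rewrite -[leRHS]mulrA; apply: ler_wpM2l => //.
  by rewrite addr_ge0 // ltW.
(* With sqrt a <= a, [key] gives [dl] exp (a r^2) <= (K + [dl]) exp (r^2) a. Inserting (a r^2)^2 <=
   2 exp (a r^2) bounds a by [Cst]. *)
pose Cst := (K + dl) * expR (r ^+ 2) * 2 / (r ^+ 4 * dl).
have r2 : 0 < r ^+ 2 by rewrite exprn_gt0.
have ub m : (1 <= (3 / 2) ^+ m / 2 :> R) -> (3 / 2) ^+ m / 2 <= Cst.
  move=> a1; have := key m _ erefl a1; move: a1; set a := (3 / 2) ^+ m / 2 => a1 H.
  have a0 : 0 < a by apply: lt_le_trans a1.
  have p0 : 0 < Num.sqrt pi :> R by rewrite sqrtr_gt0 pi_gt0.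
  have sa : 0 < Num.sqrt a by rewrite sqrtr_gt0.
  have saa : Num.sqrt a <= a.
    by rewrite -{2}(sqr_sqrtr (ltW a0)); apply: ler_eXnr; rewrite // -sqrtr1; exact: ler_wsqrtr.
  move: H; rewrite divr1 sqrtrM ?pi_ge0 // sqrtrV ?(ltW a0) // mulrCA [leRHS]mulrC ler_pM2l //.
  rewrite ler_pdivrMr // => H.
  have H2 : (a * r ^+ 2) ^+ 2 <= 2 * expR (a * r ^+ 2).
    by apply: (pow_fact_le_expR 2); rewrite mulr_ge0 // ltW.
  have E : expR (- (a - 1) * r ^+ 2) = expR (r ^+ 2) / expR (a * r ^+ 2).
    by rewrite -expRN -expRD; congr expR; ring.
  rewrite E in H.
  have e0 : 0 < expR (a * r ^+ 2) by exact: expR_gt0.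
  have H3 : dl * expR (a * r ^+ 2) <= (K + dl) * expR (r ^+ 2) * a.
    rewrite -ler_pdivlMr //; apply: le_trans H _.
    rewrite mulrA [leRHS]mulrAC; apply: ler_wpM2l => //.
    by rewrite mulr_ge0 ?invr_ge0 ?(ltW e0) // mulr_ge0 ?expR_ge0 // addr_ge0 // ltW.
  rewrite /Cst ler_pdivlMr; last by rewrite mulr_gt0 // exprn_gt0.
  rewrite -(ler_pM2l a0).
  apply: (@le_trans _ _ (dl * (2 * expR (a * r ^+ 2)))).
    rewrite [leLHS](_ : _ = dl * (a * r ^+ 2) ^+ 2); last by ring.
    by apply: ler_wpM2l => //; exact: ltW.
  rewrite [leLHS](_ : _ = 2 * (dl * expR (a * r ^+ 2))); last by ring.
  rewrite [leRHS](_ : _ = 2 * ((K + dl) * expR (r ^+ 2) * a)); last by ring.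
  by apply: ler_wpM2l.
have bern m : 1 + m%:R / 2 <= (3 / 2) ^+ m :> R.
  elim: m => [|m IH]; first by rewrite mul0r addr0 expr0.
  rewrite exprS -natr1; have m0 : 0 <= m%:R :> R by [].
  move: IH m0; move: (m%:R : R) ((3 / 2) ^+ m : R) => x z; lra.
(* By the Bernoulli bound, (3/2)^m / 2 >= 1/2 + m/4, which exceeds both [Cst] and 1 for this m and
   contradicts [ub]. *)
pose m := (4 * (Num.trunc `|Cst|).+2)%N.
have hm := bern m.
have h1 : Cst < (3 / 2) ^+ m / 2 /\ 1 <= (3 / 2) ^+ m / 2 :> R.
  have := truncnS_gt `|Cst|; have := ler_norm Cst; have := normr_ge0 Cst.
  move: hm; rewrite /m natrM -[(Num.trunc `|Cst|).+2%:R]natr1.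
  move: ((Num.trunc `|Cst|).+1%:R : R) (`|Cst|) (Cst) ((3 / 2) ^+ _ : R) => x z c w.
  by move=> ? ? ? ?; split; lra.
by have := ub m h1.2; rewrite leNgt h1.1.
Qed.

End W.

(** By the ladder relation t^k phi_m is a combination of Hermite functions; for m = 0 this is t^k
    times the Gaussian. *)
Lemma phi_pow_annih (u : R -> R) : good1 u -> (forall n, I1 (fun t => u t * phi n t) = 0) ->
  annih u (fun t => expR (- (1 / 2) * t ^+ 2)).
Proof.
move=> gu H n.
have gM k m : good1 (fun t => u t * (t ^+ k * phi m t)).
  have [K K0 HK] := phi_decay R m k.
  apply: (@good1_mul_bounded _ _ K) => //; last by move=> t; rewrite normrM normrX.
  by move=> t; apply: cvgM; [exact: exprn_continuous|exact: (@continuous_psi R 0 m)].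
have Hk k m : I1 (fun t => u t * (t ^+ k * phi m t)) = 0.
  elim: k m => [|k IH] m.
    by rewrite -[RHS](H m); congr I1; apply/funext => t; rewrite expr0 mul1r.
  have -> : (fun t => u t * (t ^+ k.+1 * phi m t)) =
    (fun t => ld R m * (u t * (t ^+ k * phi m.-1 t)) + ld R m.+1 * (u t * (t ^+ k * phi m.+1 t))).
    by apply/funext => t; rewrite exprSr -mulrA phi_mulX; ring.
  rewrite I1D ?I1Z ?IH ?mulr0 ?addr0 //; exact: good1Z.
have := Hk n 0%N.
have -> : (fun t => u t * (t ^+ n * phi 0 t)) =
   (fun t => hc R 0 * (u t * (t ^+ n * expR (- (1 / 2) * t ^+ 2)))).
  apply/funext => t; rewrite /phi /= hornerC mulr1 /gau.
  have -> : - t ^+ 2 / 2 = - (1 / 2) * t ^+ 2 by field.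
  by ring.
rewrite I1Z; first by move=> /eqP; rewrite mulf_eq0 (gt_eqF (hc_gt0 R 0)) /= => /eqP.
have [|K K0 HK] := @pow_gauss_bounded R (1 / 2) n; first by rewrite divr_gt0.
apply: (@good1_mul_bounded _ _ K) => //.
  by move=> t; apply: cvgM; [exact: exprn_continuous|exact: continuous_gauss].
by move=> t; rewrite normrM normrX (ger0_norm (expR_ge0 _)).
Qed.

Lemma hermite1_complete (u : R -> R) : good1 u ->
  (forall n, I1 (fun t => u t * phi n t) = 0) -> forall t, u t = 0.
Proof.
move=> gu H t; apply/eqP; rewrite eq_le; apply/andP; split.
  by apply: annih_le0 => //; exact: phi_pow_annih.
rewrite -oppr_le0 -mulN1r; apply: (@annih_le0 (fun t => -1 * u t)); first exact: good1Z.
apply: phi_pow_annih; first exact: good1Z.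
move=> n; have -> : (fun t => -1 * u t * phi n t) = (fun t => -1 * (u t * phi n t)).
  by apply/funext => s; rewrite -mulrA.
by rewrite I1Z ?H ?mulr0 //; apply: good1M => //; exact: good1_phi.
Qed.

End Completeness1.

(** * Hermite functions in several variables *)

Section ProdFamily.
Variables (R : realType) (d : nat) (v : 'I_d -> nat -> R -> R).
Hypothesis dv : forall j k (t : R), is_derive t (1 : R) (v j k) (v j k.+1 t).
Implicit Types (x : 'rV[R]_d) (b : mindex d).

(** The second index of [v] is the order of differentiation, so partial derivatives only shift [b].
    The family serves both the Hermite functions and, for Rodrigues' formula, the Gaussian. *)
Definition PF b x : R := \prod_(j < d) v j (b j) (x ord0 j).

Lemma differentiable_PF b x : differentiable (PF b) x.
Proof.
rewrite /PF; elim: (index_enum _) => [|j s IH].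
  rewrite (_ : (fun x => _) = (fun=> 1)); first exact: differentiable_cst.
  by apply/funext => y; rewrite big_nil.
rewrite (_ : (fun x => _) = (fun x => v j (b j) (x ord0 j) *
   \prod_(j <- s) v j (b j) (x ord0 j))); last by apply/funext => y; rewrite big_cons.
apply: differentiableM => //.
apply: (@differentiable_comp _ _ _ _ (fun x : 'rV[R]_d => x ord0 j) (v j (b j))).
  exact: differentiable_coord.
by apply/derivable1_diffP; case: (dv j (b j) (x ord0 j)).
Qed.

Lemma pder_PF i b : pder i (PF b) = PF (madd b (munit i)).
Proof.
apply/funext => x.
have dd t : derivable (PF b) (x + t *: unitv R i) (unitv R i).
  by apply: diff_derivable; exact: differentiable_PF.
have D1 := is_derive_line (dd 0).
have E : (fun s : R => PF b (x + s *: unitv R i)) =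
  (fun s => (\prod_(j < d | j != i) v j (b j) (x ord0 j)) * v i (b i) (x ord0 i + s)).
  apply/funext => s; rewrite /PF (bigD1 i) //= mulrC addunitvE eqxx mulr1; congr (_ * _).
  by apply: eq_bigr => j /negPf ji; rewrite addunitvE ji mulr0 addr0.
rewrite E scale0r addr0 in D1.
have D2 : is_derive (0 : R) 1 (fun s => (\prod_(j < d | j != i) v j (b j) (x ord0 j)) *
    v i (b i) (x ord0 i + s)) ((\prod_(j < d | j != i) v j (b j) (x ord0 j)) * v i (b i).+1 (x ord0 i)).
  apply: is_deriveZ.
  have d1 : is_derive (0 : R) 1 (fun s : R => x ord0 i + s) 1.
    rewrite -[X in is_derive _ _ _ X]add0r.
    exact: (@is_deriveD _ _ _ (cst (x ord0 i)) id).
  have d0 := dv i (b i) (x ord0 i + 0).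
  have := @is_derive1_comp _ (v i (b i)) (fun s : R => x ord0 i + s) 0 _ _ d0 d1.
  by rewrite addr0 mulr1.
have := @derive_val _ _ _ _ _ _ _ D1; rewrite (@derive_val _ _ _ _ _ _ _ D2) /pder => <-.
rewrite /PF [RHS](bigD1 i) //= [RHS]mulrC !ffunE eqxx addn1; congr (_ * _).
by apply: eq_bigr => j /negPf ji; rewrite !ffunE ji addn0.
Qed.

Lemma smooth_PF b : smooth (PF b).
Proof.
apply: (@smooth_coind _ _ (fun g => exists b, g = PF b)); last by exists b.
  by move=> g x [c ->]; exact: differentiable_PF.
by move=> g j [c ->]; rewrite pder_PF; exists (madd c (munit j)).
Qed.

Lemma dl_PF js b : dl js (PF b) = PF (madd b (mcnt js)).
Proof.
elim: js => [|j js IH].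
  by congr PF; apply/ffunP => j; rewrite !ffunE addn0.
rewrite dl_cons IH pder_PF; congr PF; apply/ffunP => k.
by rewrite !ffunE /= -addnA [(_ + (k == j))%N]addnC eq_sym.
Qed.

Lemma pders_PF b b0 : pders b (PF b0) = PF (madd b0 b).
Proof. by rewrite pdersE dl_PF mcnt_mlist. Qed.

End ProdFamily.

(** * Product Hermite functions, their coefficient functionals and completeness *)

Section HermiteD.
Variable R : realType.

Definition Psi d (b g : mindex d) (x : 'rV[R]_d) : R := \prod_(j < d) psi (b j) (g j) (x ord0 j).
Definition Hd d (g : mindex d) (x : 'rV[R]_d) : R := \prod_(j < d) phi (g j) (x ord0 j).

Lemma PsiE d (b g : mindex d) : Psi b g = PF (fun j k => psi k (g j)) b.
Proof. by []. Qed.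

Lemma is_derive_psi_family d (g : mindex d) (j : 'I_d) k (t : R) :
  is_derive t (1 : R) ((fun j k => psi k (g j)) j k) ((fun j k => psi k (g j)) j k.+1 t).
Proof. exact: is_derive_psi. Qed.

Lemma HdE d (g : mindex d) : Hd g = Psi (Defs.mzero d) g.
Proof. by apply/funext => x; apply: eq_bigr => j _; rewrite ffunE. Qed.

Lemma pder_Psi d j (b g : mindex d) : pder j (Psi b g) = Psi (madd b (munit j)) g.
Proof. by rewrite !PsiE (pder_PF (is_derive_psi_family g)). Qed.

Lemma smooth_Psi d (b g : mindex d) : smooth (Psi b g).
Proof. by rewrite PsiE; exact: (smooth_PF (is_derive_psi_family g)). Qed.

Lemma smooth_Hd d (g : mindex d) : smooth (Hd g).
Proof. by rewrite HdE; exact: smooth_Psi. Qed.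

Lemma dl_Hd d js (g : mindex d) : dl js (Hd g) = Psi (mcnt js) g.
Proof.
rewrite HdE !PsiE (dl_PF (is_derive_psi_family g)).
by congr PF; apply/ffunP => j; rewrite !ffunE.
Qed.

Lemma pders_Hd d b (g : mindex d) : pders b (Hd g) = Psi b g.
Proof. by rewrite pdersE dl_Hd mcnt_mlist. Qed.

Lemma Psi_bound d (a b g : mindex d) x :
  `|monom x a| * `|Psi b g x| <= \prod_(j < d) bnd R (a j + b j) (g j).
Proof.
rewrite /monom /Psi !normr_prod -big_split /=; apply: ler_prod => j _.
by rewrite normrX psi_bound mulr_ge0 ?exprn_ge0.
Qed.

Lemma sch_Hd d (g : mindex d) : sch (Hd g).
Proof.
apply/schP; split; first exact: smooth_Hd.
move=> a b; exists (\prod_(j < d) bnd R (a j + b j) (g j)) => x.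
by rewrite pders_Hd; exact: Psi_bound.
Qed.

(** The lowering operator x_j + d_j is the formal adjoint of the raising operator, so this is what
    partial integration produces in [xi_Ap]. *)
Lemma Hd_lower d (g : mindex d) j (x : 'rV[R]_d) :
  x ord0 j * Hd (madd g (munit j)) x + pder j (Hd (madd g (munit j))) x =
  2 * ld R (g j).+1 * Hd g x.
Proof.
have -> : pder j (Hd (madd g (munit j))) = Psi (munit j) (madd g (munit j)).
  by rewrite HdE pder_Psi; congr Psi; apply/ffunP => k; rewrite !ffunE.
pose P := \prod_(i < d | i != j) phi (g i) (x ord0 i).
have -> : Hd (madd g (munit j)) x = phi (g j).+1 (x ord0 j) * P.
  rewrite /Hd (bigD1 j) //= !ffunE eqxx addn1; congr (_ * _).
  by apply: eq_bigr => i /negPf ij; rewrite !ffunE ij addn0.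
have -> : Psi (munit j) (madd g (munit j)) x = psi 1 (g j).+1 (x ord0 j) * P.
  rewrite /Psi (bigD1 j) //= !ffunE eqxx addn1; congr (_ * _).
  by apply: eq_bigr => i /negPf ij; rewrite !ffunE ij addn0.
have -> : Hd g x = phi (g j) (x ord0 j) * P by rewrite /Hd (bigD1 j).
by rewrite mulrA phi_mulX /=; ring.
Qed.

Lemma iint_prod d (c : R) (w : 'I_d -> R -> R) : (forall j, good1 (w j)) ->
  iint (fun x : 'rV[R]_d => c * \prod_(j < d) w j (x ord0 j)) = c * \prod_(j < d) I1 (w j).
Proof.
elim: d c w => [|d IH] c w gw; first by rewrite /= !big_ord0.
rewrite iintS big_ord_recl mulrA mulrAC -I1Z //; congr I1; apply/funext => t.
have -> : (fun y : 'rV[R]_d => c * \prod_(j < d.+1) w j (sl t y ord0 j)) =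
   (fun y => c * w ord0 t * \prod_(j < d) w (lift ord0 j) (y ord0 j)).
  by apply/funext => y; rewrite big_ord_recl sl0 mulrA; under eq_bigr do rewrite slS.
by rewrite (IH _ (fun j => w (lift ord0 j))) // mulrAC.
Qed.

Lemma Hd_orthonormal d (g g' : mindex d) : iint (fun x => Hd g x * Hd g' x) = (g == g')%:R.
Proof.
have -> : (fun x : 'rV[R]_d => Hd g x * Hd g' x) =
   (fun x => 1 * \prod_(j < d) (phi (g j) (x ord0 j) * phi (g' j) (x ord0 j))).
  by apply/funext => x; rewrite mul1r big_split.
rewrite (@iint_prod d 1 (fun j t => phi (g j) t * phi (g' j) t)); last first.
  by move=> j; apply: good1M; exact: good1_phi.
rewrite mul1r; under eq_bigr do rewrite -/(ip R _ _) ip_orthonormal.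
case: eqVneq => [->|gg]; first by rewrite big1 // => j _; rewrite eqxx.
have [j gj] : exists j, g j != g' j.
  by apply/existsP; apply: contraNT gg => /existsPn H; apply/eqP/ffunP => j; have := H j; rewrite negbK => /eqP.
by rewrite (bigD1 j) //= (negPf gj) mul0r.
Qed.

(** Multipliers of the class [lipgood]: no decay is asked. This matters in the completeness proof,
    where a Hermite function of all variables but the first is regarded as a function of all of
    them. *)
Definition blip d (h : 'rV[R]_d -> R) := exists2 K, 0 <= K &
  (forall x, `|h x| <= K) /\ (forall j s x, `|h (x + s *: unitv R j) - h x| <= K * `|s|).

Lemma lipgood_blip d (h : 'rV[R]_d -> R) : lipgood h -> blip h.
Proof.
move=> [K HK]; have K0 := lipgoodK_ge0 HK; exists K => //; move: HK => [H1 H2].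
split=> [x|j s x]; first by apply: le_trans (H1 x) _; rewrite ler_piMr // wt_le1.
apply: le_trans (H2 j s x) _; rewrite ler_piMr // ?mulr_ge0 //.
by apply: prodr_ile1 => i _; rewrite qw_ge0 qw_le1.
Qed.

Lemma lipgood_mul d (f h : 'rV[R]_d -> R) : lipgood f -> blip h -> lipgood (fun x => f x * h x).
Proof.
move=> [K HK] [L L0 [H3 H4]]; have K0 := lipgoodK_ge0 HK; move: HK => [H1 H2].
exists (K * L + K * L); split=> [x|j s x].
  apply: (@le_trans _ _ (K * L * wt x)).
    by rewrite normrM mulrAC; apply: ler_pM.
  by rewrite mulrDl lerDl !mulr_ge0 ?wt_ge0.
have -> : f (x + s *: unitv R j) * h (x + s *: unitv R j) - f x * h x =
  f (x + s *: unitv R j) * (h (x + s *: unitv R j) - h x)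
  + (f (x + s *: unitv R j) - f x) * h x by ring.
apply: le_trans (ler_normD _ _) _; rewrite !normrM !mulrDl; apply: lerD.
  rewrite [leRHS](_ : _ = K * wtd j x * (L * `|s|)); last by ring.
  apply: ler_pM => //; apply: le_trans (H1 _) _; apply: ler_wpM2l => //.
  by rewrite -(wtd_same j x s); exact: wt_le_wtd.
rewrite [leRHS](_ : _ = K * `|s| * wtd j x * L); last by ring.
by apply: ler_pM.
Qed.

Lemma lipgood_wt d : lipgood (@wt R d).
Proof.
have qlip (t s : R) : `|qw (t + s) - qw t| <= `|s|.
  have p1 := qw_den_gt0 (t + s); have p2 := qw_den_gt0 t.
  (* With a = t + s and b = t the numerator is a + b, and |a + b| <= (1 + a^2) (1 + b^2). *)
  have -> : qw (t + s) - qw t = s * - ((2 * t + s) / ((1 + (t + s) ^+ 2) * (1 + t ^+ 2))).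
    by rewrite /qw; field; rewrite !gt_eqF.
  rewrite normrM ler_piMr // normrN normrM normfV (gtr0_norm (mulr_gt0 p1 p2)).
  rewrite ler_pdivrMr ?mulr_gt0 // mul1r ler_norml.
  have h1 := sqr_ge0 (t + s + t); have h2 := sqr_ge0 ((t + s) * t).
  have h3 := sqr_ge0 (t + s - 1); have h4 := sqr_ge0 (t + s + 1).
  have h5 := sqr_ge0 (t - 1); have h6 := sqr_ge0 (t + 1).
  move: h1 h2 h3 h4 h5 h6; rewrite !expr2 => *; apply/andP; split; nra.
exists 1; split=> [x|j s x]; first by rewrite mul1r ger0_norm // wt_ge0.
rewrite !(wtE j) wtd_same -mulrBl normrM mul1r (ger0_norm (wtd_ge0 _ _)).
apply: ler_wpM2r; first exact: wtd_ge0.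
by rewrite addunitvE eqxx mulr1; exact: qlip.
Qed.

Definition xi d (g : mindex d) (f : 'rV[R]_d -> R) : R := iint (fun x => f x * Hd g x).

(* AM-GM: [|u H| <= S (wt + H^2)], and both terms have integrals independent of [g]. *)
Lemma xi_bound d (g : mindex d) (u : 'rV[R]_d -> R) S : sch u -> 0 <= S ->
  (forall x, `|u x| <= S * wt x) -> `|xi g u| <= S * (I1 (@qw R) ^+ d + 1).
Proof.
move=> su S0 Hu.
have gu := sch_lipgood su; have gH := sch_lipgood (sch_Hd g).
have gHH := lipgood_mul gH (lipgood_blip gH).
have gw := lipgood_wt d.
have guH := lipgood_mul gu (lipgood_blip gH).
have gB : lipgood (fun x : 'rV[R]_d => S * (wt x + Hd g x * Hd g x)).
  by apply: lipgoodZ; exact: lipgoodD.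
have E : iint (fun x : 'rV[R]_d => S * (wt x + Hd g x * Hd g x)) = S * (iint (@wt R d) + 1).
  by rewrite iintZ ?iintD ?Hd_orthonormal ?eqxx //; exact: lipgoodD.
have pt x : `|u x * Hd g x| <= S * (wt x + Hd g x * Hd g x).
  rewrite normrM; apply: (@le_trans _ _ (S * (wt x * `|Hd g x|))).
    by rewrite mulrA; apply: ler_wpM2r.
  apply: ler_wpM2l => //.
  have := sqr_ge0 (wt x - `|Hd g x|); rewrite -[Hd g x * Hd g x]expr2 -[Hd g x ^+ 2]real_normK ?num_real //.
  have := wt_ge0 x; have := wt_le1 x; move: (wt x) (`|Hd g x|) (normr_ge0 (Hd g x)) => w h *.
  nra.
apply: (@le_trans _ _ (S * (iint (@wt R d) + 1))).
  rewrite ler_norml -E; apply/andP; split; last first.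
    by apply: iint_le => // x; apply: le_trans (ler_norm _) (pt x).
  rewrite -mulN1r -iintZ //; apply: iint_le => //; first exact: lipgoodZ.
  by move=> x; rewrite mulN1r; have := pt x; rewrite ler_norml => /andP[].
apply: ler_wpM2l => //; apply: lerD => //; apply: le_trans (ler_norm _) _.
rewrite -[leRHS]mul1r; apply: iint_norm => // x.
by rewrite mul1r ger0_norm // wt_ge0.
Qed.

Lemma xiD d (g : mindex d) (f1 f2 : 'rV[R]_d -> R) : sch f1 -> sch f2 ->
  xi g (fun x => f1 x + f2 x) = xi g f1 + xi g f2.
Proof.
move=> s1 s2; rewrite /xi -iintD; try by apply: sch_lipgood; apply: sch_mul => //; exact: sch_Hd.
by congr iint; apply/funext => x; rewrite mulrDl.
Qed.

Lemma xiZ d (g : mindex d) (c : R) (f : 'rV[R]_d -> R) : sch f ->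
  xi g (fun x => c * f x) = c * xi g f.
Proof.
move=> sf; rewrite /xi -iintZ; last by apply: sch_lipgood; apply: sch_mul => //; exact: sch_Hd.
by congr iint; apply/funext => x; rewrite mulrA.
Qed.

Definition Ap d (j : 'I_d) (f : 'rV[R]_d -> R) : 'rV[R]_d -> R :=
  fun x => x ord0 j * f x + -1 * pder j f x.

Lemma sch_Ap d (j : 'I_d) f : sch f -> sch (Ap j f).
Proof.
move=> sf; apply: sch_add; first exact: sch_coord.
by apply: sch_scale; exact: sch_pder.
Qed.

(** The integral of d_j of the product of f with the raised Hermite function vanishes; this moves
    the derivative onto the Hermite function, where [Hd_lower] applies. The factor is sqrt (2 (g_j +
    1)). *)
Lemma xi_Ap d (g : mindex d) j f : sch f ->
  xi (madd g (munit j)) (Ap j f) = 2 * ld R (g j).+1 * xi g f.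
Proof.
move=> sf; pose H' := Hd (madd g (munit j)); have sH : sch H' by exact: sch_Hd.
have sfH := sch_mul sf sH.
have I0 := iint_pder j sfH; have sP := sch_pder j sfH.
have sfHg : sch (fun x => f x * Hd g x) by apply: sch_mul => //; exact: sch_Hd.
rewrite /xi -/H' -iintZ; last exact: sch_lipgood.
have -> : (fun x => Ap j f x * H' x) = (fun x => 2 * ld R (g j).+1 * (f x * Hd g x)
   + -1 * pder j (fun x => f x * H' x) x).
  apply/funext => x; rewrite pderM; [|exact: sch_smooth..].
  by rewrite mulrCA -Hd_lower -/H' /Ap; ring.
rewrite iintD; [|exact: sch_lipgood (sch_scale _ _)|exact: sch_lipgood (sch_scale _ _)].
by rewrite (iintZ _ (sch_lipgood sP)) I0 mulr0 addr0.
Qed.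

Lemma Hd_sl d (n : nat) (g : mindex d) t y :
  Hd [ffun j => if unlift ord0 j is Some i then g i else n] (sl t y) = phi n t * Hd g y.
Proof.
rewrite /Hd big_ord_recl ffunE unlift_none sl0; congr (_ * _).
by apply: eq_bigr => j _; rewrite ffunE liftK slS.
Qed.

(* Integrating out all variables but the first leaves a function of one variable
   that is orthogonal to every [phi n]. *)
Lemma hermite_complete d (f : 'rV[R]_d -> R) : lipgood f ->
  (forall g, xi g f = 0) -> forall x, f x = 0.
Proof.
elim: d f => [|d IH] f gf H x.
  have := H (Defs.mzero 0); rewrite /xi /= /Hd big_ord0 mulr1 => <-.
  by congr f; apply/rowP => -[].
rewrite (sl_surj x); set t := x ord0 ord0; set y := \row__ _.
apply: (IH (fun y => f (sl t y))); first exact: lipgood_slice.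
move=> g; rewrite /xi.
pose tl (x : 'rV[R]_d.+1) : 'rV[R]_d := \row_j x ord0 (lift ord0 j).
have tlsl s z : tl (sl s z) = z by apply/rowP => j; rewrite mxE slS.
have gHd := sch_lipgood (sch_Hd g); have [K K0 [B1 B2]] := lipgood_blip gHd.
have bl : blip (fun x => Hd g (tl x)).
  exists K => //; split=> [z|j s z]; first exact: B1.
  rewrite (sl_surj z); case: (unliftP ord0 j) => [i ->|->].
    by rewrite sl_unitvS !tlsl; exact: B2.
  by rewrite sl_unitv0 !tlsl subrr normr0 mulr_ge0.
have gF := iint_good1 (lipgood_mul gf bl).
have FE : (fun t => iint (fun y => f (sl t y) * Hd g (tl (sl t y)))) =
          (fun t => iint (fun y => f (sl t y) * Hd g y)).
  by apply/funext => s; congr iint; apply/funext => z; rewrite tlsl.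
rewrite FE in gF.
apply: (hermite1_complete gF) => n.
have := H [ffun j => if unlift ord0 j is Some i then g i else n].
rewrite /xi iintS => E; rewrite -[RHS]E; congr I1; apply/funext => s.
rewrite mulrC -iintZ; last by apply: lipgood_mul; [exact: lipgood_slice|exact: lipgood_blip].
by congr iint; apply/funext => z; rewrite Hd_sl mulrCA.
Qed.

Lemma hermite_Hd d (g : mindex d) (x : 'rV[R]_d) : hermite g x = Hd g x.
Proof.
(* The k-th derivative of e^(-t^2). Both sides factor over the coordinates, so Rodrigues' formula is
   needed in one variable only. *)
pose gd (j : 'I_d) k (t : R) : R := (-1) ^+ k * (hp R k).[t] * expR (- t ^+ 2).
have dgd j k (t : R) : is_derive t (1 : R) (gd j k) (gd j k.+1 t).
  have dp : is_derive t (1 : R) (fun t => (-1) ^+ k * (hp R k).[t]) ((-1) ^+ k * (hp R k)^`().[t]).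
    by apply: is_deriveZ.
  have de : is_derive t (1 : R) (fun t => expR (- t ^+ 2)) (- (2 * t) * expR (- t ^+ 2)).
    by apply: is_derive_eq; rewrite /GRing.scale /=; ring.
  have := @is_deriveM _ _ _ _ _ _ _ _ dp de.
  rewrite /GRing.scale /= => D; apply: is_derive_eq.
  rewrite /gd [hp R k.+1]/= hornerD hornerN !hornerM hornerC hornerX [(-1) ^+ k.+1]exprS.
  by ring.
have E0 : (fun y : 'rV[R]_d => expR (- sqnorm y)) = PF gd (Defs.mzero d).
  apply/funext => y; rewrite /sqnorm -sumrN expR_sum; apply: eq_bigr => j _.
  by rewrite /gd ffunE expr0 mul1r /= hornerC mul1r.
rewrite /hermite /hermite_poly E0 (pders_PF dgd).
have -> : PF gd (madd (Defs.mzero d) g) x = \prod_(j < d) gd j (g j) (x ord0 j).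
  by apply: eq_bigr => j _; rewrite !ffunE.
have -> : (Num.sqrt (2 ^+ mlen g * (mfact g)%:R * pi `^ (d%:R / 2)))^-1 = \prod_(j < d) hc R (g j).
  have -> : 2 ^+ mlen g * (mfact g)%:R * pi `^ (d%:R / 2) =
      \prod_(j < d) (2 ^+ g j * (g j)`!%:R * Num.sqrt pi) :> R.
    rewrite !big_split /= /mlen -expr_sum /mfact natr_prod; congr (_ * _).
    rewrite prodr_const card_ord mulrC powRrM powR12_sqrt ?pi_ge0 //.
    by rewrite powR_mulrn // sqrtr_ge0.
  have -> : Num.sqrt (\prod_(j < d) (2 ^+ g j * (g j)`!%:R * Num.sqrt pi)) =
     \prod_(j < d) Num.sqrt (2 ^+ g j * (g j)`!%:R * Num.sqrt pi) :> R.
    elim: (index_enum _) => [|j s IH]; first by rewrite !big_nil sqrtr1.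
    by rewrite !big_cons sqrtrM ?IH // !mulr_ge0 ?exprn_ge0 ?sqrtr_ge0.
  by rewrite -prodfV.
have -> : (-1) ^+ mlen g = \prod_(j < d) (-1) ^+ g j :> R by rewrite /mlen -expr_sum.
have -> : expR (sqnorm x) = \prod_(j < d) expR (x ord0 j ^+ 2) by rewrite /sqnorm expR_sum.
have -> : expR (- sqnorm x / 2) = \prod_(j < d) gau (x ord0 j).
  by rewrite /sqnorm -sumrN mulr_suml expR_sum.
rewrite -!big_split /Hd /=; apply: eq_bigr => j _; rewrite /gd /phi.
have E1 : expR (x ord0 j ^+ 2) * expR (- x ord0 j ^+ 2) = 1 by rewrite -expRD subrr expR0.
have E2 : (-1) ^+ g j * (-1) ^+ g j = 1 :> R by rewrite -exprMn mulrNN mulr1 expr1n.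
transitivity (hc R (g j) * (((-1) ^+ g j * (-1) ^+ g j) *
   (expR (x ord0 j ^+ 2) * expR (- x ord0 j ^+ 2))) * (hp R (g j)).[x ord0 j] * gau (x ord0 j)).
  by ring.
by rewrite E1 E2 mulr1 mulr1.
Qed.

End HermiteD.

(** * Series of Hermite functions *)

Section MultiSum.
Variables (R : realType) (d : nat).
Implicit Types (g : mindex d) (u v : mindex d -> R) (s F : seq (mindex d)).

(** A summable weight on multi-indices, used as the common majorant of all series below. *)
Definition w2 g : R := \prod_(j < d) (g j).+1%:R ^- 2.

Lemma w2_ge0 g : 0 <= w2 g.
Proof. by apply: prodr_ge0 => j _; rewrite invr_ge0 exprn_ge0. Qed.

Lemma w2_gt0 g : 0 < w2 g.
Proof. by apply: prodr_gt0 => j _; rewrite invr_gt0 exprn_gt0. Qed.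

Lemma sum_invsqr_le N : \sum_(k < N) k.+1%:R ^- 2 <= 2 :> R.
Proof.
case: N => [|N]; first by rewrite big_ord0.
(* The telescoping term -1/(N+1) makes the bound provable by induction. *)
suff : \sum_(k < N.+1) k.+1%:R ^- 2 <= 2 - N.+1%:R^-1 :> R.
  by move=> /le_trans; apply; rewrite gerBl invr_ge0.
elim: N => [|N IH]; first by rewrite big_ord1 expr1n invr1; lra.
rewrite big_ord_recr /=; apply: le_trans (lerD IH (lexx _)) _.
rewrite -lerBrDr -subr_ge0 -[N.+2%:R]natr1.
have : (1 : R) <= N.+1%:R by rewrite ler1n.
move: (N.+1%:R : R) => x x1; have x0 : 0 < x by lra.
have x10 : 0 < x + 1 by lra.
rewrite [leRHS](_ : _ = (x * (x + 1) ^+ 2)^-1).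
  by rewrite invr_ge0 mulr_ge0 ?exprn_ge0 // ltW.
by field; rewrite !gt_eqF.
Qed.

Lemma big_subset_le s F (f : mindex d -> R) : uniq s -> uniq F -> {subset s <= F} ->
  (forall g, 0 <= f g) -> \sum_(g <- s) f g <= \sum_(g <- F) f g.
Proof.
move=> us uF sF f0.
have P : perm_eq s [seq g <- F | g \in s].
  apply: uniq_perm => //; first exact: filter_uniq.
  by move=> g; rewrite mem_filter; case: (boolP (g \in s)) => //= /sF ->.
rewrite (perm_big _ P) big_filter /= [leRHS](bigID (fun g => g \in s)) /= lerDl.
by apply: sumr_ge0.
Qed.

Definition mbox N : seq (mindex d) := [seq [ffun j => val (h j)] | h : {ffun 'I_d -> 'I_N}].

Lemma mbox_uniq N : uniq (mbox N).
Proof.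
rewrite map_inj_uniq ?enum_uniq // => h1 h2 /ffunP E; apply/ffunP => j.
by apply: val_inj; have := E j; rewrite !ffunE.
Qed.

Lemma mem_mbox N g : (forall j, g j < N)%N -> g \in mbox N.
Proof.
move=> H; apply/mapP; exists [ffun j => Ordinal (H j)]; first by rewrite mem_enum.
by apply/ffunP => j; rewrite !ffunE.
Qed.

(** Enclose [s] in a cube: there the sum of products is a product of d one-dimensional sums, each at
    most 2. *)
Lemma sum_w2_le s : uniq s -> \sum_(g <- s) w2 g <= 2 ^+ d.
Proof.
move=> us; pose N := (\sum_(g <- s) \sum_(j < d) g j).+1.
have sN : {subset s <= mbox N}.
  move=> g gs; apply: mem_mbox => j; rewrite /N ltnS.
  by rewrite (big_rem g) //= (bigD1 j) //= -addnA leq_addr.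
apply: le_trans (big_subset_le us (mbox_uniq N) sN w2_ge0) _.
rewrite /mbox big_map big_enum /=.
have -> : \sum_(h : {ffun 'I_d -> 'I_N}) w2 [ffun j => val (h j)] =
  \sum_(h : {ffun 'I_d -> 'I_N}) \prod_(j < d) (h j).+1%:R ^- 2.
  by apply: eq_bigr => h _; apply: eq_bigr => j _; rewrite ffunE.
rewrite -(bigA_distr_bigA (fun (j : 'I_d) (k : 'I_N) => k.+1%:R ^- 2)) /=.
apply: le_trans (_ : \prod_(j < d) 2 <= _); last by rewrite prodr_const card_ord.
apply: ler_prod => j _; rewrite sum_invsqr_le andbT.
by apply: sumr_ge0 => k _; rewrite invr_ge0 exprn_ge0.
Qed.

(** An increasing exhaustion of the multi-indices by finite sets, through their countable encoding.
    It turns sums over multi-indices into limits of sequences; codes of no multi-index are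
    dropped. *)
Definition Lseq n : seq (mindex d) := pmap (@pickle_inv (mindex d)) (iota 0 n).

Lemma Lseq_uniq n : uniq (Lseq n).
Proof. by rewrite (pmap_uniq (@pickle_invK _)) // iota_uniq. Qed.

Lemma mem_Lseq n g : (g \in Lseq n) = (pickle g < n)%N.
Proof.
rewrite mem_pmap; apply/mapP/idP => [[k]|gn].
  rewrite mem_iota /= add0n => kn E.
  by have := @pickle_invK (mindex d) k; rewrite -E /= => ->.
by exists (pickle g); rewrite ?mem_iota // pickleK_inv.
Qed.

Lemma Lseq_cover F : exists n, forall m, (n <= m)%N -> {subset F <= Lseq m}.
Proof.
exists (\sum_(g <- F) pickle g).+1 => m nm g gF; rewrite mem_Lseq; apply: leq_trans nm.
by rewrite ltnS (big_rem g) //= leq_addr.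
Qed.

Lemma Lseq_sub n m : (n <= m)%N -> {subset Lseq n <= Lseq m}.
Proof. by move=> nm g; rewrite !mem_Lseq => /leq_trans; apply. Qed.

Definition psum u n : R := \sum_(g <- Lseq n) u g.
Definition Msum u : R := limn (psum u).
Definition dom u := exists2 K, 0 <= K & forall g, `|u g| <= K * w2 g.

Lemma psum_cvg u : dom u -> cvgn (psum u).
Proof.
have pos v K : (forall g, 0 <= v g) -> (forall g, v g <= K * w2 g) -> cvgn (psum v).
  move=> v0 vK; apply: nondecreasing_is_cvgn.
    move=> n m nm; apply: big_subset_le => //; [exact: Lseq_uniq|exact: Lseq_uniq|exact: Lseq_sub].
  have K0 : 0 <= K.
    by have := le_trans (v0 (Defs.mzero d)) (vK (Defs.mzero d)); rewrite pmulr_lge0 // w2_gt0.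
  exists (K * 2 ^+ d) => _ [n _ <-].
  apply: (@le_trans _ _ (\sum_(g <- Lseq n) K * w2 g)); first by apply: ler_sum.
  by rewrite -mulr_sumr; apply: ler_wpM2l => //; apply: sum_w2_le; exact: Lseq_uniq.
move=> [K K0 HK].
have c1 : cvgn (psum (fun g => u g + K * w2 g)).
  apply: (pos _ (2 * K)) => g; have := HK g; rewrite ler_norml => /andP[h1 h2].
    by move: h1; rewrite -subr_ge0 opprK.
  by rewrite -mulrA mulr_natl mulr2n; apply: lerD.
have c2 : cvgn (psum (fun g => K * w2 g)).
  by apply: (pos _ K) => // g; rewrite mulr_ge0 // w2_ge0.
have -> : psum u = (fun n => psum (fun g => u g + K * w2 g) n - psum (fun g => K * w2 g) n).
  by apply/funext => n; rewrite /psum -sumrB; apply: eq_bigr => g _; rewrite addrK.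
exact: is_cvgB.
Qed.

Lemma domD u v : dom u -> dom v -> dom (fun g => u g + v g).
Proof.
move=> [K K0 HK] [L L0 HL]; exists (K + L); first exact: addr_ge0.
by move=> g; apply: le_trans (ler_normD _ _) _; rewrite mulrDl; exact: lerD.
Qed.

Lemma domZ (c : R) u : dom u -> dom (fun g => c * u g).
Proof.
move=> [K K0 HK]; exists (`|c| * K); first by rewrite mulr_ge0.
by move=> g; rewrite normrM -mulrA; apply: ler_wpM2l.
Qed.

Lemma MsumD u v : dom u -> dom v -> Msum (fun g => u g + v g) = Msum u + Msum v.
Proof.
move=> du dv; rewrite /Msum -limD; [|exact: psum_cvg|exact: psum_cvg].
by congr (limn _); apply/funext => n; rewrite /psum big_split.
Qed.

Lemma MsumZ (c : R) u : dom u -> Msum (fun g => c * u g) = c * Msum u.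
Proof.
move=> du; have cu := psum_cvg du; rewrite {1}/Msum.
have -> : psum (fun g => c * u g) = (fun n => c * psum u n).
  by apply/funext => n; rewrite /psum mulr_sumr.
apply/cvg_lim => //; apply: cvgM; [exact: cvg_cst|exact: cu].
Qed.

Lemma MsumB u v : dom u -> dom v -> Msum (fun g => u g - v g) = Msum u - Msum v.
Proof.
move=> du dv; rewrite -[- Msum v]mulN1r -MsumZ // -MsumD //; last exact: domZ.
by congr Msum; apply/funext => g; rewrite mulN1r.
Qed.

Lemma Msum_sum (I : Type) (r : seq I) (u : I -> mindex d -> R) : (forall i, dom (u i)) ->
  dom (fun g => \sum_(i <- r) u i g) /\
  Msum (fun g => \sum_(i <- r) u i g) = \sum_(i <- r) Msum (u i).
Proof.
move=> du; elim: r => [|i r [IH1 IH2]].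
  have -> : (fun g => \sum_(i <- [::]) u i g) = (fun=> 0).
    by apply/funext => g; rewrite big_nil.
  split; first by exists 0 => // g; rewrite normr0 mul0r.
  rewrite big_nil /Msum; have -> : psum (fun=> 0) = (fun=> 0).
    by apply/funext => n; rewrite /psum big1.
  by rewrite lim_cst.
have -> : (fun g => \sum_(i <- i :: r) u i g) = (fun g => u i g + \sum_(i <- r) u i g).
  by apply/funext => g; rewrite big_cons.
by split; [exact: domD|rewrite MsumD // IH2 big_cons].
Qed.

Lemma Msum_bound u B : dom u -> (forall s, uniq s -> \sum_(g <- s) `|u g| <= B) -> `|Msum u| <= B.
Proof.
move=> du HB; have cu := psum_cvg du.
have nB n : `|psum u n| <= B.
  by apply: le_trans (ler_norm_sum _ _ _) _; apply: HB; exact: Lseq_uniq.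
rewrite ler_norml; apply/andP; split.
  by apply: limr_ge => //; near=> n; have := nB n; rewrite ler_norml => /andP[].
by apply: limr_le => //; near=> n; have := nB n; rewrite ler_norml => /andP[].
Unshelve. all: by end_near. Qed.

Lemma Msum_finite u F : uniq F -> (forall g, g \notin F -> u g = 0) ->
  Msum u = \sum_(g <- F) u g.
Proof.
move=> uF u0; have [n0 Hn] := Lseq_cover F; apply/cvg_lim => //.
apply: cvg_near_cst; exists n0 => // n /= n0n; rewrite /psum.
have P : perm_eq F [seq g <- Lseq n | g \in F].
  apply: uniq_perm => //; first by apply: filter_uniq; exact: Lseq_uniq.
  by move=> g; rewrite mem_filter; case: (boolP (g \in F)) => //= /(Hn _ n0n) ->.
rewrite (perm_big _ P) big_filter /= (bigID (fun g => g \in F)) /=.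
by rewrite [X in _ + X]big1 ?addr0 // => g /u0.
Qed.

Lemma w2_tail (e : R) : 0 < e -> exists F0, forall s, uniq s ->
  (forall g, g \in s -> g \notin F0) -> \sum_(g <- s) w2 g <= e.
Proof.
move=> e0.
have dw : dom w2 by exists 1 => // g; rewrite mul1r ger0_norm // w2_ge0.
have cw := psum_cvg dw.
have H s : uniq s -> \sum_(g <- s) w2 g <= Msum w2.
  move=> us; have [n0 Hn] := Lseq_cover s; apply: limr_ge => //.
  exists n0 => // n /= n0n; apply: big_subset_le => //; [exact: Lseq_uniq|exact: Hn|exact: w2_ge0].
have /cvgrPdist_lt/(_ _ e0)[n _ /(_ n (leqnn n)) /= Hn] := cw.
exists (Lseq n) => s us sd.
have : \sum_(g <- s ++ Lseq n) w2 g <= Msum w2.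
  apply: H; rewrite cat_uniq us Lseq_uniq andbT /=; apply/hasPn => g gL.
  by apply/negP => gs; have := sd g gs; rewrite gL.
rewrite big_cat /= -/(psum w2 n) => h.
by move: Hn; rewrite ltr_norml => /andP[_ h2]; move: h h2; rewrite -/(Msum w2); lra.
Qed.

End MultiSum.

(** * Termwise differentiation of Hermite series *)

Section TermSeries.
Variables (R : realType) (d : nat).
Implicit Types (u : mindex d -> 'rV[R]_d -> R) (x : 'rV[R]_d).

Definition Ssum u x : R := Msum (fun g => u g x).
(** Domination is asked of all derivatives, so that it passes to [pder] and gives a class stable
    under differentiation. *)
Definition termdom u := (forall g, smooth (u g)) /\
  forall js, exists2 K, 0 <= K & forall g x, `|dl js (u g) x| <= K * w2 R g.

Lemma termdom_dom u js x : termdom u -> dom (fun g => dl js (u g) x).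
Proof. by move=> [_ /(_ js)[K K0 HK]]; exists K. Qed.

Lemma termdom_dom0 u x : termdom u -> dom (fun g => u g x).
Proof. exact: (@termdom_dom u [::] x). Qed.

Lemma termdom_pder u j : termdom u -> termdom (fun g => pder j (u g)).
Proof.
move=> [su du]; split=> [g|js]; first exact: smooth_pder.
by have [K K0 HK] := du (rcons js j); exists K => // g x; rewrite -dl_rcons.
Qed.

(** The quadratic Taylor remainders of the terms are bounded by a multiple of [w2], so they add up
    to a quadratic remainder of the sum, which identifies its derivative. *)
Lemma Ssum_differentiable u x : termdom u ->
  differentiable (Ssum u) x /\ forall j, pder j (Ssum u) x = Ssum (fun g => pder j (u g)) x.
Proof.
move=> tu; have [su du] := tu.
have Kij (ij : 'I_d * 'I_d) : {K | 0 <= K /\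
    forall g x, `|pder ij.1 (pder ij.2 (u g)) x| <= K * w2 R g}.
  by apply: cid; have [K K0 HK] := du [:: ij.1; ij.2]; exists K.
pose K := \sum_(ij : 'I_d * 'I_d) sval (Kij ij).
have K0 : 0 <= K by apply: sumr_ge0 => ij _; case: (svalP (Kij ij)).
have HK g i j y : `|pder i (pder j (u g)) y| <= K * w2 R g.
  have [k0 Hk] := svalP (Kij (i, j)).
  apply: le_trans (Hk g y) _; apply: ler_wpM2r; first exact: w2_ge0.
  by rewrite /K (bigD1 (i, j)) //= lerDl; apply: sumr_ge0 => ij _; case: (svalP (Kij ij)).
apply: (@quadratic_remainder_differentiable _ _ _ (fun j => Ssum (fun g => pder j (u g)) x) _
  (d%:R ^+ 2 * K * 2 ^+ d)).
move=> v.
have dj (j : 'I_d) : dom (fun g => v ord0 j * pder j (u g) x).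
  by apply: domZ; exact: (@termdom_dom u [:: j] x tu).
have [D1 E1] := Msum_sum (index_enum 'I_d) dj.
have -> : Ssum u (x + v) - Ssum u x - \sum_(j < d) v ord0 j * Ssum (fun g => pder j (u g)) x
  = Msum (fun g => u g (x + v) - u g x - \sum_(j < d) v ord0 j * pder j (u g) x).
  rewrite MsumB //; last first.
    have := domD (termdom_dom0 (x + v) tu) (domZ (-1) (termdom_dom0 x tu)).
    by congr dom; apply/funext => g; rewrite mulN1r.
  rewrite MsumB; [|exact: termdom_dom0..].
  rewrite E1; congr (_ - _); apply: eq_bigr => j _.
  by rewrite MsumZ //; exact: (@termdom_dom u [:: j] x tu).
have tay g : `|u g (x + v) - u g x - \sum_(j < d) v ord0 j * pder j (u g) x|
     <= d%:R ^+ 2 * K * `|v| ^+ 2 * w2 R g.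
  rewrite mulrAC -[d%:R ^+ 2 * K * _]mulrA; apply: taylor2 => //.
  - by move=> y; apply: smooth_diff.
  - by move=> j y; apply: smooth_diff; exact: smooth_pder.
have C0 : 0 <= d%:R ^+ 2 * K * `|v| ^+ 2 by rewrite !mulr_ge0 ?exprn_ge0.
apply: Msum_bound; first by exists (d%:R ^+ 2 * K * `|v| ^+ 2).
move=> s us.
apply: le_trans (ler_sum _ (fun g _ => tay g)) _.
rewrite -mulr_sumr [leLHS]mulrAC; apply: ler_wpM2r; first exact: exprn_ge0.
by apply: ler_wpM2l; [rewrite mulr_ge0 ?exprn_ge0|exact: sum_w2_le].
Qed.

Lemma pder_Ssum u j : termdom u -> pder j (Ssum u) = Ssum (fun g => pder j (u g)).
Proof. by move=> tu; apply/funext => x; have [_] := Ssum_differentiable x tu. Qed.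

Lemma smooth_Ssum u : termdom u -> smooth (Ssum u).
Proof.
move=> tu; apply: (@smooth_coind _ _ (fun f => exists2 u, termdom u & f = Ssum u)).
- by move=> f x [w tw ->]; have [] := Ssum_differentiable x tw.
- move=> f j [w tw ->]; rewrite pder_Ssum //; exists (fun g => pder j (w g)) => //.
  exact: termdom_pder.
- by exists u.
Qed.

Lemma dl_Ssum u js : termdom u -> dl js (Ssum u) = Ssum (fun g => dl js (u g)).
Proof.
elim/last_ind: js u => [|js j IH] u tu //.
rewrite dl_rcons pder_Ssum // IH; last exact: termdom_pder.
by congr Ssum; apply/funext => g; rewrite dl_rcons.
Qed.

(** The quantity (g + m)^(m/2), which for m = a + b is the growth of x^a d^b H_g up to geometric and
    polynomial factors. *)
Definition Qm (m g : mindex d) : R := \prod_(j < d) Num.sqrt (g j + m j)%:R ^+ m j.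

Lemma Qm_ge0 m g : 0 <= Qm m g.
Proof. by apply: prodr_ge0 => j _; rewrite exprn_ge0 // sqrtr_ge0. Qed.

(* Six extra orders: two absorb the polynomial growth of [bnd], four pay for [w2]. *)
Definition m6 (m : mindex d) : mindex d := [ffun j => (m j + 6)%N].

Lemma bnd_w2 m n : bnd R m n <=
  2 ^+ (m + 6) * Num.sqrt (n + (m + 6))%:R ^+ (m + 6) * n.+1%:R ^- 2.
Proof.
have n0 : 0 < n.+1%:R :> R by [].
rewrite ler_pdivlMr ?exprn_gt0 // /bnd.
set q := Num.sqrt (n + (m + 6))%:R.
have mono (k l : nat) : (k <= l)%N -> Num.sqrt k%:R <= Num.sqrt l%:R :> R.
  by move=> kl; apply: ler_wsqrtr; rewrite ler_nat.
have q0 : 0 <= q by exact: sqrtr_ge0.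
have -> : n.+1%:R ^+ 2 = Num.sqrt n.+1%:R ^+ 4 :> R.
  by rewrite -[4%N]/(2 * 2)%N exprM sqr_sqrtr.
rewrite -mulrA; apply: ler_pM.
- exact: exprn_ge0.
- by apply: mulr_ge0; apply: exprn_ge0; exact: sqrtr_ge0.
- by apply: ler_weXn2l; [rewrite ler1n|lia].
have -> : q ^+ (m + 6) = q ^+ m.+2 * q ^+ 4 by rewrite -exprD; congr (_ ^+ _); lia.
apply: ler_pM; rewrite ?exprn_ge0 ?sqrtr_ge0 //.
  by apply: lerXn2r; rewrite ?nnegrE ?sqrtr_ge0 //; apply: mono; lia.
by apply: lerXn2r; rewrite ?nnegrE ?sqrtr_ge0 //; apply: mono; lia.
Qed.

Lemma Psi_w2 (a b g : mindex d) x : `|monom x a| * `|Psi b g x| <=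
  2 ^+ mlen (m6 (madd a b)) * Qm (m6 (madd a b)) g * w2 R g.
Proof.
apply: le_trans (Psi_bound a b g x) _.
rewrite /mlen expr_sum /Qm /w2 -!big_split /=; apply: ler_prod => j _.
by rewrite bnd_ge0 /= !ffunE; exact: bnd_w2.
Qed.

Definition rapid (c : mindex d -> R) := forall m, exists K, forall g, `|c g| * Qm m g <= K.
Definition TR (c : mindex d -> R) := Ssum (fun g x => c g * Hd g x).

Lemma dl_term (c : R) g js : dl js (fun x => c * Hd g x) = (fun x => c * Psi (mcnt js) g x).
Proof. by rewrite dlZ ?dl_Hd //; exact: smooth_Hd. Qed.

Lemma rapid_termdom c : rapid c -> termdom (fun g x => c g * Hd g x).
Proof.
move=> rc; split=> [g|js]; first by apply: smooth_scale; exact: smooth_Hd.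
pose m := m6 (madd (Defs.mzero d) (mcnt js)).
have [K HK] := rc m.
have K0 : 0 <= K by apply: le_trans (HK (Defs.mzero d)); rewrite mulr_ge0 // Qm_ge0.
exists (2 ^+ mlen m * K); first by rewrite mulr_ge0 // exprn_ge0.
move=> g x; rewrite dl_term normrM.
have := Psi_w2 (Defs.mzero d) (mcnt js) g x; rewrite monom_mzero normr1 mul1r -/m => H.
apply: le_trans (ler_wpM2l (normr_ge0 _) H) _.
rewrite [leLHS](_ : _ = 2 ^+ mlen m * (`|c g| * Qm m g) * w2 R g); last by ring.
apply: ler_wpM2r; first exact: w2_ge0.
by apply: ler_wpM2l => //; rewrite exprn_ge0.
Qed.

(** The mass [tau] of the support is kept apart from the size [B] of the coefficients, so that one
    estimate covers full series, tails and single terms. *)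
Lemma TR_bound c (a b : mindex d) B tau : rapid c -> 0 <= B ->
  (forall g, `|c g| * Qm (m6 (madd a b)) g <= B) ->
  (forall s, uniq s -> (forall g, g \in s -> c g != 0) -> \sum_(g <- s) w2 R g <= tau) ->
  forall x, `|monom x a| * `|pders b (TR c) x| <= 2 ^+ mlen (m6 (madd a b)) * B * tau.
Proof.
move=> rc B0 HB Htau x; have tc := rapid_termdom rc.
rewrite pdersE dl_Ssum //.
have -> : Ssum (fun g => dl (mlist b) (fun x => c g * Hd g x)) x = Msum (fun g => c g * Psi b g x).
  by congr Msum; apply/funext => g; rewrite dl_term mcnt_mlist.
have D : dom (fun g => c g * Psi b g x).
  have := termdom_dom (mlist b) x tc; congr dom.
  by apply/funext => g; rewrite dl_term mcnt_mlist.
rewrite -normrM -MsumZ //; apply: Msum_bound; first exact: domZ.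
move=> s us; set C := 2 ^+ mlen _.
have C0 : 0 <= C by rewrite exprn_ge0.
rewrite (bigID (fun g => c g == 0)) /= big1 ?add0r; last first.
  by move=> g /eqP ->; rewrite mul0r mulr0 normr0.
rewrite -big_filter.
apply: (@le_trans _ _ (\sum_(g <- [seq g <- s | c g != 0]) C * B * w2 R g)).
  apply: ler_sum => g _; rewrite mulrCA normrM normrM.
  apply: le_trans (ler_wpM2l (normr_ge0 _) (Psi_w2 a b g x)) _; rewrite -/C.
  rewrite [leLHS](_ : _ = C * (`|c g| * Qm (m6 (madd a b)) g) * w2 R g); last by ring.
  by apply: ler_wpM2r; [exact: w2_ge0|apply: ler_wpM2l].
rewrite -mulr_sumr; apply: ler_wpM2l; first by rewrite mulr_ge0.
apply: Htau; first exact: filter_uniq.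
by move=> g; rewrite mem_filter => /andP[].
Qed.

Lemma sch_TR c : rapid c -> sch (TR c).
Proof.
move=> rc; apply/schP; split; first by apply: smooth_Ssum; exact: rapid_termdom.
move=> a b; have [K HK] := rc (m6 (madd a b)).
have K0 : 0 <= K by apply: le_trans (HK (Defs.mzero d)); rewrite mulr_ge0 // Qm_ge0.
exists (2 ^+ mlen (m6 (madd a b)) * K * 2 ^+ d); apply: TR_bound => //.
by move=> s us _; exact: sum_w2_le.
Qed.

Lemma rapidD c c' : rapid c -> rapid c' -> rapid (fun g => c g + c' g).
Proof.
move=> rc rc' m; have [K HK] := rc m; have [L HL] := rc' m; exists (K + L) => g.
apply: le_trans (lerD (HK g) (HL g)); rewrite -mulrDl; apply: ler_wpM2r; first exact: Qm_ge0.
exact: ler_normD.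
Qed.

Lemma rapidZ (k : R) c : rapid c -> rapid (fun g => k * c g).
Proof.
move=> rc m; have [K HK] := rc m; exists (`|k| * K) => g.
by rewrite normrM -mulrA; apply: ler_wpM2l.
Qed.

Lemma TRD c c' : rapid c -> rapid c' -> TR (fun g => c g + c' g) = (fun x => TR c x + TR c' x).
Proof.
move=> rc rc'; apply/funext => x; rewrite /TR /Ssum -MsumD.
- by congr Msum; apply/funext => g; rewrite mulrDl.
- exact: (termdom_dom0 x (rapid_termdom rc)).
- exact: (termdom_dom0 x (rapid_termdom rc')).
Qed.

Lemma TRZ (k : R) c : rapid c -> TR (fun g => k * c g) = (fun x => k * TR c x).
Proof.
move=> rc; apply/funext => x; rewrite /TR /Ssum -MsumZ.
- by congr Msum; apply/funext => g; rewrite mulrA.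
- exact: (termdom_dom0 x (rapid_termdom rc)).
Qed.

Lemma TR_finite c F : uniq F -> (forall g, g \notin F -> c g = 0) ->
  TR c = (fun x => \sum_(g <- F) c g * Hd g x).
Proof.
move=> uF c0; apply/funext => x; apply: Msum_finite => // g gF.
by rewrite c0 // mul0r.
Qed.

Lemma rapid_finite c (F : seq (mindex d)) : (forall g, g \notin F -> c g = 0) -> rapid c.
Proof.
move=> c0 m; exists (\sum_(g <- F) `|c g| * Qm m g) => g.
have T0 h : 0 <= `|c h| * Qm m h by rewrite mulr_ge0 // Qm_ge0.
have [gF|gF] := boolP (g \in F); last by rewrite c0 // normr0 mul0r sumr_ge0.
by rewrite (big_rem g) //= lerDl sumr_ge0.
Qed.

End TermSeries.

(** * Weighted estimates *)

Section Estimates.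
Variables (R : realType) (d : nat).
Implicit Types (f g : 'rV[R]_d -> R) (a b s k m : mindex d) (x : 'rV[R]_d) (js : seq 'I_d).

Lemma mlen_madd a b : mlen (madd a b) = (mlen a + mlen b)%N.
Proof. by rewrite /mlen -big_split; apply: eq_bigr => j _; rewrite ffunE. Qed.

Lemma maddC a b : madd a b = madd b a.
Proof. by apply/ffunP => j; rewrite !ffunE addnC. Qed.

Lemma maddA a b s : madd a (madd b s) = madd (madd a b) s.
Proof. by apply/ffunP => j; rewrite !ffunE addnA. Qed.

Lemma madd0m a : madd (Defs.mzero d) a = a.
Proof. by apply/ffunP => j; rewrite !ffunE. Qed.

Lemma mlen_mzero : mlen (Defs.mzero d) = 0%N.
Proof. by rewrite /mlen big1 // => j _; rewrite ffunE. Qed.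

Lemma mcnt_cons j js : mcnt (j :: js) = madd (mcnt js) (munit j).
Proof. by apply/ffunP => i; rewrite !ffunE /= addnC eq_sym. Qed.

Definition Aps js f := foldr (@Ap R d) f js.

Lemma sch_Aps js f : sch f -> sch (Aps js f).
Proof. by move=> sf; elim: js => //= j js; exact: sch_Ap. Qed.

Lemma pders_Ap b j f : smooth f -> pders b (Ap j f) = (fun x =>
  x ord0 j * pders b f x + (b j)%:R * pders [ffun i => (b i - (i == j))%N] f x
  - pders (madd b (munit j)) f x).
Proof.
move=> sf; rewrite /Ap pdersE dlD; last 2 first.
- by apply: smooth_mul => //; exact: smooth_coord.
- by apply: smooth_scale; exact: smooth_pder.
rewrite dlZ; last exact: smooth_pder.
rewrite -!pdersE smooth_pders_coord // pders_munit //.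
by apply/funext => x; rewrite mulN1r.
Qed.

Definition mpown s k : R := \prod_(j < d) (s j)%:R ^+ k j.
Definition msub2 s k : mindex d := [ffun j => (s j - (k j).*2)%N].

(* Every commutation of x_j with the derivative d_j lowers the total order by two and
   costs a factor at most s_j; k_j counts how often this happened in direction j. *)
Definition commbound (w : mindex d -> R) s U :=
  forall k, (forall j, (k j).*2 <= s j)%N -> mpown s k * w (msub2 s k) <= U.

Lemma mpown_ge0 s k : 0 <= mpown s k.
Proof. by apply: prodr_ge0 => j _; rewrite exprn_ge0. Qed.

(** Moving d^b past one operator x_j - d_j gives three terms: multiplication by x_j, one more
    derivative, and a commutator term with coefficient b_j. Hence the powers of 3. *)
Lemma Aps_bound (w : mindex d -> R) f : sch f -> (forall s, 0 <= w s) ->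
  (forall a b x, `|monom x a| * `|pders b f x| <= w (madd a b)) ->
  forall js a b U, commbound w (madd (madd a b) (mcnt js)) U ->
  forall x, `|monom x a| * `|pders b (Aps js f) x| <= 3 ^+ size js * U.
Proof.
move=> sf w0 Hf; elim=> [|j js IH] a b U HU x.
  rewrite expr0 mul1r; apply: le_trans (Hf a b x) _.
  have := HU (Defs.mzero d); rewrite /mpown big1 ?mul1r; last by move=> i _; rewrite [Defs.mzero d i]ffunE expr0.
  move=> H; apply: le_trans (H _); last by move=> i; rewrite ffunE.
  rewrite le_eqVlt; apply/orP; left; apply/eqP; congr w; apply/ffunP => i.
  by rewrite !ffunE /= addn0 subn0.
have U0 : 0 <= U.
  apply: le_trans (HU (Defs.mzero d) _); last by move=> i; rewrite ffunE.
  by rewrite mulr_ge0 // mpown_ge0.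
have sg := sch_Aps js sf; set g := Aps js f in IH sg.
rewrite [Aps (j :: js) f]/= -/(Aps js f) -/g pders_Ap; last exact: sch_smooth.
set b' := [ffun i => _].
have T1 : `|monom x a * x ord0 j| * `|pders b g x| <= 3 ^+ size js * U.
  rewrite -monom_munit -monom_madd; apply: IH.
  have -> // : madd (madd (madd a (munit j)) b) (mcnt js) = madd (madd a b) (mcnt (j :: js)).
  by rewrite mcnt_cons; apply/ffunP => i; rewrite !ffunE; lia.
have T3 : `|monom x a| * `|pders (madd b (munit j)) g x| <= 3 ^+ size js * U.
  apply: IH.
  have -> // : madd (madd a (madd b (munit j))) (mcnt js) = madd (madd a b) (mcnt (j :: js)).
  by rewrite mcnt_cons; apply/ffunP => i; rewrite !ffunE; lia.
have T2 : `|monom x a| * ((b j)%:R * `|pders b' g x|) <= 3 ^+ size js * U.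
  have [->|bj] := posnP (b j).
    by rewrite mul0r mulr0 mulr_ge0 // exprn_ge0.
  have bj0 : 0 < (b j)%:R :> R by rewrite ltr0n.
  rewrite mulrCA -ler_pdivlMl // [leRHS]mulrC -mulrA; apply: IH => k Hk.
  rewrite ler_pdivlMr //.
  (* The commutator consumed one derivative of b and one operator of the list, so [s'] is [s]
     lowered by two in direction j. The coefficient b_j <= s_j accounts for raising k_j by one. *)
  set s' := madd _ _; pose s := madd (madd a b) (mcnt (j :: js)).
  have Es i : s i = (s' i + (i == j).*2)%N.
    rewrite /s mcnt_cons /s' /b' !ffunE; case: eqVneq => [->|ij] /=; last lia.
    by rewrite -[in LHS](prednK bj) subn1; lia.
  have Hk' i : ((madd k (munit j) i).*2 <= s i)%N.
    by rewrite ffunE ffunE Es doubleD leq_add2r; exact: Hk.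
  apply: le_trans (HU _ Hk').
  have -> : msub2 (madd (madd a b) (mcnt (j :: js))) (madd k (munit j)) = msub2 s' k.
    by apply/ffunP => i; rewrite [LHS]ffunE -/s Es [RHS]ffunE [madd k _ i]ffunE [munit j i]ffunE doubleD subnDr.
  rewrite mulrAC; apply: ler_wpM2r => //; rewrite -/s.
  have -> : mpown s (madd k (munit j)) = mpown s k * (s j)%:R.
    rewrite /mpown (bigD1 j) //= [in RHS](bigD1 j) //= !ffunE eqxx addn1 exprSr mulrAC.
    congr (_ * _ * _); apply: eq_bigr => i /negPf ij.
    by rewrite !ffunE ij addn0.
  apply: ler_pM => //; first exact: mpown_ge0.
    apply: ler_prod => i _; rewrite exprn_ge0 //=; apply: lerXn2r; rewrite ?nnegrE //.
    by rewrite ler_nat Es leq_addr.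
  by rewrite ler_nat /s !ffunE -addnA addnCA leq_addr.
rewrite exprS; apply: (@le_trans _ _ (3 ^+ size js * U + 3 ^+ size js * U + 3 ^+ size js * U)).
  apply: le_trans (lerD (lerD T1 T2) T3).
  rewrite normrM -[_ * `|x ord0 j| * _]mulrA -!mulrDr; apply: ler_wpM2l => //.
  apply: le_trans (ler_normB _ _) _; apply: lerD => //.
  apply: le_trans (ler_normD _ _) _.
  by rewrite !normrM normr_nat.
by rewrite le_eqVlt; apply/orP; left; apply/eqP; ring.
Qed.

(** The two conditions with all quantified data fixed. In this form they serve the Roumieu and the
    Beurling case alike. *)
Definition cond1 (N N' : mindex d -> R) (h H B : R) := forall a b,
  mpow_half R a * N b <= B * h ^+ mlen a * H ^+ mlen (madd a b) * N' (madd a b).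
Definition cond2 (N' N'' : mindex d -> R) (D A : R) := forall a b,
  (forall j, a j <= 6)%N -> N' (madd a b) <= D * A ^+ mlen b * N'' b.

Lemma fact_le_pow n p : (n <= p)%N -> (n`! <= p ^ n)%N.
Proof.
elim: n => // n IH np; rewrite factS expnS leq_mul //; exact: IH (ltnW np).
Qed.

Lemma mpow_half_ge0 a : 0 <= mpow_half R a.
Proof. by apply: prodr_ge0 => j _; rewrite exprn_ge0 // sqrtr_ge0. Qed.

(** The commutator cost satisfies s_j^(k_j) <= e^(s_j) k_j! <= e^(s_j) (2 k_j)^(k_j), and the last
    power is the factor a_j^(a_j/2) of [cond1] for a = 2k, exactly the number of orders lost. *)
Lemma cond1_commbound (N N' : mindex d -> R) h H B K s : cond1 N N' h H B -> 0 <= h -> 0 <= K ->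
  (forall a, 0 <= N a) ->
  commbound (fun s => K * h ^+ mlen s * N s) s (K * B * (expR 1 * H * h) ^+ mlen s * N' s).
Proof.
move=> C1 h0 K0 N0 k Hk.
pose a : mindex d := [ffun j => (k j).*2].
have sE : madd a (msub2 s k) = s by apply/ffunP => j; rewrite !ffunE subnKC.
have Hp : mpown s k <= expR 1 ^+ mlen s * mpow_half R a.
  rewrite /mpown /mlen expr_sum /mpow_half -big_split /=; apply: ler_prod => j _.
  rewrite exprn_ge0 //= ffunE.
  have -> : Num.sqrt (k j).*2%:R ^+ (k j).*2 = (k j).*2%:R ^+ k j :> R.
    by rewrite -mul2n exprM sqr_sqrtr.
  apply: le_trans (pow_fact_le_expR _ _) _ => //.
  rewrite mulrC -expRM_natl mulr1; apply: ler_wpM2l; first exact: expR_ge0.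
  by rewrite -natrX ler_nat; apply: fact_le_pow; rewrite -addnn leq_addr.
have C := C1 a (msub2 s k); rewrite sE in C.
have hl : h ^+ mlen s = h ^+ mlen a * h ^+ mlen (msub2 s k) by rewrite -exprD -mlen_madd sE.
apply: (@le_trans _ _ (expR 1 ^+ mlen s * mpow_half R a * (K * h ^+ mlen (msub2 s k) * N (msub2 s k)))).
  by apply: ler_wpM2r => //; rewrite !mulr_ge0 // exprn_ge0.
rewrite [leLHS](_ : _ = expR 1 ^+ mlen s * K * h ^+ mlen (msub2 s k) * (mpow_half R a * N (msub2 s k))).
  apply: le_trans (ler_wpM2l _ C) _; first by rewrite !mulr_ge0 ?exprn_ge0 ?expR_ge0.
  rewrite !exprMn hl le_eqVlt; apply/orP; left; apply/eqP; ring.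
by ring.
Qed.

(** The power gm^(b/2), in terms of which the sequence norms are rewritten in [lnorm_leP]. *)
Definition sqpow (gm b : mindex d) : R := \prod_(j < d) Num.sqrt (gm j)%:R ^+ b j.

Lemma sqpow_ge0 gm b : 0 <= sqpow gm b.
Proof. by apply: prodr_ge0 => j _; rewrite exprn_ge0 // sqrtr_ge0. Qed.

Lemma sqpow_mzero gm : sqpow gm (Defs.mzero d) = 1.
Proof. by rewrite /sqpow big1 // => j _; rewrite ffunE expr0. Qed.

Lemma sqpow_munit gm b j : sqpow gm (madd b (munit j)) = Num.sqrt (gm j)%:R * sqpow gm b.
Proof.
rewrite /sqpow (bigD1 j) //= [in RHS](bigD1 j) //= !ffunE eqxx addn1 exprS mulrA.
by congr (_ * _ * _); apply: eq_bigr => i /negPf ij; rewrite !ffunE ij addn0.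
Qed.

(** Each operator multiplies the coefficient by sqrt (2 (n + 1)), where n >= gm_j is the current
    index in its direction; only the lower bound sqrt gm_j is kept. *)
Lemma xi_Aps (gm : mindex d) js f : sch f ->
  sqpow gm (mcnt js) * `|xi gm f| <= `|xi (madd gm (mcnt js)) (Aps js f)|.
Proof.
move=> sf; elim: js => [|j js IH].
  rewrite /sqpow big1 ?mul1r; last by move=> i _; rewrite ffunE expr0.
  by have -> // : madd gm (mcnt [::]) = gm by apply/ffunP => i; rewrite !ffunE addn0.
rewrite mcnt_cons sqpow_munit maddA [Aps _ f]/= -/(Aps js f) xi_Ap; last exact: sch_Aps.
rewrite normrM -mulrA; apply: ler_pM => //; first by rewrite mulr_ge0 // sqpow_ge0.
set n := madd _ _ _; have ng : (gm j <= n)%N by rewrite /n ffunE leq_addr.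
rewrite ger0_norm ?mulr_ge0 ?ld_ge0 //.
rewrite -(@ler_pXn2r _ 2) ?nnegrE ?sqrtr_ge0 ?mulr_ge0 ?ld_ge0 //.
rewrite sqr_sqrtr // exprMn ld_sqr.
have : (gm j)%:R <= n%:R :> R by rewrite ler_nat.
rewrite -[n.+1%:R]natr1; have : 0 <= n%:R :> R by [].
by move: (n%:R : R) ((gm j)%:R : R) => p q ? ?; lra.
Qed.

Lemma size_mlist b : size (mlist b) = mlen b.
Proof. by rewrite size_flatten /shape -map_comp sumnE big_map big_enum; apply: eq_bigr => j _; rewrite /= size_nseq. Qed.

Lemma xi_weighted (N N' N'' : mindex d -> R) (h H B D A : R) :
  0 <= h -> 0 <= H -> 0 <= B -> 0 <= D -> 0 <= A -> (forall a, 0 <= N a) -> (forall a, 0 <= N' a) ->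
  (forall a, 0 <= N'' a) ->
  cond1 N N' h H B -> cond2 N' N'' D A ->
  exists2 C, 0 <= C & forall K f, 0 <= K -> sch f ->
    (forall a b x, `|monom x a| * `|pders b f x| <= K * h ^+ mlen (madd a b) * N (madd a b)) ->
    forall gm b, `|xi gm f| * sqpow gm b <= C * K * (3 * (expR 1 * H * h) * A) ^+ mlen b * N'' b.
Proof.
move=> h0 H0 B0 D0 A0 N0 N0' N0'' C1 C2.
pose q := expR 1 * H * h; have q0 : 0 <= q by rewrite !mulr_ge0 ?expR_ge0.
(* Integrability costs the extra exponents [aJ J], of total order at most 2d. [E] bounds the
   matching power of q whether q is small or large, and [cond2] removes the extra orders from the
   weight. *)
pose E := (1 + q) ^+ (d * 2)%N.
have E0 : 0 <= E by rewrite exprn_ge0 // addr_ge0.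
have cqw : 0 <= I1 (@qw R) ^+ d + 1.
  by rewrite addr_ge0 // exprn_ge0 // Rintegral_ge0 // => t _; exact: qw_ge0.
exists (#|{set 'I_d}|%:R * (B * E * D) * (I1 (@qw R) ^+ d + 1)); first by rewrite !mulr_ge0.
move=> K f K0 sf Hf gm b.
pose js := mlist b; have cj : mcnt js = b by exact: mcnt_mlist.
pose T := 3 ^+ mlen b * (K * B * (E * q ^+ mlen b) * (D * A ^+ mlen b * N'' b)).
have T0 : 0 <= T by rewrite !mulr_ge0 // exprn_ge0.
have HT J x : `|monom x (aJ J)| * `|Aps js f x| <= T.
  have W0 s : 0 <= K * h ^+ mlen s * N s by rewrite !mulr_ge0 // exprn_ge0.
  have := @Aps_bound (fun s => K * h ^+ mlen s * N s) f sf W0 Hf js (aJ J) (Defs.mzero d).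
  pose s := madd (madd (aJ J) (Defs.mzero d)) (mcnt js).
  have Es : s = madd (aJ J) b by rewrite /s cj; apply/ffunP => i; rewrite !ffunE addn0.
  move=> /(_ _ (@cond1_commbound _ _ _ _ _ _ s C1 h0 K0 N0) x).
  rewrite pders_mzero => /le_trans; apply; rewrite size_mlist -/q Es /T; apply: ler_wpM2l; first exact: exprn_ge0.
  apply: ler_pM; rewrite ?mulr_ge0 ?exprn_ge0 //.
    apply: ler_wpM2l; first by rewrite mulr_ge0.
    rewrite mlen_madd exprD; apply: ler_wpM2r; first exact: exprn_ge0.
    apply: (@le_trans _ _ ((1 + q) ^+ mlen (aJ J))).
      by apply: lerXn2r; rewrite ?nnegrE ?addr_ge0 // lerDr.
    apply: ler_weXn2l; first by rewrite lerDl.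
    rewrite /mlen -[X in (_ <= X * 2)%N](card_ord d) -sum_nat_const leq_sum // => i _.
    by rewrite ffunE; case: (i \in J).
  by apply: C2 => i; rewrite ffunE; case: (i \in J).
have := xi_Aps gm js sf; rewrite cj mulrC => /le_trans; apply.
have sA := sch_Aps js sf.
apply: le_trans (xi_bound _ sA _ (wt_of_monom HT)) _; first by rewrite mulr_ge0.
rewrite -/q /T !exprMn le_eqVlt; apply/orP; left; apply/eqP; ring.
Qed.

Definition mJ (P : pred 'I_d) m : mindex d := [ffun j => if P j then m j else 0%N].

(* Split the directions according to whether [m j <= gm j]: the large ones are
   controlled by the decay of [c], the others by [cond1]. *)
Lemma Qm_weighted (N N' : mindex d -> R) (h H B K : R) (c : mindex d -> R) :
  0 <= h -> 0 <= K ->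
  cond1 N N' h H B ->
  (forall gm b, `|c gm| * sqpow gm b <= K * h ^+ mlen b * N b) ->
  forall m gm, `|c gm| * Qm R m gm <= K * B * (2 * H * h) ^+ mlen m * N' m.
Proof.
move=> h0 K0 C1 Hc m gm.
pose P : pred 'I_d := fun j => (m j <= gm j)%N.
pose m1 := mJ P m; pose m2 := mJ (predC P) m.
have mE : madd m2 m1 = m.
  by apply/ffunP => j; rewrite !ffunE /=; case: (P j) => /=; lia.
have HQ : Qm R m gm <= 2 ^+ mlen m * (mpow_half R m2 * sqpow gm m1).
  rewrite /Qm /mlen expr_sum /mpow_half /sqpow -!big_split /=; apply: ler_prod => j _.
  rewrite exprn_ge0 ?sqrtr_ge0 //= !ffunE /=.
  have main (p : nat) : (gm j <= p)%N -> (m j <= p)%N ->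
      Num.sqrt (gm j + m j)%:R ^+ m j <= 2 ^+ m j * Num.sqrt p%:R ^+ m j :> R.
    move=> h1 h2; rewrite -exprMn; apply: lerXn2r; rewrite ?nnegrE ?mulr_ge0 ?sqrtr_ge0 //.
    have -> : 2 * Num.sqrt p%:R = Num.sqrt (4 * p)%:R :> R.
      rewrite natrM sqrtrM // -[4%:R]/((2 * 2)%N%:R) natrM -expr2 sqrtr_sqr ger0_norm //.
    by apply: ler_wsqrtr; rewrite ler_nat; lia.
  have [Pj|Pj] := boolP (P j) => /=.
    by rewrite expr0 mul1r; apply: main.
  by rewrite expr0 mulr1; apply: main => //; rewrite /P -ltnNge in Pj; exact: ltnW.
apply: le_trans (ler_wpM2l (normr_ge0 _) HQ) _.
rewrite [leLHS](_ : _ = 2 ^+ mlen m * mpow_half R m2 * (`|c gm| * sqpow gm m1)); last by ring.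
apply: le_trans (ler_wpM2l _ (Hc gm m1)) _.
  by rewrite mulr_ge0 ?exprn_ge0 // mpow_half_ge0.
rewrite [leLHS](_ : _ = 2 ^+ mlen m * K * h ^+ mlen m1 * (mpow_half R m2 * N m1)); last by ring.
apply: le_trans (ler_wpM2l _ (C1 m2 m1)) _; first by rewrite !mulr_ge0 ?exprn_ge0.
rewrite mE !exprMn (_ : h ^+ mlen m = h ^+ mlen m2 * h ^+ mlen m1); last first.
  by rewrite -exprD -mlen_madd mE.
by rewrite le_eqVlt; apply/orP; left; apply/eqP; ring.
Qed.

Lemma Qm_weighted6 (N N' N'' : mindex d -> R) (h H B D A : R) :
  0 <= h -> 0 <= H -> 0 <= B -> 0 <= D -> 0 <= A ->
  cond1 N N' h H B -> cond2 N' N'' D A ->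
  exists2 C, 0 <= C & forall K (c : mindex d -> R), 0 <= K ->
  (forall gm b, `|c gm| * sqpow gm b <= K * h ^+ mlen b * N b) ->
  forall m gm, 2 ^+ mlen (m6 m) * (`|c gm| * Qm R (m6 m) gm) <= C * K * (2 * (2 * H * h) * A) ^+ mlen m * N'' m.
Proof.
move=> h0 H0 B0 D0 A0 C1 C2.
pose q := 2 * (2 * H * h); have q0 : 0 <= q by rewrite !mulr_ge0.
exists (B * q ^+ (d * 6)%N * D); first by rewrite !mulr_ge0 // exprn_ge0.
move=> K c K0 Hc m gm.
have W := Qm_weighted h0 K0 C1 Hc (m6 m) gm.
apply: le_trans (ler_wpM2l (exprn_ge0 _ _) W) _ => //.
have E6 : m6 m = madd [ffun=> 6%N] m by apply/ffunP => j; rewrite !ffunE addnC.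
have l6 : mlen (m6 m) = (d * 6 + mlen m)%N.
  rewrite E6 mlen_madd; congr addn; rewrite /mlen (eq_bigr (fun=> 6%N)).
    by rewrite sum_nat_const card_ord.
  by move=> j _; rewrite ffunE.
have W2 : N' (m6 m) <= D * A ^+ mlen m * N'' m by rewrite E6; apply: C2 => j; rewrite ffunE.
rewrite [leLHS](_ : _ = K * B * q ^+ mlen (m6 m) * N' (m6 m)); last by rewrite /q [(2 * (2 * H * h)) ^+ _]exprMn; ring.
apply: le_trans (ler_wpM2l _ W2) _; first by rewrite !mulr_ge0 // exprn_ge0.
by rewrite -/q l6 exprD [(q * A) ^+ _]exprMn le_eqVlt; apply/orP; left; apply/eqP; ring.
Qed.

Lemma TR_weighted (N N' N'' : mindex d -> R) (h H B D A : R) :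
  0 <= h -> 0 <= H -> 0 <= B -> 0 <= D -> 0 <= A -> (forall a, 0 <= N'' a) ->
  cond1 N N' h H B -> cond2 N' N'' D A ->
  exists2 C, 0 <= C & forall K (c : mindex d -> R), 0 <= K ->
  (forall gm b, `|c gm| * sqpow gm b <= K * h ^+ mlen b * N b) ->
  rapid c /\
  forall tau, (forall s : seq (mindex d), uniq s -> (forall gm, gm \in s -> c gm != 0) -> \sum_(gm <- s) w2 R gm <= tau) ->
  forall a b x, `|monom x a| * `|pders b (TR c) x| <=
     C * K * tau * (2 * (2 * H * h) * A) ^+ mlen (madd a b) * N'' (madd a b).
Proof.
move=> h0 H0 B0 D0 A0 N0 C1 C2.
have [C C0 HC] := Qm_weighted6 h0 H0 B0 D0 A0 C1 C2.
exists C => // K c K0 Hc.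
have W := Qm_weighted h0 K0 C1 Hc.
have rc : rapid c by move=> m; exists (K * B * (2 * H * h) ^+ mlen m * N' m) => gm; exact: W.
split=> // tau Ht a b x; have {}HC := HC K c K0 Hc.
set m := madd a b; set V := (_ * A) ^+ _.
have V0 : 0 <= V by rewrite exprn_ge0 // !mulr_ge0.
have p2 : 0 < 2 ^+ mlen (m6 m) :> R by rewrite exprn_gt0.
have := @TR_bound R d c a b (C * K * V * N'' m / 2 ^+ mlen (m6 m)) tau rc.
have HB gm : `|c gm| * Qm R (m6 (madd a b)) gm <= C * K * V * N'' m / 2 ^+ mlen (m6 m).
  by rewrite ler_pdivlMr // mulrC; exact: HC.
have B00 : 0 <= C * K * V * N'' m / 2 ^+ mlen (m6 m).
  by rewrite divr_ge0 ?(ltW p2) // !mulr_ge0.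
move=> /(_ B00 HB Ht x) /le_trans; apply.
rewrite -/m [2 ^+ _ * _]mulrC divfK ?gt_eqF //.
by rewrite le_eqVlt; apply/orP; left; apply/eqP; ring.
Qed.

End Estimates.

(** * The coefficient map and the Hermite series are mutually inverse *)

Section RealInversion.
Variables (R : realType) (d : nat).
Implicit Types (f : 'rV[R]_d -> R) (c : mindex d -> R) (g : mindex d).

Lemma sch0 : sch (fun _ : 'rV[R]_d => 0 : R).
Proof.
apply/schP; split; first exact: smooth_cst.
move=> a b; exists 0 => x; rewrite pdersE.
suff -> : dl (mlist b) (fun _ : 'rV[R]_d => 0 : R) = (fun=> 0) by rewrite normr0 mulr0.
by elim: (mlist b) => // j s IH; rewrite dl_cons IH pder_cst.
Qed.

Lemma xi_sum (s : seq (mindex d)) (F : mindex d -> 'rV[R]_d -> R) g :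
  (forall h, sch (F h)) -> xi g (fun x => \sum_(h <- s) F h x) = \sum_(h <- s) xi g (F h).
Proof.
move=> sF; elim: s => [|h s IH].
  rewrite big_nil (_ : (fun x => _) = (fun x => 0 * (0 : R))); last first.
    by apply/funext => x; rewrite big_nil mul0r.
  by rewrite (xiZ _ _ sch0) mul0r.
rewrite big_cons -IH -xiD //; last by apply: sch_sum => //; exact: sch0.
by congr xi; apply/funext => x; rewrite big_cons.
Qed.

Definition mrestr (P : pred (mindex d)) c : mindex d -> R := fun g => if P g then c g else 0.

Lemma rapid_restr P c : rapid c -> rapid (mrestr P c).
Proof.
move=> rc m; have [K HK] := rc m; exists K => g; apply: le_trans (HK g).
apply: ler_wpM2r; first exact: Qm_ge0.
by rewrite /mrestr; case: (P g); rewrite ?normr0.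
Qed.

Lemma TR_split c (F : seq (mindex d)) : uniq F -> rapid c ->
  TR c = (fun x => \sum_(g <- F) c g * Hd g x + TR (mrestr (fun g => g \notin F) c) x).
Proof.
move=> uF rc.
have E : c = (fun g => mrestr (mem F) c g + mrestr (fun g => g \notin F) c g).
  by apply/funext => g; rewrite /mrestr /=; case: (g \in F); rewrite ?addr0 ?add0r.
rewrite {1}E TRD; [|exact: rapid_restr..].
rewrite (@TR_finite _ _ _ F) //; last by move=> g gF; rewrite /mrestr /= (negPf gF).
apply/funext => x; congr (_ + _); apply: eq_big_seq => g gF.
by rewrite /mrestr /= gF.
Qed.

(** Sum and integral are not interchanged directly. A finite part containing g has the right
    coefficient by orthonormality, and the tail is small in the weighted sup norm that controls
    [xi g]. *)
Lemma xi_TR c g : rapid c -> xi g (TR c) = c g.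
Proof.
move=> rc.
have HJ J : {K | forall h, `|c h| * Qm R (m6 (madd (aJ J) (Defs.mzero d))) h <= K}.
  by apply: cid; exact: rc.
pose B := \sum_(J : {set 'I_d}) (2 ^+ mlen (m6 (madd (aJ J) (Defs.mzero d))) * `|sval (HJ J)|).
have B0 : 0 <= B by apply: sumr_ge0 => J _; rewrite mulr_ge0 // exprn_ge0.
pose Cst := #|{set 'I_d}|%:R * B * (I1 (@qw R) ^+ d + 1).
have cqw : 0 <= I1 (@qw R) ^+ d + 1.
  by rewrite addr_ge0 // exprn_ge0 // Rintegral_ge0 // => t _; exact: qw_ge0.
have Cst0 : 0 <= Cst by rewrite !mulr_ge0.
have key e : 0 < e -> `|xi g (TR c) - c g| <= Cst * e.
  move=> e0; have [F0 HF0] := @w2_tail R d e e0.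
  pose F := undup (g :: F0); have uF : uniq F by exact: undup_uniq.
  have gF : g \in F by rewrite mem_undup mem_head.
  pose t := mrestr (fun g => g \notin F) c; have rt : rapid t by exact: rapid_restr.
  have sT h : sch (fun x => c h * Hd h x) by apply: sch_scale; exact: sch_Hd.
  have sTR := sch_TR rt.
  rewrite (TR_split uF rc) xiD //; last by apply: sch_sum => //; exact: sch0.
  rewrite xi_sum //.
  have -> : \sum_(h <- F) xi g (fun x => c h * Hd h x) = c g.
    rewrite (bigD1_seq g) //= big1_seq ?addr0.
      by rewrite xiZ ?/xi ?Hd_orthonormal ?eqxx ?mulr1 //; exact: sch_Hd.
    move=> h /andP[hg _]; rewrite xiZ; last exact: sch_Hd.
    by rewrite /xi Hd_orthonormal (negPf hg) mulr0.
  rewrite addrC addKr -/t.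
  have tl (s : seq (mindex d)) : uniq s -> (forall h, h \in s -> t h != 0) -> \sum_(h <- s) w2 R h <= e.
    move=> us Hs; apply: HF0 => // h /Hs; rewrite /t /mrestr.
    case: ifP => [hF _|_]; last by rewrite eqxx.
    by apply: contra hF => hF0; rewrite mem_undup inE hF0 orbT.
  have HT J x : `|monom x (aJ J)| * `|TR t x| <= B * e.
    have K0 : 0 <= `|sval (HJ J)| by [].
    have HK h : `|t h| * Qm R (m6 (madd (aJ J) (Defs.mzero d))) h <= `|sval (HJ J)|.
      apply: le_trans (ler_norm _); apply: le_trans (svalP (HJ J) h).
      apply: ler_wpM2r; first exact: Qm_ge0.
      by rewrite /t /mrestr; case: ifP => _; rewrite ?normr0.
    have := TR_bound rt K0 HK tl x.
    rewrite pders_mzero => /le_trans; apply; apply: ler_wpM2r; first exact: ltW.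
    rewrite /B (bigD1 J) //= lerDl; apply: sumr_ge0 => J' _.
    by rewrite mulr_ge0 // exprn_ge0.
  apply: le_trans (xi_bound g sTR _ (wt_of_monom HT)) _.
    by rewrite !mulr_ge0 // ltW.
  by rewrite /Cst le_eqVlt; apply/orP; left; apply/eqP; ring.
apply/eqP; rewrite -subr_eq0 -normr_le0; apply/ler_addgt0Pr => e e0; rewrite add0r.
have D0 : 0 < Cst + 1 by rewrite ltr_wpDl.
apply: le_trans (key (e / (Cst + 1)) _) _; first by rewrite divr_gt0.
by rewrite mulrCA; apply: ler_piMr; [exact: ltW|rewrite ler_pdivrMr // mul1r lerDl].
Qed.

Lemma TR_xi f : sch f -> rapid (fun g => xi g f) -> TR (fun g => xi g f) = f.
Proof.
move=> sf rf; have sT := sch_TR rf.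
have su : sch (fun x => TR (fun g => xi g f) x + -1 * f x).
  by apply: sch_add => //; exact: sch_scale.
apply/funext => x; have := hermite_complete (sch_lipgood su).
have H g : xi g (fun x => TR (fun g => xi g f) x + -1 * f x) = 0.
  by rewrite xiD ?xiZ ?xi_TR ?mulN1r ?subrr //; exact: sch_scale.
by move=> /(_ H x) /eqP; rewrite mulN1r subr_eq0 => /eqP.
Qed.

End RealInversion.

(** * Complex-valued functions and the sequence norms *)

Section Complexes.
Variables (R : realType).
Local Notation C := (complex R).
Implicit Types (z w : C).

Lemma cmodE z : cmod z = Normc.normc z.
Proof. by case: z. Qed.

Lemma cmod_ge0 z : 0 <= cmod z. Proof. exact: sqrtr_ge0. Qed.
Lemma cmodM z w : cmod (z * w) = cmod z * cmod w.
Proof. by rewrite !cmodE Normc.normcM. Qed.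
Lemma cmodD z w : cmod (z + w) <= cmod z + cmod w.
Proof. by rewrite !cmodE le_normcD. Qed.
Lemma cmod_eq0 z : cmod z = 0 -> z = 0.
Proof. by rewrite cmodE => /Normc.eq0_normc. Qed.
Lemma cmod0 : cmod (0 : C) = 0.
Proof. by rewrite cmodE Normc.normc0. Qed.

Lemma Re_le_cmod z : `|complex.Re z| <= cmod z.
Proof. by rewrite /cmod -sqrtr_sqr; apply: ler_wsqrtr; rewrite lerDl sqr_ge0. Qed.
Lemma Im_le_cmod z : `|complex.Im z| <= cmod z.
Proof. by rewrite /cmod -sqrtr_sqr; apply: ler_wsqrtr; rewrite lerDr sqr_ge0. Qed.
Lemma cmod_le z : cmod z <= `|complex.Re z| + `|complex.Im z|.
Proof.
rewrite -(@ler_pXn2r _ 2) ?nnegrE ?cmod_ge0 ?addr_ge0 // sqr_sqrtr ?addr_ge0 ?sqr_ge0 //.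
rewrite sqrrD !real_normK ?num_real // addrAC lerDl mulrn_wge0 // mulr_ge0 //.
Qed.

Lemma ReD z w : complex.Re (z + w) = complex.Re z + complex.Re w.
Proof. by case: z; case: w. Qed.
Lemma ImD z w : complex.Im (z + w) = complex.Im z + complex.Im w.
Proof. by case: z; case: w. Qed.
Lemma ReM z w : complex.Re (z * w) = complex.Re z * complex.Re w - complex.Im z * complex.Im w.
Proof. by case: z; case: w. Qed.
Lemma ImM z w : complex.Im (z * w) = complex.Re z * complex.Im w + complex.Im z * complex.Re w.
Proof. by case: z; case: w. Qed.
Lemma complex_ext z w : complex.Re z = complex.Re w -> complex.Im z = complex.Im w -> z = w.
Proof. by case: z => a b; case: w => c e /= -> ->. Qed.

Variable d : nat.
Implicit Types (f : 'rV[R]_d -> C) (c : mindex d -> C).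

Definition schC f := sch (reF f) /\ sch (imF f).
Definition reS c : mindex d -> R := fun g => complex.Re (c g).
Definition imS c : mindex d -> R := fun g => complex.Im (c g).
Definition rapidC c := rapid (reS c) /\ rapid (imS c).
Definition TinvC c : 'rV[R]_d -> C := fun x => Complex (TR (reS c) x) (TR (imS c) x).

Lemma hcoefE f g : hcoef g f = Complex (xi g (reF f)) (xi g (imF f)).
Proof.
rewrite /hcoef /xi; congr Complex; congr iint; apply/funext => x; by rewrite hermite_Hd.
Qed.

Lemma reF_TinvC c : reF (TinvC c) = TR (reS c). Proof. by []. Qed.
Lemma imF_TinvC c : imF (TinvC c) = TR (imS c). Proof. by []. Qed.

Lemma schC_TinvC c : rapidC c -> schC (TinvC c).
Proof. by move=> [r i]; split; exact: sch_TR. Qed.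

Lemma hermiteT_TinvC c : rapidC c -> hermiteT (TinvC c) = c.
Proof.
move=> [r i]; apply/funext => g; rewrite /hermiteT hcoefE reF_TinvC imF_TinvC !xi_TR //.
by rewrite /reS /imS; case: (c g).
Qed.

Lemma TinvC_hermiteT f : schC f -> rapidC (hermiteT f) -> TinvC (hermiteT f) = f.
Proof.
move=> [sr si] [r i].
have Er : reS (hermiteT f) = (fun g => xi g (reF f)).
  by apply/funext => g; rewrite /reS /hermiteT hcoefE.
have Ei : imS (hermiteT f) = (fun g => xi g (imF f)).
  by apply/funext => g; rewrite /imS /hermiteT hcoefE.
apply/funext => x; rewrite /TinvC Er Ei TR_xi -?Er // TR_xi -?Ei //.
by rewrite /reF /imF; case: (f x).
Qed.

Lemma hermiteT_linear (k : C) f1 f2 : schC f1 -> schC f2 ->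
  hermiteT (k *: f1 + f2) = k *: hermiteT f1 + hermiteT f2.
Proof.
move=> [r1 i1] [r2 i2]; apply/funext => g.
rewrite [RHS]/((k * hermiteT f1 g) + hermiteT f2 g) /hermiteT !hcoefE.
have ER : reF (k *: f1 + f2) = (fun x => (complex.Re k * reF f1 x + (- complex.Im k) * imF f1 x) + reF f2 x).
  by apply/funext => x; rewrite /reF -[(k *: f1 + f2) x]/(k * f1 x + f2 x) ReD ReM mulNr.
have EI : imF (k *: f1 + f2) = (fun x => (complex.Re k * imF f1 x + complex.Im k * reF f1 x) + imF f2 x).
  by apply/funext => x; rewrite /imF -[(k *: f1 + f2) x]/(k * f1 x + f2 x) ImD ImM.
have sR : sch (fun x => complex.Re k * reF f1 x + (- complex.Im k) * imF f1 x).
  by apply: sch_add; exact: sch_scale.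
have sI : sch (fun x => complex.Re k * imF f1 x + complex.Im k * reF f1 x).
  by apply: sch_add; exact: sch_scale.
apply: complex_ext; rewrite ?ReD ?ImD ?ReM ?ImM /=.
  by rewrite ER (xiD _ sR r2) (xiD _ (sch_scale _ r1) (sch_scale _ i1)) !xiZ // mulNr.
by rewrite EI (xiD _ sI i2) (xiD _ (sch_scale _ i1) (sch_scale _ r1)) !xiZ.
Qed.

Lemma TinvC_linear (k : C) c1 c2 : rapidC c1 -> rapidC c2 ->
  TinvC (k *: c1 + c2) = k *: TinvC c1 + TinvC c2.
Proof.
move=> [r1 i1] [r2 i2]; apply/funext => x.
rewrite [RHS]/((k * TinvC c1 x) + TinvC c2 x).
have ER : reS (k *: c1 + c2) = (fun g => (complex.Re k * reS c1 g + (- complex.Im k) * imS c1 g) + reS c2 g).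
  by apply/funext => g; rewrite /reS -[(k *: c1 + c2) g]/(k * c1 g + c2 g) ReD ReM mulNr.
have EI : imS (k *: c1 + c2) = (fun g => (complex.Re k * imS c1 g + complex.Im k * reS c1 g) + imS c2 g).
  by apply/funext => g; rewrite /imS -[(k *: c1 + c2) g]/(k * c1 g + c2 g) ImD ImM.
apply: complex_ext; rewrite ?ReD ?ImD ?ReM ?ImM /=.
  rewrite ER (TRD (rapidD (rapidZ _ r1) (rapidZ _ i1)) r2) (TRD (rapidZ _ r1) (rapidZ _ i1)) !TRZ //.
  by rewrite mulNr.
by rewrite EI (TRD (rapidD (rapidZ _ i1) (rapidZ _ r1)) i2) (TRD (rapidZ _ i1) (rapidZ _ r1)) !TRZ.
Qed.

(** Exponentiating the associated weight function undoes the logarithm: its exponential at sqrt(a)/h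
    is the supremum over b of a^(b/2) / (h^|b| N_b). *)
Lemma lnorm_leP (N : mindex d -> R) h K c : 0 < h -> (forall a, 0 < N a) ->
  lnorm_le N h K c <-> forall a b, cmod (c a) * sqpow R a b <= K * h ^+ mlen b * N b.
Proof.
move=> h0 N0.
have mE (a b : mindex d) : monom (sqrt_idx a h) b = sqpow R a b / h ^+ mlen b.
  rewrite /monom /sqpow /mlen expr_sum -prodf_div; apply: eq_bigr => j _.
  by rewrite mxE expr_div_n.
have mpos b : 0 < h ^+ mlen b * N b by rewrite mulr_gt0 // exprn_gt0.
have sp (a b : mindex d) : (forall j, sqrt_idx a h ord0 j = 0 -> b j = 0%N) -> 0 < sqpow R a b.
  move=> Hb; apply: prodr_gt0 => j _; have [aj|aj] := posnP (a j).
    by rewrite (Hb j) ?expr0 // mxE aj sqrtr0 mul0r.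
  by rewrite exprn_gt0 // sqrtr_gt0 ltr0n.
have yE (a b : mindex d) : `|monom (sqrt_idx a h) b| / N b = sqpow R a b / (h ^+ mlen b * N b).
  rewrite mE ger0_norm; first by rewrite invfM mulrA.
  by rewrite divr_ge0 ?sqpow_ge0 // exprn_ge0 // ltW.
split=> [H a b|H a].
  have K0 : 0 <= K.
    have := H a; rewrite -lee_fin; apply: le_trans; apply: mule_ge0; last exact: expeR_ge0.
    by rewrite lee_fin cmod_ge0.
  (* An index b left out of the supremum has b_j > 0 = a_j for some j, so a^(b/2) = 0 and the
     inequality is trivial. *)
  have [Hb|Hb] := pselect (forall j, sqrt_idx a h ord0 j = 0 -> b j = 0%N); last first.
    have -> : sqpow R a b = 0.
      have [j /not_implyP[tj bj]] : exists j, ~ (sqrt_idx a h ord0 j = 0 -> b j = 0%N).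
        by apply/existsNP.
      rewrite /sqpow (bigD1 j) //=; have : Num.sqrt (a j)%:R = 0 :> R.
        move: tj; rewrite mxE => /eqP; rewrite mulf_eq0 invr_eq0 (gt_eqF h0) orbF.
        by move=> /eqP.
      by move=> ->; rewrite expr0n; case: (b j) bj => // n _; rewrite mul0r.
    by rewrite mulr0 -mulrA; apply: mulr_ge0 => //; exact: ltW (mpos b).
  rewrite -mulrA -ler_pdivrMr // -mulrA -yE -lee_fin EFinM.
  apply: le_trans (H a); apply: lee_wpmul2l; first by rewrite lee_fin cmod_ge0.
  have y0 : 0 < `|monom (sqrt_idx a h) b| / N b by rewrite yE divr_gt0 // sp.
  rewrite -[X in (X%:E <= _)%E]lnK ?posrE // -[(expR _)%:E]/(expeR (ln _)%:E) lee_expeR.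
  by apply: ereal_sup_ubound; exists b.
have HK := H a (Defs.mzero d); rewrite sqpow_mzero mlen_mzero mulr1 expr0 mulr1 in HK.
(* The weight may be infinite; a vanishing coefficient is then covered by the convention that 0
   times infinity is 0. *)
have [c0|c0] := eqVneq (cmod (c a)) 0.
  rewrite c0 mul0e lee_fin.
  by rewrite -(pmulr_lge0 _ (N0 (Defs.mzero d))); apply: le_trans HK; exact: cmod_ge0.
have cp : 0 < cmod (c a) by rewrite lt_neqAle eq_sym c0 cmod_ge0.
have Kp : 0 < K by rewrite -(pmulr_lgt0 _ (N0 (Defs.mzero d))); apply: lt_le_trans HK.
have om : (omegaM N (sqrt_idx a h) <= (ln (K / cmod (c a)))%:E)%E.
  apply: ge_ereal_sup => _ [b Hb <-]; rewrite lee_fin.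
  have y0 : 0 < `|monom (sqrt_idx a h) b| / N b by rewrite yE divr_gt0 // sp.
  have k0 : 0 < K / cmod (c a) by rewrite divr_gt0.
  rewrite ler_ln ?posrE // yE ler_pdivlMr // mulrAC ler_pdivrMr // mulrC.
  by rewrite [leRHS]mulrA; exact: H.
have : (expeR (omegaM N (sqrt_idx a h)) <= (K / cmod (c a))%:E)%E.
  rewrite -[X in (_ <= X%:E)%E]lnK ?posrE ?divr_gt0 // -[(expR _)%:E]/(expeR (ln _)%:E).
  by rewrite lee_expeR.
move=> /(lee_wpmul2l _) -/(_ (cmod (c a))%:E) H2.
apply: le_trans (H2 _) _; first by rewrite lee_fin ltW.
by rewrite -EFinM lee_fin mulrC divfK.
Qed.

End Complexes.

(** * Bases and isomorphisms *)

Section AbstractBasis.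
Variables (R : realType) (d : nat).
Local Notation C := (complex R).
Local Notation V := ('rV[R]_d -> C).
Local Notation W := (mindex d -> C).
Variables (E : set V) (csE : (V -> R) -> Prop) (F : set W) (csF : (W -> R) -> Prop).

Implicit Types (f : V) (c : W) (g : mindex d) (k : C).

Definition restr_of (c' c : W) := forall g, c' g = c g \/ c' g = 0.
Definition supp_w2 (c : W) (tau : R) := forall s : seq (mindex d), uniq s ->
  (forall g, g \in s -> c g != 0) -> \sum_(g <- s) w2 R g <= tau.
Definition deltaC (g : mindex d) : W := fun h => (h == g)%:R.

Hypothesis E_sch : forall f, E f -> schC f.
Hypothesis F_rapid : forall c, F c -> rapidC c.
Hypothesis F_delta : forall g, F (deltaC g).
Hypothesis T_EF : forall f, E f -> F (hermiteT f).
Hypothesis Tinv_FE : forall c, F c -> E (TinvC c).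
Hypothesis csE_seminorm : forall p, csE p -> seminorm_on E p.
Hypothesis csF_seminorm : forall q, csF q -> seminorm_on F q.
(** Only the norm estimate is left to each case; the seminorm axioms of the composite follow once
    from linearity, in [top_iso_hermiteT]. *)
Hypothesis T_cont : forall q, seminorm_on E (q \o @hermiteT R d) -> csF q -> csE (q \o @hermiteT R d).
Hypothesis Tinv_cont : forall p, seminorm_on F (p \o @TinvC R d) -> csE p -> csF (p \o @TinvC R d).
(** The constant is uniform over all restrictions of c and linear in the mass of their support.
    Tails give convergence of the expansion, single indices give absoluteness. *)
Hypothesis restr_bound : forall c p, F c -> csE p -> exists2 D, 0 <= D &
  forall c' tau, restr_of c' c -> 0 <= tau -> supp_w2 c' tau -> E (TinvC c') /\ p (TinvC c') <= D * tau.
Hypothesis xi_cont : forall g, seminorm_on E (fun f => cmod (hcoef g f)) ->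
  csE (fun f => cmod (hcoef g f)).

Lemma hermiteT0 : hermiteT (0 : V) = 0.
Proof.
apply/funext => g; rewrite /hermiteT hcoefE.
have E0 : reF (0 : V) = (fun x => 0 * (0 : R)) by apply/funext => x; rewrite mul0r.
have E1 : imF (0 : V) = (fun x => 0 * (0 : R)) by apply/funext => x; rewrite mul0r.
by rewrite E0 E1 (xiZ _ _ (@sch0 R d)) mul0r.
Qed.

Lemma schC0 : schC (0 : V).
Proof. by split; exact: sch0. Qed.

Lemma hermiteTZ (k : C) f : schC f -> hermiteT (k *: f) = k *: hermiteT f.
Proof.
move=> sf; have := hermiteT_linear k sf schC0.
by rewrite hermiteT0 !addr0.
Qed.

Lemma hermiteTD f1 f2 : schC f1 -> schC f2 -> hermiteT (f1 + f2) = hermiteT f1 + hermiteT f2.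
Proof. by move=> s1 s2; have := hermiteT_linear 1 s1 s2; rewrite !scale1r. Qed.

Lemma rapidC0 : rapidC (0 : W).
Proof. by split; apply: (@rapid_finite _ _ _ [::]). Qed.

Lemma TinvC0 : TinvC (0 : W) = 0.
Proof.
apply/funext => x; rewrite /TinvC.
by rewrite !(@TR_finite _ _ _ [::]) // !big_nil.
Qed.

Lemma TinvCZ (k : C) c : rapidC c -> TinvC (k *: c) = k *: TinvC c.
Proof.
move=> rc; have := TinvC_linear k rc rapidC0.
by rewrite TinvC0 !addr0.
Qed.

Lemma TinvCD c1 c2 : rapidC c1 -> rapidC c2 -> TinvC (c1 + c2) = TinvC c1 + TinvC c2.
Proof. by move=> s1 s2; have := TinvC_linear 1 s1 s2; rewrite !scale1r. Qed.

Lemma TinvC_delta g : TinvC (deltaC g) = hermiteC g.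
Proof.
have H h : h \notin [:: g] -> deltaC g h = 0.
  by rewrite inE /deltaC => /negPf ->.
have D1 : deltaC g g = 1 by rewrite /deltaC eqxx.
apply/funext => x; rewrite /TinvC /hermiteC hermite_Hd.
rewrite !(@TR_finite _ _ _ [:: g]) //; try by move=> h /H; rewrite /reS /imS => ->.
by rewrite !big_cons !big_nil /reS /imS D1 /= !addr0 mul1r mul0r.
Qed.

Lemma hermiteC_E g : E (hermiteC g).
Proof. by rewrite -TinvC_delta; exact: Tinv_FE. Qed.

Lemma top_iso_hermiteT : top_iso E csE F csF (@hermiteT R d).
Proof.
split; [exact: T_EF|split].
  by move=> k x y Ex Ey; apply: hermiteT_linear; exact: E_sch.
exists (@TinvC R d); split; first exact: Tinv_FE.
split; first by move=> f Ef; apply: TinvC_hermiteT; [exact: E_sch|apply: F_rapid; exact: T_EF].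
split; first by move=> c Fc; apply: hermiteT_TinvC; exact: F_rapid.
split.
  move=> q csq; apply: T_cont => //; have [q0 [qD qZ]] := csF_seminorm csq.
  split; first by move=> f Ef /=; apply: q0; exact: T_EF.
  split=> [f1 f2 E1 E2|k f Ef] /=.
    by rewrite hermiteTD; [apply: qD; exact: T_EF|exact: E_sch..].
  by rewrite hermiteTZ; [apply: qZ; exact: T_EF|exact: E_sch].
move=> p csp; apply: Tinv_cont => //; have [p0 [pD pZ]] := csE_seminorm csp.
split; first by move=> c Fc /=; apply: p0; exact: Tinv_FE.
split=> [c1 c2 F1 F2|k c Fc] /=.
  by rewrite TinvCD; [apply: pD; exact: Tinv_FE|exact: F_rapid..].
by rewrite TinvCZ; [apply: pZ; exact: Tinv_FE|exact: F_rapid].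
Qed.

Lemma xi_seminorm g : csE (fun f => cmod (hcoef g f)).
Proof.
apply: xi_cont; split; first by move=> f _; exact: cmod_ge0.
split=> [f1 f2 E1 E2|k f Ef].
  have -> : hcoef g (f1 + f2) = hcoef g f1 + hcoef g f2.
    by have := congr1 (fun c => c g) (hermiteTD (E_sch E1) (E_sch E2)).
  exact: cmodD.
have -> : hcoef g (k *: f) = k * hcoef g f.
  by have := congr1 (fun c => c g) (hermiteTZ k (E_sch Ef)).
exact: cmodM.
Qed.

Lemma sum_hermite_TinvC (c : W) (s : seq (mindex d)) : uniq s ->
  \sum_(g <- s) c g *: hermiteC g = TinvC (fun g => if g \in s then c g else 0).
Proof.
move=> us; apply/funext => x; rewrite fct_sumE /TinvC.
rewrite !(@TR_finite _ _ _ s) //; try by move=> h hs; rewrite /reS /imS (negPf hs).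
have -> : \sum_(g <- s) reS (fun g0 => if g0 \in s then c g0 else 0) g * Hd g x =
          \sum_(g <- s) complex.Re (c g) * Hd g x.
  by apply: eq_big_seq => g gs; rewrite /reS gs.
have -> : \sum_(g <- s) imS (fun g0 => if g0 \in s then c g0 else 0) g * Hd g x =
          \sum_(g <- s) complex.Im (c g) * Hd g x.
  by apply: eq_big_seq => g gs; rewrite /imS gs.
elim: s {us} => [|g s IH]; first by rewrite !big_nil.
rewrite !big_cons IH -[(c g *: hermiteC g) x]/(c g * hermiteC g x) /hermiteC hermite_Hd.
by apply: complex_ext; rewrite ?ReD ?ImD ?ReM ?ImM /= ?mulr0 ?subr0 ?add0r.
Qed.

Lemma partial_rapidC (c : W) (P : pred (mindex d)) : rapidC c ->
  rapidC (fun g => if P g then c g else 0).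
Proof.
move=> [r i]; have [r1 r2] := (rapid_restr P r, rapid_restr P i).
have E1 : reS (fun g => if P g then c g else 0) = mrestr P (reS c).
  by apply/funext => g; rewrite /reS /mrestr; case: (P g).
have E2 : imS (fun g => if P g then c g else 0) = mrestr P (imS c).
  by apply/funext => g; rewrite /imS /mrestr; case: (P g).
by split; rewrite ?E1 ?E2.
Qed.

Lemma hermite_expansion f : E f ->
  sum_converges csE (fun g => hermiteT f g *: hermiteC g) f.
Proof.
move=> Ef p csp eps eps0.
have Fc := T_EF Ef; set c := hermiteT f in Fc *.
have [D D0 HD] := restr_bound Fc csp.
(* Dividing by D + 1 allows for D = 0 and makes the final inequality strict. *)
have tau0 : 0 < eps / (D + 1) by rewrite divr_gt0 // ltr_wpDl.
have [F0 HF0] := @w2_tail R d _ tau0.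
exists F0 => s us F0s.
have -> : f - \sum_(g <- s) c g *: hermiteC g = TinvC (fun g => if g \notin s then c g else 0).
  rewrite sum_hermite_TinvC // -{1}(TinvC_hermiteT (E_sch Ef) (F_rapid Fc)) -/c.
  have rc := F_rapid Fc.
  have Ec : c = (fun g => if g \in s then c g else 0) + (fun g => if g \notin s then c g else 0).
    apply/funext => g; rewrite -[RHS]/(_ + _ : C) /=.
    by case: (g \in s) => /=; rewrite ?addr0 ?add0r.
  rewrite {1}Ec TinvCD; [|exact: partial_rapidC|exact: partial_rapidC].
  by rewrite addrC addKr.
have Hr : restr_of (fun g => if g \notin s then c g else 0) c.
  by move=> g; case: (g \in s) => /=; [right|left].
have Hs : supp_w2 (fun g => if g \notin s then c g else 0) (eps / (D + 1)).
  move=> r ur Hr'; apply: HF0 => // g /Hr'; case: ifP => [gs _|_]; last by rewrite eqxx.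
  by apply: contra gs; exact: F0s.
have [_ /le_lt_trans] := HD _ _ Hr (ltW tau0) Hs; apply.
by rewrite mulrCA gtr_pMr // ltr_pdivrMr ?ltr_wpDl // mul1r ltrDl.
Qed.

(** The seminorm given by the g-th coefficient is continuous, and every partial sum whose index set
    contains g has g-th coefficient exactly [c g]. *)
Lemma hermite_coef_unique f (c : W) : E f ->
  sum_converges csE (fun g => c g *: hermiteC g) f -> c = hermiteT f.
Proof.
move=> Ef Hc; apply/funext => g.
have := Hc _ (xi_seminorm g) => H.
suff : cmod (hermiteT f g - c g) = 0.
  by move/cmod_eq0/eqP; rewrite subr_eq0 => /eqP.
apply/eqP; rewrite eq_le cmod_ge0 andbT; apply/ler_addgt0Pr => e e0; rewrite add0r.
have [F0 HF0] := H e e0.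
pose s := undup (g :: F0); have us : uniq s by exact: undup_uniq.
have gs : g \in s by rewrite mem_undup mem_head.
have := HF0 s us _; rewrite sum_hermite_TinvC // => /(_ _)/ltW.
have rs : rapidC (fun h => if h \in s then c h else 0).
  by split; apply: (@rapid_finite _ _ _ s) => h /negPf hs; rewrite /reS /imS hs.
have -> : hcoef g (f - TinvC (fun h => if h \in s then c h else 0)) = hermiteT f g - c g.
  have -> : f - TinvC (fun h => if h \in s then c h else 0) =
     (-1) *: TinvC (fun h => if h \in s then c h else 0) + f by rewrite scaleN1r addrC.
  have := congr1 (fun c => c g) (hermiteT_linear (-1) (schC_TinvC rs) (E_sch Ef)).
  rewrite hermiteT_TinvC // => H'; apply: (etrans H').
  rewrite -[LHS]/(-1 * (if g \in s then c g else 0) + hermiteT f g) gs mulN1r.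
  by rewrite addrC.
apply; move=> h hF; by rewrite mem_undup inE hF orbT.
Qed.

Lemma abs_schauder_hermite : abs_schauder_basis E csE (@hermiteC R d).
Proof.
split; first exact: hermiteC_E.
split.
  move=> f Ef; exists (hermiteT f); split; first exact: hermite_expansion.
  by move=> c'; exact: hermite_coef_unique.
split.
  move=> g; exists (fun f => cmod (hcoef g f)); split; first exact: xi_seminorm.
  by move=> f c Ef /(hermite_coef_unique Ef) ->.
move=> f c p Ef /(hermite_coef_unique Ef) -> csp.
have Fc := T_EF Ef; set c0 := hermiteT f in Fc *.
have [D D0 HD] := restr_bound Fc csp.
have [_ [_ pZ]] := csE_seminorm csp.
exists (D * 2 ^+ d) => s us.
apply: (@le_trans _ _ (\sum_(g <- s) D * w2 R g)).
  apply: ler_sum => g _; rewrite -pZ; last exact: hermiteC_E.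
  (* A single term is the series of the restriction to {g}, whose support has mass at most [w2 g].
     The bounds on the terms are thereby summable. *)
  have -> : c0 g *: hermiteC g = TinvC (fun h => if h \in [:: g] then c0 h else 0).
    by rewrite -sum_hermite_TinvC // big_cons big_nil addr0.
  have Hr : restr_of (fun h => if h \in [:: g] then c0 h else 0) c0.
    by move=> h; case: ifP => _; [left|right].
  have Hs : supp_w2 (fun h => if h \in [:: g] then c0 h else 0) (w2 R g).
    move=> r ur Hr'.
    have sub : {subset r <= [:: g]}.
      by move=> h /Hr'; case: ifP => // _; rewrite eqxx.
    apply: le_trans (big_subset_le ur _ sub (@w2_ge0 R d)) _ => //.
    by rewrite big_cons big_nil addr0.
  by have [] := HD _ _ Hr (w2_ge0 _ _) Hs.
rewrite -mulr_sumr; apply: ler_wpM2l => //; exact: sum_w2_le.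
Qed.

End AbstractBasis.

(** * Norm estimates between steps of a weight matrix *)

Section Instances.
Variables (R : realType) (d : nat).
Local Notation C := (complex R).
Implicit Types (N : mindex d -> R) (f : 'rV[R]_d -> C) (c : mindex d -> C) (a b g : mindex d).

Lemma snorm_le_ge0 N h K f : (forall a, 0 < N a) -> snorm_le N h K f -> 0 <= K.
Proof.
move=> N0 H; have := H (Defs.mzero d) (Defs.mzero d) 0; rewrite monom_mzero normr1 mul1r.
rewrite madd0m mlen_mzero expr0 mulr1 => /(le_trans (cmod_ge0 _)).
by rewrite pmulr_lge0.
Qed.

Lemma snorm_le_parts N h K f a b (x : 'rV[R]_d) : snorm_le N h K f ->
  `|monom x a| * `|pders b (reF f) x| <= K * h ^+ mlen (madd a b) * N (madd a b) /\
  `|monom x a| * `|pders b (imF f) x| <= K * h ^+ mlen (madd a b) * N (madd a b).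
Proof.
move=> /(_ a b x) H; split; apply: le_trans H; apply: ler_wpM2l => //.
  exact: (Re_le_cmod (pdersC b f x)).
exact: (Im_le_cmod (pdersC b f x)).
Qed.

Lemma snorm_sch N h K f : smoothC f -> snorm_le N h K f -> schC f.
Proof.
move=> [s1 s2] H; split; apply/schP; split=> // a b;
exists (K * h ^+ mlen (madd a b) * N (madd a b)) => x; by case: (snorm_le_parts a b x H).
Qed.

Lemma lnorm_le_ge0 N h K c : 0 < h -> (forall a, 0 < N a) -> lnorm_le N h K c -> 0 <= K.
Proof.
move=> h0 N0 /(lnorm_leP _ _ h0 N0) /(_ (Defs.mzero d) (Defs.mzero d)).
rewrite sqpow_mzero mulr1 => /(le_trans (cmod_ge0 _)).
by rewrite -mulrA pmulr_lge0 // mulr_gt0 // exprn_gt0.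
Qed.

Lemma lnorm_le_mono N N' h h' K c : 0 < h -> h <= h' -> (forall a, 0 < N a) ->
  (forall a, N a <= N' a) -> lnorm_le N h K c -> lnorm_le N' h' K c.
Proof.
move=> h0 hh N0 NN H; have K0 := lnorm_le_ge0 h0 N0 H.
have N0' a : 0 < N' a by apply: lt_le_trans (NN a).
apply/(lnorm_leP _ _ (lt_le_trans h0 hh) N0') => a b.
apply: le_trans ((lnorm_leP _ _ h0 N0).1 H a b) _; rewrite -!mulrA; apply: ler_wpM2l => //.
apply: ler_pM => //; first by rewrite exprn_ge0 // ltW.
  by rewrite ltW.
by apply: lerXn2r; rewrite ?nnegrE ?(ltW h0) // ltW // (lt_le_trans h0 hh).
Qed.

Lemma lnorm_le_restr N h K c c' : 0 < h -> (forall a, 0 < N a) -> restr_of c' c ->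
  lnorm_le N h K c -> lnorm_le N h K c'.
Proof.
move=> h0 N0 Hr H; have K0 := lnorm_le_ge0 h0 N0 H.
apply/(lnorm_leP _ _ h0 N0) => a b; have [->|->] := Hr a.
  exact: (lnorm_leP _ _ h0 N0).1.
by rewrite cmod0 mul0r !mulr_ge0 ?exprn_ge0 // ltW.
Qed.

Lemma cmod_apply_le N h K c g : 0 < h -> (forall a, 0 < N a) -> N (Defs.mzero d) = 1 ->
  lnorm_le N h K c -> cmod (c g) <= K.
Proof.
move=> h0 N0 N1 /(lnorm_leP _ _ h0 N0) /(_ g (Defs.mzero d)).
by rewrite sqpow_mzero mlen_mzero N1 !mulr1.
Qed.

Definition estT N h N2 h2 := exists2 D, 0 <= D & forall K f, schC f ->
  snorm_le N h K f -> lnorm_le N2 h2 (D * K) (hermiteT f).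
Definition estTinv N h N2 h2 := exists2 D, 0 <= D & forall K c, lnorm_le N h K c ->
  rapidC c /\ forall tau, 0 <= tau -> supp_w2 c tau -> snorm_le N2 h2 (D * K * tau) (TinvC c).

(** The slack between h and h1 is for the Roumieu case, where the constant in the first condition is
    imposed and h has to be raised to it. *)
Lemma estT_cond N N' N'' h h1 H B D A : 0 < h -> h <= h1 -> 0 < H -> 0 < B -> 0 < D -> 0 < A ->
  (forall a, 0 < N a) -> (forall a, 0 < N' a) -> (forall a, 0 < N'' a) ->
  cond1 N N' h1 H B -> cond2 N' N'' D A -> estT N h N'' (3 * (expR 1 * H * h1) * A).
Proof.
move=> h0 hh H0 B0 D0 A0 N0 N0' N0'' C1 C2.
have h10 : 0 < h1 by apply: lt_le_trans hh.
have h20 : 0 < 3 * (expR 1 * H * h1) * A by rewrite !mulr_gt0 // expR_gt0.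
have W (P : mindex d -> R) : (forall a, 0 < P a) -> forall a, 0 <= P a by move=> HP a; exact: ltW.
have [Q Q0 HQ] := xi_weighted (ltW h10) (ltW H0) (ltW B0) (ltW D0) (ltW A0)
  (W _ N0) (W _ N0') (W _ N0'') C1 C2.
exists (2 * Q); first by rewrite mulr_ge0.
move=> K f [sr si] Hf; have K0 := snorm_le_ge0 N0 Hf.
apply/(lnorm_leP _ _ h20 N0'') => a b; rewrite /hermiteT hcoefE.
have up a' b' : K * h ^+ mlen (madd a' b') * N (madd a' b') <=
               K * h1 ^+ mlen (madd a' b') * N (madd a' b').
  apply: ler_wpM2r; first exact: ltW.
  apply: ler_wpM2l => //; apply: lerXn2r; rewrite ?nnegrE ?(ltW h0) ?(ltW h10) //.
have Hr a' b' x : `|monom x a'| * `|pders b' (reF f) x| <=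
               K * h1 ^+ mlen (madd a' b') * N (madd a' b').
  by apply: le_trans (up _ _); case: (snorm_le_parts a' b' x Hf).
have Hi a' b' x : `|monom x a'| * `|pders b' (imF f) x| <=
               K * h1 ^+ mlen (madd a' b') * N (madd a' b').
  by apply: le_trans (up _ _); case: (snorm_le_parts a' b' x Hf).
have X1 := HQ K _ K0 sr Hr a b; have X2 := HQ K _ K0 si Hi a b.
apply: le_trans (ler_wpM2r (sqpow_ge0 _ _ _) (cmod_le _)) _ => /=.
rewrite mulrDl; apply: le_trans (lerD X1 X2) _.
by rewrite le_eqVlt; apply/orP; left; apply/eqP; ring.
Qed.

Lemma estTinv_cond N N' N'' h h1 H B D A : 0 < h -> h <= h1 -> 0 < H -> 0 < B -> 0 < D -> 0 < A ->
  (forall a, 0 < N a) -> (forall a, 0 < N'' a) ->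
  cond1 N N' h1 H B -> cond2 N' N'' D A -> estTinv N h N'' (2 * (2 * H * h1) * A).
Proof.
move=> h0 hh H0 B0 D0 A0 N0 N0'' C1 C2.
have h10 : 0 < h1 by apply: lt_le_trans hh.
have [Q Q0 HQ] := TR_weighted (ltW h10) (ltW H0) (ltW B0) (ltW D0) (ltW A0)
  (fun a => ltW (N0'' a)) C1 C2.
exists (2 * Q); first by rewrite mulr_ge0.
move=> K c Hc; have K0 := lnorm_le_ge0 h0 N0 Hc.
have Hc1 := (lnorm_leP _ _ h10 N0).1 (lnorm_le_mono h0 hh N0 (fun a => lexx _) Hc).
have Hr g b : `|reS c g| * sqpow R g b <= K * h1 ^+ mlen b * N b.
  by apply: le_trans (Hc1 g b); apply: ler_wpM2r; [exact: sqpow_ge0|exact: Re_le_cmod].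
have Hi g b : `|imS c g| * sqpow R g b <= K * h1 ^+ mlen b * N b.
  by apply: le_trans (Hc1 g b); apply: ler_wpM2r; [exact: sqpow_ge0|exact: Im_le_cmod].
have [r1 X1] := HQ K _ K0 Hr; have [r2 X2] := HQ K _ K0 Hi.
split=> // tau t0 Ht a b x.
have {}X1 := X1 tau _ a b x; have {}X2 := X2 tau _ a b x.
apply: le_trans (ler_wpM2l (normr_ge0 _) (cmod_le _)) _.
rewrite mulrDr; apply: le_trans (lerD (X1 _) (X2 _)) _.
- move=> s us Hs; apply: Ht => // g /Hs; apply: contra => /eqP.
  by rewrite /reS => ->.
- move=> s us Hs; apply: Ht => // g /Hs; apply: contra => /eqP.
  by rewrite /imS => ->.
by rewrite le_eqVlt; apply/orP; left; apply/eqP; ring.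
Qed.

(** After squaring, in each coordinate: g^b <= b! e^g <= b^b e^(2g). *)
Lemma sqpow_le_mpow_half g b : sqpow R g b <= expR 1 ^+ mlen g * mpow_half R b.
Proof.
rewrite /sqpow /mlen expr_sum /mpow_half -big_split /=; apply: ler_prod => j _.
rewrite exprn_ge0 ?sqrtr_ge0 //=.
have e0 : 0 <= expR 1 ^+ g j :> R by rewrite exprn_ge0 // expR_ge0.
rewrite -(@ler_pXn2r _ 2) ?nnegrE ?mulr_ge0 ?exprn_ge0 ?sqrtr_ge0 //.
rewrite exprMn -!exprM ![(b j * 2)%N]mulnC ![(2 * b j)%N]mulnC ![_ ^+ (b j * 2)]exprM.
rewrite ![(_ ^+ b j) ^+ 2]exprAC !sqr_sqrtr //.
apply: le_trans (pow_fact_le_expR (b j) _) _ => //.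
rewrite mulrC; apply: ler_pM; rewrite ?expR_ge0 //.
  rewrite -[X in expR X]mulr1 expRM_natl; apply: ler_weXn2l; last by rewrite leq_pmulr.
  by rewrite -expR0 ler_expR.
by rewrite -natrX ler_nat; exact: fact_le_pow.
Qed.

(** With second index 0, [cond1] says that the weights grow at least like b^(b/2) up to geometric
    factors. This puts the unit sequences into the sequence space, hence the Hermite functions into
    the function space. *)
Lemma lnorm_delta N N' h H B g : 0 < h -> 0 < H -> (forall a, 0 < N' a) ->
  N (Defs.mzero d) = 1 -> cond1 N N' h H B ->
  lnorm_le N' (h * H) (expR 1 ^+ mlen g * B) (deltaC R g).
Proof.
move=> h0 H0 N0' N1 C1.
apply/(lnorm_leP _ _ (mulr_gt0 h0 H0) N0') => a b.
have C := C1 b (Defs.mzero d); rewrite N1 mulr1 maddC madd0m in C.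
have X : sqpow R g b <= expR 1 ^+ mlen g * B * (h * H) ^+ mlen b * N' b.
  apply: le_trans (sqpow_le_mpow_half g b) _.
  apply: le_trans (ler_wpM2l _ C) _; first by rewrite exprn_ge0 // expR_ge0.
  by rewrite exprMn le_eqVlt; apply/orP; left; apply/eqP; ring.
rewrite /deltaC; case: eqVneq => [->|_].
  by rewrite /cmod /= expr1n expr0n addr0 sqrtr1 mul1r.
by rewrite cmod0 mul0r; apply: le_trans X; exact: sqpow_ge0.
Qed.

Definition cond2len N N' p A := forall a b, (mlen a <= p)%N ->
  N (madd a b) <= A ^+ (mlen b).+1 * N' b.

(** Removing one unit from a costs A1^(|a| + |b|) with |a| <= p + 1, hence at most
    A1^((p+1)(|b|+1)). For fixed p the total cost stays geometric in |b|. *)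
Lemma cond2len_step N1 N2 N3 p A1 A2 : 1 <= A1 -> 1 <= A2 -> (forall a, 0 <= N3 a) ->
  (forall a (j : 'I_d), N1 (madd a (munit j)) <= A1 ^+ (mlen a).+1 * N2 a) ->
  (forall a, N1 a <= N3 a) -> cond2len N2 N3 p A2 -> cond2len N1 N3 p.+1 (A1 ^+ p.+1 * A2).
Proof.
move=> A11 A21 N30 H1 N13 H2 a b ap.
have A3 : 1 <= A1 ^+ p.+1 * A2 by rewrite mulr_ege1 // exprn_ege1.
have [a0|an0] := eqVneq a (Defs.mzero d).
  rewrite a0 madd0m; apply: le_trans (N13 b) _.
  by rewrite ler_peMl // exprn_ege1.
have [j aj] : exists j, a j != 0%N.
  apply/existsP; apply: contraNT an0 => /existsPn H; apply/eqP/ffunP => j.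
  by have := H j; rewrite negbK ffunE => /eqP.
pose a' : mindex d := [ffun i => (a i - (i == j))%N].
have aE : a = madd a' (munit j).
  by apply/ffunP => i; rewrite !ffunE; case: eqVneq => [->|_] /=; lia.
have la : mlen a = (mlen a').+1.
  rewrite {1}aE mlen_madd /mlen -/(mlen a') -addn1; congr addn.
  by rewrite (bigD1 j) //= ffunE eqxx big1 // => i /negPf ij; rewrite ffunE ij.
have la' : (mlen a' <= p)%N by rewrite -ltnS -la.
have -> : madd a b = madd (madd a' b) (munit j).
  by rewrite aE; apply/ffunP => i; rewrite !ffunE; lia.
apply: le_trans (H1 _ j) _; rewrite mlen_madd.
have A10 : 0 <= A1 by apply: le_trans A11.
apply: le_trans (ler_wpM2l (exprn_ge0 _ A10) (H2 a' b la')) _.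
rewrite mulrA exprMn; apply: ler_wpM2r => //; apply: ler_wpM2r.
  by rewrite exprn_ge0 // (le_trans _ A21).
rewrite -exprM; apply: ler_weXn2l => //; nia.
Qed.

Lemma cond2len_cond2 N N' A : 0 < A -> cond2len N N' (d * 6) A -> cond2 N N' A A.
Proof.
move=> A0 H a b Ha; rewrite -exprS; apply: H.
by rewrite /mlen -[X in (_ <= X * 6)%N](card_ord d) -sum_nat_const leq_sum.
Qed.

Section Matrix.
Variable M : R -> mindex d -> R.
Hypothesis wM : weight_matrix M.

Lemma wM_gt0 l a : 0 < l -> 0 < M l a. Proof. by case: wM => H _ l0; exact: H. Qed.
Lemma wM_1 l : 0 < l -> M l (Defs.mzero d) = 1. Proof. by case: wM => _ [H _]; exact: H. Qed.
Lemma wM_mono l k a : 0 < l -> l <= k -> M l a <= M k a.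
Proof. by case: wM => _ [_ H] l0 lk; exact: H. Qed.

Lemma supp_w2_all (c : mindex d -> C) : supp_w2 c (2 ^+ d).
Proof. by move=> s us _; exact: sum_w2_le. Qed.

Lemma smoothC_TinvC (c : mindex d -> C) : rapidC c -> smoothC (TinvC c).
Proof. by move=> /schC_TinvC[s1 s2]; split; exact: sch_smooth. Qed.

(** * Roumieu case: the target step is found from the source step *)

Section Roumieu.
Hypothesis (R1 : condR1 M) (R2 : condR2 M).

Lemma condR2_iter p l : 0 < l -> exists k A, l <= k /\ 1 <= A /\ cond2len (M l) (M k) p A.
Proof.
elim: p l => [|p IH] l l0.
  exists l, 1; split=> //; split=> // a b; rewrite leqn0 expr1n mul1r => /eqP a0.
  suff -> : a = Defs.mzero d by rewrite madd0m.
  apply/ffunP => j; rewrite ffunE; apply/eqP; rewrite -leqn0 -a0.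
  by rewrite /mlen (bigD1 j) //= leq_addr.
have [k1 [A1 [lk1 [A11 H1]]]] := R2 l0.
have k10 := lt_le_trans l0 lk1.
have [k2 [A2 [k12 [A21 H2]]]] := IH k1 k10.
have k20 := lt_le_trans k10 k12.
exists k2, (A1 ^+ p.+1 * A2); split; first exact: le_trans lk1 k12.
split; first by rewrite mulr_ege1 // exprn_ege1.
apply: (@cond2len_step _ (M k1)) => // a; first exact: ltW (wM_gt0 a k20).
by apply: wM_mono => //; exact: le_trans k12.
Qed.

Lemma roumieu_cond l h : 0 < l -> 0 < h -> exists k1 k2 h1 H B D A,
  [/\ l <= k1, k1 <= k2, h <= h1, 0 < H & 0 < B] /\
  [/\ 0 < D, 0 < A, cond1 (M l) (M k1) h1 H B & cond2 (M k1) (M k2) D A].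
Proof.
move=> l0 h0; have [k [B [Q [H [lk [B0 [Q0 [H0 HH]]]]]]]] := R1 l0.
have k0 := lt_le_trans l0 lk.
have [k2 [A [kk2 [A1 HA]]]] := condR2_iter (d * 6) k0.
have A0 : 0 < A by apply: lt_le_trans A1.
(* The given h may lie below the constant of the first condition; the larger of the two serves both
   purposes. *)
exists k, k2, (Num.max h Q), H, B, A, A; split; first by split; rewrite // le_max lexx.
split=> //; last exact: cond2len_cond2.
move=> a b; apply: le_trans (HH a b) _.
have m0 := ltW (wM_gt0 (madd a b) k0).
apply: ler_wpM2r => //; apply: ler_wpM2r; first by rewrite exprn_ge0 // ltW.
apply: ler_wpM2l; first exact: ltW.
by apply: lerXn2r; rewrite ?nnegrE ?le_max ?(ltW Q0) ?orbT // lexx orbT.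
Qed.

Lemma roumieu_estT l h : 0 < l -> 0 < h -> exists k h2, [/\ 0 < k, 0 < h2 & estT (M l) h (M k) h2].
Proof.
move=> l0 h0.
have [k1 [k2 [h1 [H [B [D [A [[lk1 k12 hh H0 B0] [D0 A0 C1 C2]]]]]]]]] := roumieu_cond l0 h0.
have k10 := lt_le_trans l0 lk1; have k20 := lt_le_trans k10 k12.
exists k2, (3 * (expR 1 * H * h1) * A); split=> //.
  by rewrite !mulr_gt0 ?expR_gt0 // (lt_le_trans h0 hh).
by apply: (estT_cond _ _ _ _ _ _ _ _ _ C1 C2) => // a; exact: wM_gt0.
Qed.

Lemma roumieu_estTinv l h : 0 < l -> 0 < h ->
  exists k h2, [/\ 0 < k, 0 < h2 & estTinv (M l) h (M k) h2].
Proof.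
move=> l0 h0.
have [k1 [k2 [h1 [H [B [D [A [[lk1 k12 hh H0 B0] [D0 A0 C1 C2]]]]]]]]] := roumieu_cond l0 h0.
have k10 := lt_le_trans l0 lk1; have k20 := lt_le_trans k10 k12.
exists k2, (2 * (2 * H * h1) * A); split=> //.
  by rewrite !mulr_gt0 // (lt_le_trans h0 hh).
by apply: (estTinv_cond _ _ _ _ _ _ _ _ C1 C2) => // a; exact: wM_gt0.
Qed.

Lemma SR_schC f : SR M f -> schC f.
Proof. by move=> [sf [l [h [K [_ [_ H]]]]]]; exact: snorm_sch H. Qed.

Lemma LR_rapidC c : LR M c -> rapidC c.
Proof.
move=> [l [h [K [l0 [h0 H]]]]]; have [k [h2 [_ _ [D _ HD]]]] := roumieu_estTinv l0 h0.
by have [] := HD K c H.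
Qed.

Lemma roumieu_main : abs_schauder_basis (SR M) (csSR M) (@hermiteC R d) /\
     top_iso (SR M) (csSR M) (LR M) (csLR M) (@hermiteT R d).
Proof.
have Fd g : LR M (deltaC R g).
  have [k1 [k2 [h1 [H [B [D [A [[lk1 k12 hh H0 B0] [D0 A0 C1 C2]]]]]]]]] := roumieu_cond ltr01 ltr01.
  have k10 := lt_le_trans ltr01 lk1; have h10 := lt_le_trans ltr01 hh.
  exists k1, (h1 * H), (expR 1 ^+ mlen g * B); split=> //; split; first by rewrite mulr_gt0.
  by apply: (lnorm_delta _ _ _ _ _ C1) => // [a|]; [exact: wM_gt0|exact: wM_1].
have TEF f : SR M f -> LR M (hermiteT f).
  move=> Ef; have sf := SR_schC Ef; case: Ef => _ [l [h [K [l0 [h0 H]]]]].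
  have [k [h2 [k0 h20 [D D0 HD]]]] := roumieu_estT l0 h0.
  by exists k, h2, (D * K); split=> //; split=> //; exact: HD.
have TFE c : LR M c -> SR M (TinvC c).
  move=> [l [h [K [l0 [h0 H]]]]]; have [k [h2 [k0 h20 [D _ HD]]]] := roumieu_estTinv l0 h0.
  have [rc Hc] := HD K c H; split; first exact: smoothC_TinvC.
  exists k, h2, (D * K * 2 ^+ d); split=> //; split=> //.
  by apply: Hc; [exact: exprn_ge0|exact: supp_w2_all].
have Tc q : seminorm_on (SR M) (q \o @hermiteT R d) -> csLR M q -> csSR M (q \o @hermiteT R d).
  move=> sq [_ Hq]; split=> // l h l0 h0.
  have [k [h2 [k0 h20 [D D0 HD]]]] := roumieu_estT l0 h0.
  (* Continuity on the sequence space is tested on the integer steps, so both parameters are raised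
     to one integer; this only weakens the norm. *)
  pose j := (Num.trunc (Num.max k h2)).+1.
  have jm : Num.max k h2 <= j%:R by exact: ltW (truncnS_gt _).
  have kj : k <= j%:R by apply: le_trans jm; rewrite le_max lexx.
  have hj : h2 <= j%:R by apply: le_trans jm; rewrite le_max lexx orbT.
  have [Cst HC] := Hq j (ltn0Sn _); exists (Cst * D) => f K Ef Hf.
  rewrite -mulrA; apply: HC; first exact: TEF.
  apply: (lnorm_le_mono h20 hj _ _ (HD K f (SR_schC Ef) Hf)) => a; first exact: wM_gt0.
  exact: wM_mono.
have Tic p : seminorm_on (LR M) (p \o @TinvC R d) -> csSR M p -> csLR M (p \o @TinvC R d).
  move=> sp [_ Hp]; split=> // j j0.
  have j0' : 0 < j%:R :> R by rewrite ltr0n.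
  have [k [h2 [k0 h20 [D D0 HD]]]] := roumieu_estTinv j0' j0'.
  have [Cst HC] := Hp k h2 k0 h20; exists (Cst * (D * 2 ^+ d)) => c K Fc Hc.
  have [rc Hc'] := HD K c Hc.
  rewrite -mulrA [D * 2 ^+ d * K]mulrAC; apply: HC; first exact: TFE.
  by apply: Hc'; [exact: exprn_ge0|exact: supp_w2_all].
have Hre c p : LR M c -> csSR M p -> exists2 D, 0 <= D & forall c' tau, restr_of c' c ->
    0 <= tau -> supp_w2 c' tau -> SR M (TinvC c') /\ p (TinvC c') <= D * tau.
  move=> [l [h [K [l0 [h0 H]]]]] [[p0 _] Hp].
  have [k [h2 [k0 h20 [D D0 HD]]]] := roumieu_estTinv l0 h0.
  have [Cst HC] := Hp k h2 k0 h20.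
  have K0 := lnorm_le_ge0 h0 (fun a => wM_gt0 a l0) H.
  exists (`|Cst| * (D * K)); first by rewrite !mulr_ge0.
  move=> c' tau Hr t0 Ht.
  have H' := lnorm_le_restr h0 (fun a => wM_gt0 a l0) Hr H.
  have [rc Hc] := HD K c' H'; have Hs := Hc tau t0 Ht.
  have Es : SR M (TinvC c').
    split; first exact: smoothC_TinvC.
    by exists k, h2, (D * K * tau).
  split=> //; apply: le_trans (HC _ _ Es Hs) _.
  rewrite -[leRHS]mulrA; apply: ler_wpM2r; first by rewrite !mulr_ge0.
  exact: ler_norm.
have Hxi g : seminorm_on (SR M) (fun f => cmod (hcoef g f)) -> csSR M (fun f => cmod (hcoef g f)).
  move=> sx; split=> // l h l0 h0.
  have [k [h2 [k0 h20 [D D0 HD]]]] := roumieu_estT l0 h0.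
  exists D => f K Ef Hf.
  apply: (cmod_apply_le _ h20 _ _ (HD K f (SR_schC Ef) Hf)) => [a|]; first exact: wM_gt0.
  exact: wM_1.
split.
  by apply: (@abs_schauder_hermite _ _ _ _ (LR M)) => //;
    [exact: SR_schC|exact: LR_rapidC|move=> p []].
by apply: top_iso_hermiteT => //;
  [exact: SR_schC|exact: LR_rapidC|move=> p []|move=> q []].
Qed.

End Roumieu.

(** * Beurling case: the source step is found from the target step *)

Section Beurling.
Hypothesis (B1 : condB1 M) (B2 : condB2 M).

Lemma condB2_iter p l : 0 < l -> exists k A,
  0 < k /\ k <= l /\ 1 <= A /\ cond2len (M k) (M l) p A.
Proof.
move=> l0; elim: p => [|p [k2 [A2 [k20 [k2l [A21 H2]]]]]].
  exists l, 1; do 3![split=> //]; move=> a b; rewrite leqn0 expr1n mul1r => /eqP a0.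
  suff -> : a = Defs.mzero d by rewrite madd0m.
  apply/ffunP => j; rewrite ffunE; apply/eqP; rewrite -leqn0 -a0.
  by rewrite /mlen (bigD1 j) //= leq_addr.
have [k1 [A1 [k10 [k12 [A11 H1]]]]] := B2 k20.
exists k1, (A1 ^+ p.+1 * A2); split=> //; split; first exact: le_trans k12 k2l.
split; first by rewrite mulr_ege1 // exprn_ege1.
apply: (@cond2len_step _ (M k2)) => // a; first exact: ltW (wM_gt0 a l0).
by apply: wM_mono => //; exact: le_trans k2l.
Qed.

(** Working back from the target fixes A and then H before the free constant of the first condition
    is chosen, so h can be solved from r H h A = h2. The number r is the numerical factor of the
    estimate: 3e for T, 4 for its inverse. *)
Lemma beurling_cond k h2 r : 0 < k -> 0 < h2 -> 0 < r -> exists l k1 h H B D A,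
  [/\ 0 < l, l <= k1, k1 <= k, 0 < h & 0 < H] /\
  [/\ 0 < B, 0 < D, 0 < A, cond1 (M l) (M k1) h H B & cond2 (M k1) (M k) D A] /\
  r * (H * h * A) = h2.
Proof.
move=> k0 h20 r0; have [k1 [A [k10 [k1k [A1 HA]]]]] := condB2_iter (d * 6) k0.
have A0 : 0 < A by apply: lt_le_trans A1.
have [l [H [l0 [lk1 [H0 HH]]]]] := B1 k10.
pose h := h2 / (r * H * A).
have h0 : 0 < h by rewrite divr_gt0 // !mulr_gt0.
have [B [B0 HB]] := HH h h0.
exists l, k1, h, H, B, A, A; split=> //; split.
  by split=> //; exact: cond2len_cond2.
by rewrite /h; field; rewrite !gt_eqF.
Qed.

Lemma beurling_estT k h2 : 0 < k -> 0 < h2 -> exists l h, [/\ 0 < l, 0 < h & estT (M l) h (M k) h2].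
Proof.
move=> k0 h20; have r0 : 0 < 3 * expR 1 :> R by rewrite mulr_gt0 // expR_gt0.
have [l [k1 [h [H [B [D [A [[l0 lk1 k1k h0 H0] [[B0 D0 A0 C1 C2] E]]]]]]]]] :=
  beurling_cond k0 h20 r0.
have k10 := lt_le_trans l0 lk1.
exists l, h; split=> //.
have -> : h2 = 3 * (expR 1 * H * h) * A by rewrite -E; ring.
by apply: (estT_cond _ (lexx h) _ _ _ _ _ _ _ C1 C2) => // a; exact: wM_gt0.
Qed.

Lemma beurling_estTinv k h2 : 0 < k -> 0 < h2 ->
  exists l h, [/\ 0 < l, 0 < h & estTinv (M l) h (M k) h2].
Proof.
move=> k0 h20; have r0 : 0 < 4 :> R by [].
have [l [k1 [h [H [B [D [A [[l0 lk1 k1k h0 H0] [[B0 D0 A0 C1 C2] E]]]]]]]]] :=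
  beurling_cond k0 h20 r0.
exists l, h; split=> //.
have -> : h2 = 2 * (2 * H * h) * A by rewrite -E; ring.
by apply: (estTinv_cond _ (lexx h) _ _ _ _ _ _ C1 C2) => // a; exact: wM_gt0.
Qed.

Lemma SB_schC f : SB M f -> schC f.
Proof. by move=> [sf /(_ 1 1 ltr01 ltr01)[K H]]; exact: snorm_sch H. Qed.

Lemma LB_rapidC c : LB M c -> rapidC c.
Proof.
move=> Fc; have [l [h [l0 h0 [D _ HD]]]] := beurling_estTinv ltr01 ltr01.
by have [K /HD[]] := Fc l h l0 h0.
Qed.

Lemma beurling_main : abs_schauder_basis (SB M) (csSB M) (@hermiteC R d) /\
     top_iso (SB M) (csSB M) (LB M) (csLB M) (@hermiteT R d).
Proof.
have Fd g : LB M (deltaC R g).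
  move=> l h l0 h0; have [k [H [k0 [kl [H0 HH]]]]] := B1 l0.
  have hH : 0 < h / H by rewrite divr_gt0.
  have [B [B0 C1]] := HH _ hH; exists (expR 1 ^+ mlen g * B).
  have -> : h = h / H * H by rewrite divfK // gt_eqF.
  by apply: (lnorm_delta _ _ _ _ _ C1) => // [a|]; [exact: wM_gt0|exact: wM_1].
have TEF f : SB M f -> LB M (hermiteT f).
  move=> Ef; have sf := SB_schC Ef; case: Ef => _ Ef k h2 k0 h20.
  have [l [h [l0 h0 [D D0 HD]]]] := beurling_estT k0 h20.
  by have [K H] := Ef l h l0 h0; exists (D * K); exact: HD.
have TFE c : LB M c -> SB M (TinvC c).
  move=> Fc; split; first by apply: smoothC_TinvC; exact: LB_rapidC.
  move=> k h2 k0 h20; have [l [h [l0 h0 [D D0 HD]]]] := beurling_estTinv k0 h20.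
  have [K H] := Fc l h l0 h0; have [_ Hc] := HD K c H.
  by exists (D * K * 2 ^+ d); apply: Hc; [exact: exprn_ge0|exact: supp_w2_all].
have Tc q : seminorm_on (SB M) (q \o @hermiteT R d) -> csLB M q -> csSB M (q \o @hermiteT R d).
  move=> sq [_ [j [Cst [j0 Hq]]]]; split=> //.
  have j0' : 0 < j%:R^-1 :> R by rewrite invr_gt0 ltr0n.
  have [l [h [l0 h0 [D D0 HD]]]] := beurling_estT j0' j0'.
  exists l, h, (Cst * D); split=> //; split=> // f K Ef Hf.
  rewrite -mulrA; apply: Hq; first exact: TEF.
  by apply: HD => //; exact: SB_schC.
have Tic p : seminorm_on (LB M) (p \o @TinvC R d) -> csSB M p -> csLB M (p \o @TinvC R d).
  move=> sp [_ [k [h2 [Cst [k0 [h20 Hp]]]]]]; split=> //.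
  have [l [h [l0 h0 [D D0 HD]]]] := beurling_estTinv k0 h20.
  (* The sequence topology is given by the norms with both parameters 1/j; taking 1/j below l and h
     gives a stronger norm than the one needed. *)
  pose e := Num.min l h; have e0 : 0 < e by rewrite lt_min l0.
  pose j := (Num.trunc e^-1).+1.
  have j0 : 0 < j%:R :> R by [].
  have je : j%:R^-1 <= e.
    by rewrite -[e]invrK lef_pV2 ?posrE ?invr_gt0 //; exact: ltW (truncnS_gt _).
  have jl : j%:R^-1 <= l by apply: le_trans je _; rewrite ge_min lexx.
  have jh : j%:R^-1 <= h by apply: le_trans je _; rewrite ge_min lexx orbT.
  have jv0 : 0 < j%:R^-1 :> R by rewrite invr_gt0.
  exists j, (Cst * (D * 2 ^+ d)); split=> // c K Fc Hc.
  have Hc2 : lnorm_le (M l) h K c.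
    by apply: (lnorm_le_mono jv0 jh _ _ Hc) => a; [exact: wM_gt0|exact: wM_mono].
  have [rc Hc'] := HD K c Hc2.
  rewrite -mulrA [D * 2 ^+ d * K]mulrAC; apply: Hp; first exact: TFE.
  by apply: Hc'; [exact: exprn_ge0|exact: supp_w2_all].
have Hre c p : LB M c -> csSB M p -> exists2 D, 0 <= D & forall c' tau, restr_of c' c ->
    0 <= tau -> supp_w2 c' tau -> SB M (TinvC c') /\ p (TinvC c') <= D * tau.
  move=> Fc [_ [k [h2 [Cst [k0 [h20 Hp]]]]]].
  have [l [h [l0 h0 [D D0 HD]]]] := beurling_estTinv k0 h20.
  have [K H] := Fc l h l0 h0.
  have K0 := lnorm_le_ge0 h0 (fun a => wM_gt0 a l0) H.
  exists (`|Cst| * (D * K)); first by rewrite !mulr_ge0.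
  move=> c' tau Hr t0 Ht.
  (* Membership in the Beurling space involves every norm, whereas the bound on [p] uses a single
     one. *)
  have Fc' : LB M c'.
    move=> l' h' l0' h0'; have [K' H'] := Fc l' h' l0' h0'; exists K'.
    exact: (lnorm_le_restr h0' (fun a => wM_gt0 a l0') Hr H').
  have H' := lnorm_le_restr h0 (fun a => wM_gt0 a l0) Hr H.
  have [rc Hc] := HD K c' H'; have Hs := Hc tau t0 Ht.
  have Es := TFE c' Fc'; split=> //; apply: le_trans (Hp _ _ Es Hs) _.
  rewrite -[leRHS]mulrA; apply: ler_wpM2r; first by rewrite !mulr_ge0.
  exact: ler_norm.
have Hxi g : seminorm_on (SB M) (fun f => cmod (hcoef g f)) -> csSB M (fun f => cmod (hcoef g f)).
  move=> sx; split=> //.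
  have [l [h [l0 h0 [D D0 HD]]]] := beurling_estT ltr01 ltr01.
  exists l, h, D; split=> //; split=> // f K Ef Hf.
  apply: (cmod_apply_le _ ltr01 _ _ (HD K f (SB_schC Ef) Hf)) => [a|]; first exact: wM_gt0.
  exact: wM_1.
split.
  by apply: (@abs_schauder_hermite _ _ _ _ (LB M)) => //;
    [exact: SB_schC|exact: LB_rapidC|move=> p []].
by apply: top_iso_hermiteT => //;
  [exact: SB_schC|exact: LB_rapidC|move=> p []|move=> q []].
Qed.

End Beurling.
End Matrix.
End Instances.

Theorem theorem5p1 (R : realType) (d : nat) (M : R -> mindex d -> R) :
  (0 < d)%N -> weight_matrix M ->
  ((condR1 M /\ condR2 M) ->
     abs_schauder_basis (SR M) (csSR M) (@hermiteC R d) /\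
     top_iso (SR M) (csSR M) (LR M) (csLR M) (@hermiteT R d)) /\
  ((condB1 M /\ condB2 M) ->
     abs_schauder_basis (SB M) (csSB M) (@hermiteC R d) /\
     top_iso (SB M) (csSB M) (LB M) (csLB M) (@hermiteT R d)).
Proof.
move=> _ wM; split=> -[c1 c2]; first exact: roumieu_main.
exact: beurling_main.
Qed.
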